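(* Let $k\ge 0$ be an integer or half-integer, let $\mu$ be a $k$-FC measure, and let $\alpha,\beta\in\mathbb{Z}_+$ with $\alpha+\beta=2k$. Consider the sesquilinear form $$F(f,g)=\int_{\mathbb{C}}f^{(\alpha)}(z)\,\overline{g^{(\beta)}(z)}\,e^{-|z|^2}\,d\mu(z),\qquad f,g\in\mathcal{F}^2(\mathbb{C}).$$ This form is bounded in $\mathcal{F}^2(\mathbb{C})$; moreover, $$|F(f,g)|\le C(F)\,\|f\|_{\mathcal{F}^2}\|g\|_{\mathcal{F}^2}\quad\text{with}\quad C(F)\le\big(\varpi_\alpha(\mu)\,\varpi_\beta(\mu)\big)^{1/2}.$$
   Context: $\mathcal{F}^2(\mathbb{C})$ is the Fock space of entire functions $f$ with $\|f\|_{\mathcal{F}^2}^2=\int_{\mathbb{C}}|f(z)|^2\,d\nu(z)<\infty$, where $d\nu(z)=\pi^{-1}e^{-|z|^2}dV(z)$ and $dV$ is Lebesgue measure on $\mathbb{C}=\mathbb{R}^2$. $\mathbb{Z}_+=\{0,1,2,\dots\}$. Measures are complex-valued Borel measures on $\mathbb{C}$ that are locally finite (possibly of infinite total variation); $|\mu|$ denotes the variation of $\mu$. For an integer $k\ge0$, $\mu$ is called a $k$-FC measure (Fock-Carleson measure for derivatives of order $k$) if there is a constant $\varpi_k(\mu)<\infty$ such that $$\int_{\mathbb{C}}|f^{(k)}(z)|^2e^{-|z|^2}\,d|\mu|(z)\le\varpi_k(\mu)\|f\|_{\mathcal{F}^2}^2\quad\text{for all } f\in\mathcal{F}^2(\mathbb{C}).$$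 For integer $j\ge 0$, $\varpi_j(\mu)\in[0,\infty]$ denotes the least constant for which this inequality holds with $k=j$ ($\varpi_j(\mu)=\infty$ if there is none). For half-integer $k\ge 0$, $\mu$ is called a $k$-FC measure if $\sup_{z\in\mathbb{C}}|\mu|(B(z,\sqrt2))(1+|z|^2)^k<\infty$, where $B(z,r)$ is the disk of radius $r$ centered at $z$. *)

(* Defs.v *)
From HB Require Import structures.
From mathcomp Require Import all_boot all_order all_algebra.
From mathcomp Require Import complex.
From mathcomp Require Import all_classical all_reals all_analysis.

Set Implicit Arguments.
Unset Strict Implicit.
Unset Printing Implicit Defensive.

Import Order.TTheory GRing.Theory Num.Theory.
Import numFieldNormedType.Exports.

Local Open Scope classical_set_scope.
Local Open Scope complex_scope.
Local Open Scope ring_scope.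

Definition bounded_borel (R : realType) (A : set (R * R)) : Prop :=
  measurable A /\ bounded_set A.

(* A locally finite complex Borel measure on the plane: a countably additive
   complex function on the bounded Borel sets.  Only the values on bounded Borel
   sets are meaningful, so the total variation may be infinite.  The sets of the
   plane are subsets of R * R, whose product sigma-algebra is the Borel one. *)
Record complex_measure (R : realType) := ComplexMeasure {
  cmeas :> set (R * R) -> R[i] ;
  cmeas_sigma_additive : forall A : (set (R * R))^nat,
    (forall n, measurable (A n)) -> trivIset setT A ->
    bounded_set (\bigcup_n A n) ->
    (fun n => \sum_(i < n) cmeas (A i) : R[i]^o) @ \oo -->
      (cmeas (\bigcup_n A n) : R[i]^o)
}.

(* The supremum of sum_i phi (mu (B_i)) over the finite families of disjoint
   bounded Borel subsets B_i of A.  With phi the modulus this is |mu|(A); with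
   phi the positive part of the real part it is the positive variation of
   Re mu. *)
Definition phi_sums (R : realType) (phi : R[i] -> R) (mu : complex_measure R)
    (A : set (R * R)) : set (\bar R) :=
  [set x | exists n (B : (set (R * R))^nat),
     [/\ forall i, (i < n)%N -> bounded_borel (B i) /\ B i `<=` A,
         trivIset [set i | (i < n)%N] B
       & x = (\sum_(i < n) phi (mu (B i)))%:E]].

Definition phi_variation (R : realType) (phi : R[i] -> R)
    (mu : complex_measure R) (A : set (R * R)) : \bar R :=
  ereal_sup (phi_sums phi mu A).

Section phi_variation_measure.
Context (R : realType) (phi : R[i] -> R) (mu : complex_measure R).
Hypothesis phi_ge0 : forall w, 0 <= phi w.
Hypothesis phi_le : forall w, phi w <= Normc.normc w.
Hypothesis phiD : forall v w, phi (v + w) <= phi v + phi w.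

Let V := phi_variation phi mu.

Let normc0 : Normc.normc (0 : R[i]) = 0.
Proof. by rewrite /Normc.normc /= !expr0n /= addr0 sqrtr0. Qed.

Let phi0 : phi 0 = 0.
Proof. by apply/le_anti; rewrite phi_ge0 andbT -normc0 phi_le. Qed.

Let phi_sum n (F : nat -> R[i]) :
  phi (\sum_(i < n) F i) <= \sum_(i < n) phi (F i).
Proof.
elim: n => [|n IH]; first by rewrite !big_ord0 phi0.
by rewrite !big_ord_recr /=; apply: (le_trans (phiD _ _)); rewrite lerD2r.
Qed.

Let bounded_sub (A B : set (R * R)) :
  A `<=` B -> bounded_set B -> bounded_set A.
Proof.
move=> AB; rewrite /bounded_set /= /bounded_near; apply: filterS => M bM x /AB.
exact: bM.
Qed.

Let cmeas0 : mu set0 = 0.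
Proof.
have b0 : bounded_set (set0 : set (R * R)).
  by rewrite /bounded_set /= /bounded_near; near=> M => x.
have t0 : trivIset [set: nat] (fun=> set0 : set (R * R)).
  by move=> i j _ _ [x []].
have := @cmeas_sigma_additive R mu (fun=> set0) (fun=> measurable0) t0.
rewrite bigcup0// => /(_ b0) cv.
have cv1 : (fun n => \sum_(i < n.+1) mu set0 : R[i]^o) @ \oo -->
    (mu set0 : R[i]^o) by rewrite -cvg_shiftS in cv.
have cv2 : (fun n => \sum_(i < n.+1) mu set0 : R[i]^o) @ \oo -->
    (mu set0 + mu set0 : R[i]^o).
  have -> : (fun n => \sum_(i < n.+1) mu set0 : R[i]^o) =
      (fun n => (\sum_(i < n) mu set0 : R[i]^o) + (mu set0 : R[i]^o)).
    by apply/funext => n; rewrite big_ord_recr.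
  by apply: cvgD cv _; exact: cvg_cst.
have h : mu set0 + mu set0 = mu set0.
  have hd := @norm_hausdorff _ (R[i]^o : normedModType R[i]).
  exact: etrans (esym (cvg_lim hd cv2)) (cvg_lim hd cv1).
by apply: (addrI (mu set0)); rewrite addr0.
Unshelve. all: by end_near. Qed.

Let V_ge0 A : (0 <= V A)%E.
Proof.
apply: ereal_sup_ubound; exists 0%N, (fun=> set0); split=> //.
by rewrite big_ord0.
Qed.

Let V0 : V set0 = 0%E.
Proof.
apply/le_anti; rewrite V_ge0 andbT; apply: ge_ereal_sup => _ [n [B [HB _ ->]]].
rewrite lee_fin big1// => i _; have [_] := HB i (ltn_ord i).
by rewrite subset0 => ->; rewrite cmeas0 phi0.
Qed.

Let phi_series (A : (set (R * R))^nat) :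
  (forall n, measurable (A n)) -> trivIset setT A ->
  bounded_set (\bigcup_n A n) ->
  ((phi (mu (\bigcup_n A n)))%:E <= \sum_(0 <= n <oo) (phi (mu (A n)))%:E)%E.
Proof.
move=> mA tA bA; apply/lee_addgt0Pr => e e0.
have := @cmeas_sigma_additive R mu A mA tA bA.
move=> /cvgrPdist_lt /(_ (e%:C)%C); rewrite ltcR => /(_ e0) [N _ /(_ N (leqnn N))].
rewrite /= => hN.
set S := \sum_(i < N) _ in hN.
have {}hN : Normc.normc (mu (\bigcup_n A n) - S) < e by rewrite -ltcR.
rewrite -[mu _](subrK S).
apply: (@le_trans _ _ ((\sum_(i < N) phi (mu (A i)))%:E + e%:E)%E).
  rewrite -EFinD lee_fin [leRHS]addrC; apply: (le_trans (phiD _ _)).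
  apply: lerD; last exact: (phi_sum N (fun i => mu (A i))).
  exact: le_trans (phi_le _) (ltW hN).
rewrite leeD2r// -sumEFin.
rewrite -(big_mkord xpredT (fun i => (phi (mu (A i)))%:E)).
by apply: nneseries_lim_ge => n _ _; rewrite lee_fin.
Qed.

Let V_superadd (A A' : set (R * R)) : A `&` A' = set0 ->
  (V A + V A' <= V (A `|` A'))%E.
Proof.
move=> AA'0.
have key x x' : phi_sums phi mu A x -> phi_sums phi mu A' x' ->
    (x + x' <= V (A `|` A'))%E.
  move=> [n [B [HB tB ->]]] [n' [B' [HB' tB' ->]]].
  apply: ereal_sup_ubound.
  exists (n + n')%N, (fun i => if (i < n)%N then B i else B' (i - n)%N); split.
  - move=> i lti; case: ifPn => [/HB [bB BA]|].
      by split=> //; exact: subset_trans BA (@subsetUl _ _ _).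
    rewrite -leqNgt => nlei; have /HB' [bB BA] : (i - n < n')%N.
      by rewrite ltn_subLR.
    by split=> //; exact: subset_trans BA (@subsetUr _ _ _).
  - move=> i j /= lti ltj; case: ifPn => [ilt|]; case: ifPn => [jlt|].
    + exact: tB.
    + rewrite -leqNgt => nlej [y [By B'y]]; exfalso.
      have jn : (j - n < n')%N by rewrite ltn_subLR.
      have : (A `&` A') y.
        by split; [exact: (HB i ilt).2 | exact: (HB' _ jn).2].
      by rewrite AA'0.
    + rewrite -leqNgt => nlei [y [B'y By]]; exfalso.
      have jn : (i - n < n')%N by rewrite ltn_subLR.
      have : (A `&` A') y.
        by split; [exact: (HB j jlt).2 | exact: (HB' _ jn).2].
      by rewrite AA'0.
    + rewrite -!leqNgt => nlei nlej h.
      have /= := tB' (i - n)%N (j - n)%N.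
      rewrite !ltn_subLR// => /(_ lti ltj h) ij.
      by rewrite -(subnKC nlei) -(subnKC nlej) ij.
  - rewrite -EFinD big_split_ord /=; congr (_ + _)%:E.
      by apply: eq_bigr => i _; rewrite ltn_ord.
    by apply: eq_bigr => i _; rewrite ltnNge leq_addr /= addKn.
have [VA|VA] := eqVneq (V (A `|` A')) +oo%E; first by rewrite VA leey.
have VUfin : V (A `|` A') \is a fin_num.
  by rewrite ge0_fin_numE// ltey.
have s0 (D : set (R * R)) : phi_sums phi mu D 0%E.
  by exists 0%N, (fun=> set0); split=> //; rewrite big_ord0.
have xfin (D : set (R * R)) x : phi_sums phi mu D x -> x \is a fin_num.
  by move=> [n [B [_ _ ->]]].
have h1 x' : phi_sums phi mu A' x' -> (V A <= V (A `|` A') - x')%E.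
  move=> hx'; apply: ge_ereal_sup => x hx.
  by rewrite leeBrDr ?(xfin _ _ hx')// key.
have VAfin : V A \is a fin_num.
  rewrite ge0_fin_numE//; apply: le_lt_trans (h1 _ (s0 _)) _.
  by rewrite sube0 -ge0_fin_numE.
rewrite addeC -leeBrDr//; apply: ge_ereal_sup => x hx.
rewrite leeBrDr// addeC -leeBrDr ?(xfin _ _ hx)//; exact: h1.
Qed.

Let V_mono A A' : A `<=` A' -> (V A <= V A')%E.
Proof.
move=> AA'; apply: ereal_sup_le => _ [n [B [HB tB ->]]]; exists n, B; split=> //.
by move=> i /HB [bB BA]; split=> //; exact: subset_trans BA AA'.
Qed.

Let V_finsuperadd (A : (set (R * R))^nat) n : trivIset setT A ->
  (\sum_(0 <= i < n) V (A i) <= V (\bigcup_(i < n) A i))%E.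
Proof.
move=> tA; elim: n => [|n IH]; first by rewrite big_nil.
rewrite big_nat_recr//= bigcup_mkord big_ord_recr /= -bigcup_mkord.
apply: le_trans (V_superadd _).
  by rewrite leeD2r.
rewrite setI_bigcupl; apply/bigcup0P => i /= ltin.
apply/eqP/negPn/negP => /set0P /(tA i n I I) E.
by move: ltin; rewrite E ltnn.
Qed.

Lemma phi_variation_sigma_additive : semi_sigma_additive V.
Proof.
move=> A mA tA mUA.
suff -> : V (\bigcup_n A n) = (\sum_(0 <= n <oo) V (A n))%E.
  exact: is_cvg_nneseries.
apply/le_anti/andP; split; last first.
  apply: lime_le; first exact: is_cvg_nneseries.
  near=> n; apply: le_trans (V_finsuperadd _ tA) _.
  by apply: V_mono => x [i _ Aix]; exists i.
apply: ge_ereal_sup => _ [m [B [HB tB ->]]].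
rewrite -sumEFin.
have sub k (i : 'I_m) : B i `&` A k `<=` B i by move=> x [].
apply: (@le_trans _ _
    (\sum_(i < m) \sum_(0 <= k <oo) (phi (mu (B i `&` A k)))%:E)%E).
  apply: lee_sum => i _; have [[mBi bBi] BiA] := HB i (ltn_ord i).
  have {1}-> : B i = \bigcup_k (B i `&` A k).
    by rewrite -setI_bigcupr; apply/esym/setIidl.
  apply: phi_series.
  - by move=> k; exact: measurableI.
  - by apply: trivIset_setIl.
  - by apply: bounded_sub bBi; apply: bigcup_sub => k _; exact: sub.
rewrite -nneseries_sum; last by move=> *; rewrite lee_fin.
apply: lee_nneseries => [k _ _|k _].
  by rewrite sume_ge0// => *; rewrite lee_fin.
rewrite sumEFin; apply: ereal_sup_ubound; exists m, (fun i => B i `&` A k).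
split=> //.
- move=> i im; have [[mBi bBi] _] := HB i im; split; last by move=> x [].
  by split; [exact: measurableI|apply: bounded_sub bBi => x []].
- by apply: trivIset_setIr.
Unshelve. all: by end_near. Qed.

Lemma phi_variation0 : V set0 = 0%E. Proof. exact: V0. Qed.
Lemma phi_variation_ge0 A : (0 <= V A)%E. Proof. exact: V_ge0. Qed.

End phi_variation_measure.

Section variations.
Context (R : realType) (mu : complex_measure R).

Definition variation := phi_variation (@Normc.normc R) mu.

Definition re_pos_variation := phi_variation (fun w : R[i] => Num.max (complex.Re w) 0) mu.
Definition re_neg_variation := phi_variation (fun w : R[i] => Num.max (- complex.Re w) 0) mu.
Definition im_pos_variation := phi_variation (fun w : R[i] => Num.max (complex.Im w) 0) mu.
Definition im_neg_variation := phi_variation (fun w : R[i] => Num.max (- complex.Im w) 0) mu.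

Let normc_ge_Re (w : R[i]) : `|complex.Re w| <= Normc.normc w.
Proof.
by case: w => a b /=; rewrite -sqrtr_sqr ler_sqrt ?addr_ge0 ?sqr_ge0// lerDl sqr_ge0.
Qed.

Let normc_ge_Im (w : R[i]) : `|complex.Im w| <= Normc.normc w.
Proof.
by case: w => a b /=; rewrite -sqrtr_sqr ler_sqrt ?addr_ge0 ?sqr_ge0// lerDr sqr_ge0.
Qed.

Let normc_ge0 (w : R[i]) : 0 <= Normc.normc w.
Proof. by case: w => a b; exact: sqrtr_ge0. Qed.

Let pos_part_sub (x y : R) : Num.max (x + y) 0 <= Num.max x 0 + Num.max y 0.
Proof.
by rewrite ge_max lerD ?le_max ?lexx//= addr_ge0// le_max lexx orbT.
Qed.

Let pos_part_ge0 (x : R) : 0 <= Num.max x 0.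
Proof. by rewrite le_max lexx orbT. Qed.

Let max_le_normc (w : R[i]) (x : R) :
  `|x| <= Normc.normc w -> Num.max x 0 <= Normc.normc w.
Proof. by move=> h; rewrite ge_max normc_ge0 andbT (le_trans (ler_norm _) h). Qed.

Let normcD (v w : R[i]) :
  Normc.normc (v + w) <= Normc.normc v + Normc.normc w.
Proof. exact: le_normcD. Qed.

Let variation0 : variation set0 = 0%E.
Proof. by apply: phi_variation0. Qed.

Let variation_ge0 A : (0 <= variation A)%E.
Proof. exact: phi_variation_ge0. Qed.

Let variation_sigma_additive : semi_sigma_additive variation.
Proof. by apply: phi_variation_sigma_additive. Qed.

HB.instance Definition _ := isMeasure.Build _ _ _ variation
  variation0 variation_ge0 variation_sigma_additive.

Let re_pos0 : re_pos_variation set0 = 0%E.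
Proof.
apply: phi_variation0 => w; first exact: pos_part_ge0.
by apply: max_le_normc; rewrite normc_ge_Re.
Qed.

Let re_pos_ge0 A : (0 <= re_pos_variation A)%E.
Proof. exact: phi_variation_ge0. Qed.

Let re_pos_sigma_additive : semi_sigma_additive re_pos_variation.
Proof.
apply: phi_variation_sigma_additive => [w|w|[a b] [c d]] /=.
- exact: pos_part_ge0.
- by apply: max_le_normc; rewrite normc_ge_Re.
- exact: pos_part_sub.
Qed.

HB.instance Definition _ := isMeasure.Build _ _ _ re_pos_variation
  re_pos0 re_pos_ge0 re_pos_sigma_additive.

Let re_neg0 : re_neg_variation set0 = 0%E.
Proof.
apply: phi_variation0 => w; first exact: pos_part_ge0.
by apply: max_le_normc; rewrite normrN normc_ge_Re.
Qed.

Let re_neg_ge0 A : (0 <= re_neg_variation A)%E.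
Proof. exact: phi_variation_ge0. Qed.

Let re_neg_sigma_additive : semi_sigma_additive re_neg_variation.
Proof.
apply: phi_variation_sigma_additive => [w|w|[a b] [c d]] /=.
- exact: pos_part_ge0.
- by apply: max_le_normc; rewrite normrN normc_ge_Re.
- rewrite opprD; exact: pos_part_sub.
Qed.

HB.instance Definition _ := isMeasure.Build _ _ _ re_neg_variation
  re_neg0 re_neg_ge0 re_neg_sigma_additive.

Let im_pos0 : im_pos_variation set0 = 0%E.
Proof.
apply: phi_variation0 => w; first exact: pos_part_ge0.
by apply: max_le_normc; rewrite normc_ge_Im.
Qed.

Let im_pos_ge0 A : (0 <= im_pos_variation A)%E.
Proof. exact: phi_variation_ge0. Qed.

Let im_pos_sigma_additive : semi_sigma_additive im_pos_variation.
Proof.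
apply: phi_variation_sigma_additive => [w|w|[a b] [c d]] /=.
- exact: pos_part_ge0.
- by apply: max_le_normc; rewrite normc_ge_Im.
- exact: pos_part_sub.
Qed.

HB.instance Definition _ := isMeasure.Build _ _ _ im_pos_variation
  im_pos0 im_pos_ge0 im_pos_sigma_additive.

Let im_neg0 : im_neg_variation set0 = 0%E.
Proof.
apply: phi_variation0 => w; first exact: pos_part_ge0.
by apply: max_le_normc; rewrite normrN normc_ge_Im.
Qed.

Let im_neg_ge0 A : (0 <= im_neg_variation A)%E.
Proof. exact: phi_variation_ge0. Qed.

Let im_neg_sigma_additive : semi_sigma_additive im_neg_variation.
Proof.
apply: phi_variation_sigma_additive => [w|w|[a b] [c d]] /=.
- exact: pos_part_ge0.
- by apply: max_le_normc; rewrite normrN normc_ge_Im.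
- rewrite opprD; exact: pos_part_sub.
Qed.

HB.instance Definition _ := isMeasure.Build _ _ _ im_neg_variation
  im_neg0 im_neg_ge0 im_neg_sigma_additive.

End variations.

Section fock_space.
Context (R : realType).

Definition z_of (p : R * R) : R[i] := p.1 +i* p.2.

Definition sqmod (w : R[i]) : R := Normc.normc w ^+ 2.

Definition gauss (p : R * R) : R := expR (- sqmod (z_of p)).

Definition entire (f : R[i] -> R[i]) : Prop :=
  forall z : R[i]^o, derivable (f : R[i]^o -> R[i]^o) z 1.

Definition cderiv (n : nat) (f : R[i] -> R[i]) : R[i] -> R[i] :=
  derive1n n (f : R[i] -> R[i]^o).

Definition fock_sqnorm (f : R[i] -> R[i]) : \bar R :=
  (\int[(lebesgue_measure \x lebesgue_measure)%E]_p
     (sqmod (f (z_of p)) * (pi^-1 * gauss p))%:E)%E.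

Definition fock (f : R[i] -> R[i]) : Prop :=
  entire f /\ (fock_sqnorm f < +oo)%E.

Definition fock_norm (f : R[i] -> R[i]) : R := Num.sqrt (fine (fock_sqnorm f)).

End fock_space.

Section integral_complex_measure.
Context (R : realType) (mu : complex_measure R).

(* mu = mu1 - mu2 + i (mu3 - mu4) is the Jordan decomposition of the real and
   imaginary parts; each mu_j is dominated by |mu|. *)
Definition cintegral (h : R * R -> R[i]) : R[i] :=
  let re p := complex.Re (h p) in
  let im p := complex.Im (h p) in
  let mu1 := re_pos_variation mu in
  let mu2 := re_neg_variation mu in
  let mu3 := im_pos_variation mu in
  let mu4 := im_neg_variation mu in
  ((\int[mu1]_p re p - \int[mu2]_p re p)
     - (\int[mu3]_p im p - \int[mu4]_p im p))
  +i* ((\int[mu1]_p im p - \int[mu2]_p im p)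
     + (\int[mu3]_p re p - \int[mu4]_p re p)).

Definition cintegrable (h : R * R -> R[i]) : Prop :=
  (variation mu).-integrable setT (fun p => (complex.Re (h p))%:E) /\
  (variation mu).-integrable setT (fun p => (complex.Im (h p))%:E).

End integral_complex_measure.

Section fock_carleson.
Context (R : realType) (mu : complex_measure R).

Definition fc_bound (k : nat) (c : R) : Prop :=
  forall f : R[i] -> R[i], fock f ->
    (\int[variation mu]_p (sqmod (cderiv k f (z_of p)) * gauss p)%:E
       <= c%:E * fock_sqnorm f)%E.

(* The least constant; the infimum of the empty set is +oo. *)
Definition fc_const (k : nat) : \bar R :=
  ereal_inf [set c%:E | c in [set c | 0 <= c /\ fc_bound k c]].

Definition disk (p : R * R) (r : R) : set (R * R) :=
  [set q | Normc.normc (z_of q - z_of p) < r].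

Definition fc_sup (k : R) : \bar R :=
  ereal_sup [set (variation mu (disk p (Num.sqrt 2))
                  * ((1 + sqmod (z_of p)) `^ k)%:E)%E | p in [set: R * R]].

(* The order k of a Fock-Carleson measure is an integer or a half-integer; it
   is encoded by the natural number k2 = 2 k. *)
Definition fc_measure (k2 : nat) : Prop :=
  if odd k2 then is_true (fc_sup (k2%:R / 2) < +oo)%E
  else exists c : R, fc_bound k2./2 c.

Definition fc_integrand (alpha beta : nat) (f g : R[i] -> R[i])
    (p : R * R) : R[i] :=
  cderiv alpha f (z_of p) * (cderiv beta g (z_of p))^* * (gauss p)%:C.

Definition fc_form (alpha beta : nat) (f g : R[i] -> R[i]) : R[i] :=
  cintegral mu (fc_integrand alpha beta f g).

End fock_carleson.

(* Main.v *)
From HB Require Import structures.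
Require Import Defs.
From mathcomp Require Import all_boot all_order all_algebra.
From mathcomp Require Import complex ring lra.
From mathcomp Require Import all_classical all_reals all_analysis.
From mathcomp Require Import measurable_realfun.
Set Implicit Arguments.
Unset Strict Implicit.
Unset Printing Implicit Defensive.
Import Order.TTheory GRing.Theory Num.Theory.
Import numFieldNormedType.Exports.
Local Open Scope classical_set_scope.
Local Open Scope ring_scope.
Local Open Scope complex_scope.

(** The form is an integral against a complex measure of a product of two
derivatives.  Its modulus is at most the integral of the modulus against the
variation, and the Cauchy-Schwarz inequality splits that integral into the two
quadratic integrals whose best constants are varpi_alpha and varpi_beta.  Three
points need an argument.

Integrability.  When alpha and beta differ, the hypothesis controls neither of
the two quadratic integrals, only the mean k of their orders.  With
w(z) = (1 + |z|^2)^(1/2) one has instead the balanced bounds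
  int |f^(alpha)|^2 e^{-|z|^2} w^(beta - alpha) d|mu| <= C ||f||^2
and the same with alpha and beta exchanged ([weighted_estimate]); the two
weights cancel in the Cauchy-Schwarz inequality.  These bounds follow by
Tonelli's theorem from the growth bound |mu|(B(z, sqrt 2)) w(z)^(2k) <= M
([fc_measure_ball]; for an integer k it comes from testing the Carleson
inequality on the normalized reproducing kernels) and from the pointwise bound
  |f^(n)(z)|^2 e^{-|z|^2} <= C w(z)^(2n) int_Q |f|^2 e^{-|v|^2} dV(v)
on a square Q of fixed size around z ([local_estimate]).  The factor w(z)^(2n) appears
because the twist v |-> e^{-conj z (v - z)}, which turns the Gaussian at v into
the Gaussian at z, has modulus of order one only on a scale 1 / w(z), the scale
at which Cauchy's estimates are therefore applied.

The modulus of an integral.  The integral is a combination of integrals against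
the four Jordan parts of mu.  Estimating the parts separately loses a constant,
so the plane is cut into finitely many slices on which the direction of the
integrand is almost constant; on a slice the inequality
Re ((a + ib) mu(A)) <= |a + ib| |mu|(A) between set functions integrates to the
sharp bound ([modulus_bound], [normc_cintegral_le]).

The constant.  If both least constants are finite, the Cauchy-Schwarz bound
is the claim.  If their product is infinite there is nothing to compare with
and the balanced bounds give some constant.  In the remaining case one constant
is zero and the other infinite; then one quadratic integral vanishes and so
does the form.

The function theory is developed on rectangles.  Goursat's lemma by
bisection gives Cauchy's formula, whose kernel can be differentiated
twice under the integral sign; hence derivatives of entire functions are entire
and satisfy Cauchy's estimates.  Since the four sides of a rectangle can be
moved independently, averaging Cauchy's formula over them gives the L^1 mean
value inequality ([mean_value_L1]). *)

Local Notation normc := Normc.normc.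
Local Notation Re := complex.Re.
Local Notation Im := complex.Im.

(** * The modulus and the parts of a complex number *)

Section normc_theory.
Context (R : realType).
Implicit Types z w : R[i].

Lemma normc_ge0 z : 0 <= normc z.
Proof. by case: z => a b; exact: sqrtr_ge0. Qed.

Lemma normc_eq0 z : (normc z == 0) = (z == 0).
Proof.
by apply/eqP/eqP => [/Normc.eq0_normc//|->]; exact: Normc.normc0.
Qed.

Lemma normc_gt0 z : (0 < normc z) = (z != 0).
Proof. by rewrite lt_neqAle normc_ge0 andbT eq_sym normc_eq0. Qed.

Lemma Re_le_normc z : `|Re z| <= normc z.
Proof.
by case: z => a b /=; rewrite -sqrtr_sqr ler_sqrt ?addr_ge0 ?sqr_ge0// lerDl sqr_ge0.
Qed.

Lemma Im_le_normc z : `|Im z| <= normc z.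
Proof.
by case: z => a b /=; rewrite -sqrtr_sqr ler_sqrt ?addr_ge0 ?sqr_ge0// lerDr sqr_ge0.
Qed.

Lemma normc_le_ReIm z : normc z <= `|Re z| + `|Im z|.
Proof.
case: z => a b /=; rewrite -[leRHS]ger0_norm ?addr_ge0// -sqrtr_sqr.
rewrite ler_sqrt ?sqr_ge0// sqrrD !real_normK ?num_real//.
by rewrite [in leRHS]addrAC lerDl mulrn_wge0// mulr_ge0.
Qed.

Lemma sqr_normc z : normc z ^+ 2 = Re z ^+ 2 + Im z ^+ 2.
Proof. by case: z => a b /=; rewrite sqr_sqrtr// addr_ge0 ?sqr_ge0. Qed.

Lemma normcX z n : normc (z ^+ n) = normc z ^+ n.
Proof.
by elim: n => [|n IH]; rewrite ?expr0 ?Normc.normc1// !exprS Normc.normcM IH.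
Qed.

Lemma normc_real (x : R) : normc x%:C = `|x|.
Proof. by rewrite /= expr0n addr0 sqrtr_sqr. Qed.

Lemma normc_conj z : normc z^* = normc z.
Proof. by case: z => a b /=; rewrite sqrrN. Qed.

Lemma normcB z w : normc (z - w) = normc (w - z).
Proof. by rewrite -normcN opprB. Qed.

Lemma normrE z : `|z| = (normc z)%:C.
Proof. by case: z. Qed.

Lemma ReD z w : Re (z + w) = Re z + Re w. Proof. by case: z; case: w. Qed.
Lemma ImD z w : Im (z + w) = Im z + Im w. Proof. by case: z; case: w. Qed.
Lemma ReN z : Re (- z) = - Re z. Proof. by case: z. Qed.
Lemma ImN z : Im (- z) = - Im z. Proof. by case: z. Qed.
Lemma ReM z w : Re (z * w) = Re z * Re w - Im z * Im w.
Proof. by case: z; case: w. Qed.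
Lemma ImM z w : Im (z * w) = Re z * Im w + Im z * Re w.
Proof. by case: z => a b; case: w => c d /=; rewrite [b * c]mulrC. Qed.
Definition ReImE := (ReD, ImD, ReN, ImN, ReM, ImM).

Lemma complex_eqP z w : Re z = Re w -> Im z = Im w -> z = w.
Proof. by case: z => a b; case: w => c d /= -> ->. Qed.

End normc_theory.

(** * Complex differentiability with real epsilons *)

Section cderiv_eps.
Context (R : realType).
Implicit Types (f : R[i] -> R[i]) (z d : R[i]).

(** The norm of R[i] takes its values in R[i]; real radii and errors allow
estimates in R.  [is_cderivP] relates this to [derive1]. *)
Definition is_cderiv f z d := forall e : R, 0 < e -> exists2 r : R, 0 < r &
  forall w, normc (w - z) <= r -> normc (f w - f z - d * (w - z)) <= e * normc (w - z).

Lemma nbhs_normc z (P : set R[i]^o) : nbhs (z : R[i]^o) P <->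
  exists2 r : R, 0 < r & forall w, normc (w - z) <= r -> P w.
Proof.
split=> [/nbhs_ballP[e /= e0 eP]|[r r0 rP]].
  have eR : e = (Re e)%:C by rewrite RRe_real// ger0_real// ltW.
  have re0 : 0 < Re e by rewrite -ltcR -eR.
  exists (Re e / 2); first by rewrite divr_gt0.
  move=> w wz; apply: eP; rewrite -ball_normE /= normrE eR ltcR normcB.
  by rewrite (le_lt_trans wz)// ltr_pdivrMr// ltr_pMr// ltr1n.
apply/nbhs_ballP; exists r%:C => /=; first by rewrite ltcR.
by move=> w; rewrite -ball_normE /= normrE ltcR normcB => /ltW /rP.
Qed.

Lemma is_cderivP f z d : is_cderiv f z d <->
  derivable (f : R[i]^o -> R[i]^o) z 1 /\ derive1 (f : R[i] -> R[i]^o) z = d.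
Proof.
have key : is_cderiv f z d <->
   (fun h : R[i]^o => h^-1 *: (f (h + z) - f z : R[i]^o)) @ 0^' --> (d : R[i]^o).
  split=> [fd|fd].
    apply/cvgrPdist_le => e e0.
    have eR : e = (Re e)%:C by rewrite RRe_real// ger0_real// ltW.
    have /fd[r r0 H] : 0 < Re e by rewrite -ltcR -eR.
    have : nbhs (0 : R[i]^o) [set h | normc h <= r].
      by apply/nbhs_normc; exists r => // w; rewrite subr0.
    apply: filterS => h /= hr h0; rewrite normrE eR lecR.
    have := H (h + z); rewrite addrK => /(_ hr) hh.
    have hp : 0 < normc h by rewrite normc_gt0.
    rewrite -(ler_pM2r hp) -Normc.normcM; apply: le_trans hh.
    rewrite normcB /GRing.scale /= le_eqVlt; apply/orP; left; apply/eqP.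
    by congr (normc _); field.
  move=> e e0.
  have /cvgrPdist_le/(_ e%:C) := fd; rewrite ltcR => /(_ e0).
  move=> /(nbhs_normc (0 : R[i]))[r r0 H]; exists r => // w wr.
  have [->|wz] := eqVneq w z; first by rewrite !subrr mulr0 subrr Normc.normc0 mulr0.
  have := H (w - z); rewrite subr0 => /(_ wr); rewrite subr_eq0 => /(_ wz).
  rewrite normrE lecR => hh.
  have hp : 0 < normc (w - z) by rewrite normc_gt0 subr_eq0.
  move: hh; rewrite -(ler_pM2r hp) -Normc.normcM; apply: le_trans.
  rewrite normcB /GRing.scale /= subrK le_eqVlt; apply/orP; left; apply/eqP.
  by congr (normc _); field; rewrite subr_eq0.
have hd := @norm_hausdorff _ (R[i]^o : normedModType R[i]).
split.
  move=> /key h; split; last exact: (cvg_lim hd h).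
  rewrite /derivable; apply/cvg_ex; exists (d : R[i]^o).
  by under eq_fun do rewrite scaler1 //.
move=> [dv dE]; apply/key; rewrite -dE /derive1.
by move: dv; rewrite /derivable; under eq_fun do rewrite scaler1 //.
Qed.

End cderiv_eps.

(** * Integrals of complex functions on segments *)

Section cint.
Context (R : realType).
Notation leb := (@lebesgue_measure R).
Implicit Types (phi psi : R -> R[i]) (a b : R).

Definition cint a b phi : R[i] :=
  (\int[leb]_(x in `[a, b]) Re (phi x)) +i* (\int[leb]_(x in `[a, b]) Im (phi x)).

Definition cintb a b phi : Prop :=
  leb.-integrable `[a, b] (EFin \o (fun x => Re (phi x))) /\
  leb.-integrable `[a, b] (EFin \o (fun x => Im (phi x))).

Lemma eq_cint a b phi psi : (forall x, a <= x <= b -> phi x = psi x) ->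
  cint a b phi = cint a b psi.
Proof.
by move=> E; congr (_ +i* _); apply: eq_Rintegral => x;
  rewrite inE /= in_itv /= => /E ->.
Qed.

Lemma cintB a b phi psi : cintb a b phi -> cintb a b psi ->
  cint a b (fun x => phi x - psi x) = cint a b phi - cint a b psi.
Proof.
move=> [p1 p2] [q1 q2]; apply: complex_eqP; rewrite !ReImE /=.
  by under eq_Rintegral do rewrite ReD ReN; rewrite RintegralB.
by under eq_Rintegral do rewrite ImD ImN; rewrite RintegralB.
Qed.

Lemma cintZ a b k phi : cintb a b phi -> cint a b (fun x => k * phi x) = k * cint a b phi.
Proof.
move=> [p1 p2]; have mI : measurable (`[a, b] : set R) by [].
have Z r (g : R -> R) : leb.-integrable `[a, b] (EFin \o g) ->
    leb.-integrable `[a, b] (EFin \o (fun x => r * g x)).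
  move=> ig; rewrite (_ : _ \o _ = (fun x => r%:E * (EFin \o g) x)%E).
    exact: integrableZl.
  by apply/funext => x /=; rewrite EFinM.
apply: complex_eqP; rewrite !ReImE /=.
  under eq_Rintegral do rewrite ReM.
  by rewrite RintegralB// ?RintegralZl//; exact: Z.
under eq_Rintegral do rewrite ImM.
by rewrite RintegralD// ?RintegralZl//; exact: Z.
Qed.

Lemma cint_cst a b k : a <= b -> cint a b (fun=> k) = (b - a)%:C * k.
Proof.
move=> ab; rewrite /cint !Rintegral_cst//= lebesgue_measure_itv/= lte_fin.
case: ifPn => [h|]; last first.
  rewrite -leNgt => ba; have -> : a = b by apply/le_anti; rewrite ab.
  by rewrite /= !mulr0 subrr mul0r.
by apply: complex_eqP; rewrite !ReImE /=; ring.
Qed.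

Lemma cint_cat a m b phi : a <= m -> m <= b -> cintb a b phi ->
  cint a b phi = cint a m phi + cint m b phi.
Proof.
move=> am mb [h1 h2].
have key (g : R -> R) : leb.-integrable `[a, b] (EFin \o g) ->
   \int[leb]_(x in `[a, b]) g x =
   \int[leb]_(x in `[a, m]) g x + \int[leb]_(x in `[m, b]) g x.
  move=> ig; have := @Rintegral_itvB _ g (BLeft a) (BRight b) m ig.
  rewrite !bnd_simp => /(_ am mb) /eqP; rewrite subr_eq => /eqP ->.
  rewrite addrC Rintegral_itv_obnd_cbnd//.
  by apply: integrableS ig => //; apply: subset_itv; rewrite bnd_simp.
by apply: complex_eqP; rewrite !ReImE /= key.
Qed.

(** The factor 2 is the price of estimating the real and imaginary parts
separately; no sharp constant is needed for contours. *)
Lemma normc_cint_le a b phi (M : R) : a <= b -> cintb a b phi ->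
  (forall x, a <= x <= b -> normc (phi x) <= M) -> normc (cint a b phi) <= 2 * M * (b - a).
Proof.
move=> ab [h1 h2] bM; apply: (le_trans (normc_le_ReIm _)).
have mI : measurable (`[a, b] : set R) by [].
have key (g : R -> R) : leb.-integrable `[a, b] (EFin \o g) ->
   (forall x, a <= x <= b -> `|g x| <= M) -> `|\int[leb]_(x in `[a, b]) g x| <= M * (b - a).
  move=> ig gM; apply: le_trans; first by apply: le_normr_Rintegral.
  have -> : M * (b - a) = \int[leb]_(x in `[a, b]) M.
    rewrite Rintegral_cst//= lebesgue_measure_itv/= lte_fin.
    by case: ltgtP ab => //= -> _; rewrite subrr.
  apply: le_Rintegral => //.
  - by have := integrable_norm ig.
  - apply: continuous_compact_integrable; first exact: segment_compact.
    by apply: continuous_subspaceT => x; exact: cvg_cst.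
rewrite -mulrA mulrDl !mul1r /=.
apply: lerD; apply: key => // x xab.
  exact: le_trans (Re_le_normc _) (bM _ xab).
exact: le_trans (Im_le_normc _) (bM _ xab).
Qed.

End cint.

(** * Rectangular contours *)

Section contour.
Context (R : realType).
Implicit Types (f : R[i] -> R[i]) (a b c x y : R).

Definition ccont_at f (z : R[i]) := forall e : R, 0 < e -> exists2 r : R, 0 < r &
  forall w, normc (w - z) <= r -> normc (f w - f z) <= e.

Lemma is_cderiv_ccont f z d : is_cderiv f z d -> ccont_at f z.
Proof.
move=> fd e e0; have [r r0 H] := fd 1 ltr01.
have k0 : 0 < 1 + normc d by rewrite ltr_pwDl ?normc_ge0.
exists (Num.min r (e / (1 + normc d))); first by rewrite lt_min r0 divr_gt0.
move=> w; rewrite le_min => /andP[/H Hw we].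
rewrite -[f w - f z](subrK (d * (w - z))); apply: (le_trans (le_normcD _ _)).
rewrite Normc.normcM; apply: (le_trans (lerD Hw (lexx _))).
by rewrite -mulrDl mulrC -ler_pdivlMr.
Qed.

Lemma ccontB f g z : ccont_at f z -> ccont_at g z -> ccont_at (fun w => f w - g w) z.
Proof.
move=> cf cg e e0; have e2 : 0 < e / 2 by rewrite divr_gt0.
have [r r0 Hr] := cf _ e2; have [q q0 Hq] := cg _ e2.
exists (Num.min r q); first by rewrite lt_min r0.
move=> w; rewrite le_min => /andP[/Hr h1 /Hq h2].
have -> : f w - g w - (f z - g z) = (f w - f z) - (g w - g z) by ring.
rewrite (splitr e); apply: (le_trans (le_normcD _ _)).
by rewrite normcN lerD.
Qed.

(** Stated for a 1-Lipschitz p so that it covers the real part, the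
imaginary part and the modulus at once. *)
Lemma lipschitz_hline f (p : R[i] -> R) a b y :
  (forall z w, `|p z - p w| <= normc (z - w)) ->
  (forall x, a <= x <= b -> ccont_at f (x +i* y)) ->
  {within `[a, b], continuous (fun x => p (f (x +i* y)))}.
Proof.
move=> pl cf.
apply: continuous_in_subspaceT => x; rewrite inE /= in_itv /= => /cf cfx.
apply/cvgrPdist_le => e e0; have [r r0 H] := cfx e e0.
near=> t; rewrite (le_trans (pl _ _))// normcB H//.
have -> : (t +i* y) - (x +i* y) = (t - x)%:C :> R[i].
  by apply: complex_eqP; rewrite !ReImE //= subrr.
rewrite normc_real; near: t; apply: (cvgr_distC_le (fun t : R => t)) => //.
Unshelve. all: by end_near. Qed.

(** Reduces vertical segments to horizontal ones by a quarter turn. *)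
Lemma ccont_rot f x y : ccont_at f (x +i* y) ->
  ccont_at (fun w => f ('i * w + x%:C)) (y +i* 0).
Proof.
move=> cf e /cf[r r0 H].
have E : (x +i* y) = 'i * (y +i* 0) + x%:C :> R[i].
  by apply: complex_eqP; rewrite !ReImE //=; ring.
exists r => // w wr; rewrite -E; apply: H; rewrite E.
have -> : 'i * w + x%:C - ('i * (y +i* 0) + x%:C) = 'i * (w - (y +i* 0)) :> R[i] by ring.
by rewrite Normc.normcM /= expr0n expr1n add0r sqrtr1 mul1r.
Qed.

Lemma lipschitz_vline f (p : R[i] -> R) c d x :
  (forall z w, `|p z - p w| <= normc (z - w)) ->
  (forall y, c <= y <= d -> ccont_at f (x +i* y)) ->
  {within `[c, d], continuous (fun y => p (f (x +i* y)))}.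
Proof.
move=> pl cf.
have E y : (x +i* y) = 'i * (y +i* 0) + x%:C :> R[i].
  by apply: complex_eqP; rewrite !ReImE //=; ring.
rewrite (_ : (fun y => _) = (fun y => p ((fun w => f ('i * w + x%:C)) (y +i* 0)))).
  apply: (@lipschitz_hline (fun w => f ('i * w + x%:C))) => // y /cf.
  exact: ccont_rot.
by apply/funext => y; rewrite E.
Qed.

Let Re_lipschitz (z w : R[i]) : `|Re z - Re w| <= normc (z - w).
Proof. by rewrite -ReN -ReD Re_le_normc. Qed.

Let Im_lipschitz (z w : R[i]) : `|Im z - Im w| <= normc (z - w).
Proof. by rewrite -ImN -ImD Im_le_normc. Qed.

Lemma ccont_hline f a b y : (forall x, a <= x <= b -> ccont_at f (x +i* y)) ->
  cintb a b (fun x => f (x +i* y)).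
Proof.
by move=> cf; split; apply: continuous_compact_integrable; try exact: segment_compact;
  exact: lipschitz_hline.
Qed.

Lemma ccont_vline f c d x : (forall y, c <= y <= d -> ccont_at f (x +i* y)) ->
  cintb c d (fun y => f (x +i* y)).
Proof.
by move=> cf; split; apply: continuous_compact_integrable; try exact: segment_compact;
  exact: lipschitz_vline.
Qed.

Definition contour f a b c d : R[i] :=
  cint a b (fun x => f (x +i* c)) - cint a b (fun x => f (x +i* d)) +
  'i * (cint c d (fun y => f (b +i* y)) - cint c d (fun y => f (a +i* y))).

(** Continuity on the four sides only: Cauchy kernels are singular
inside the rectangle. *)
Definition ccont_frame f a b c d := forall x y, a <= x <= b -> c <= y <= d ->
  [|| x == a, x == b, y == c | y == d] -> ccont_at f (x +i* y).

Lemma frame_cintb f a b c d : a <= b -> c <= d -> ccont_frame f a b c d ->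
  [/\ cintb a b (fun x => f (x +i* c)), cintb a b (fun x => f (x +i* d)),
      cintb c d (fun y => f (b +i* y)) & cintb c d (fun y => f (a +i* y))].
Proof.
move=> ab cd cf; split.
- by apply: ccont_hline => x xab; apply: cf => //; rewrite ?lexx ?eqxx ?orbT.
- by apply: ccont_hline => x xab; apply: cf => //; rewrite ?lexx ?cd ?eqxx ?orbT.
- by apply: ccont_vline => x xab; apply: cf => //; rewrite ?lexx ?ab ?eqxx ?orbT.
- by apply: ccont_vline => x xab; apply: cf => //; rewrite ?lexx ?ab ?eqxx ?orbT.
Qed.

Lemma contourB f g a b c d : a <= b -> c <= d ->
  ccont_frame f a b c d -> ccont_frame g a b c d ->
  contour (fun z => f z - g z) a b c d = contour f a b c d - contour g a b c d.
Proof.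
move=> ab cd /(frame_cintb ab cd)[f1 f2 f3 f4] /(frame_cintb ab cd)[g1 g2 g3 g4].
by rewrite /contour !cintB//; ring.
Qed.

Lemma contourZ k f a b c d : a <= b -> c <= d -> ccont_frame f a b c d ->
  contour (fun z => k * f z) a b c d = k * contour f a b c d.
Proof.
move=> ab cd /(frame_cintb ab cd)[f1 f2 f3 f4].
by rewrite /contour !cintZ//; ring.
Qed.

Lemma contour_hcut m f a b c d : a <= m -> m <= b -> c <= d ->
  ccont_frame f a b c d ->
  contour f a b c d = contour f a m c d + contour f m b c d.
Proof.
move=> am mb cd /(frame_cintb (le_trans am mb) cd)[f1 f2 f3 f4].
by rewrite /contour (cint_cat am mb f1) (cint_cat am mb f2); ring.
Qed.

Lemma contour_vcut m f a b c d : a <= b -> c <= m -> m <= d ->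
  ccont_frame f a b c d ->
  contour f a b c d = contour f a b c m + contour f a b m d.
Proof.
move=> ab cm md /(frame_cintb ab (le_trans cm md))[f1 f2 f3 f4].
by rewrite /contour (cint_cat cm md f3) (cint_cat cm md f4); ring.
Qed.

Lemma contour_bound f a b c d (M : R) : a <= b -> c <= d ->
  ccont_frame f a b c d ->
  (forall x y, a <= x <= b -> c <= y <= d ->
     [|| x == a, x == b, y == c | y == d] -> normc (f (x +i* y)) <= M) ->
  normc (contour f a b c d) <= 4 * M * ((b - a) + (d - c)).
Proof.
move=> ab cd /(frame_cintb ab cd)[f1 f2 f3 f4] fM.
have n1 : normc ('i : R[i]) = 1 by rewrite /= expr0n expr1n add0r sqrtr1.
apply: (le_trans (le_normcD _ _)); rewrite Normc.normcM n1 mul1r.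
have h1 : normc (cint a b (fun x => f (x +i* c))) <= 2 * M * (b - a).
  by apply: normc_cint_le => // x xab; apply: fM; rewrite ?lexx ?eqxx ?orbT.
have h2 : normc (cint a b (fun x => f (x +i* d))) <= 2 * M * (b - a).
  by apply: normc_cint_le => // x xab; apply: fM; rewrite ?lexx ?cd ?eqxx ?orbT.
have h3 : normc (cint c d (fun x => f (b +i* x))) <= 2 * M * (d - c).
  by apply: normc_cint_le => // x xab; apply: fM; rewrite ?lexx ?ab ?eqxx ?orbT.
have h4 : normc (cint c d (fun x => f (a +i* x))) <= 2 * M * (d - c).
  by apply: normc_cint_le => // x xab; apply: fM; rewrite ?lexx ?ab ?eqxx ?orbT.
have T (u v : R[i]) : normc (u - v) <= normc u + normc v.
  by rewrite -[normc v]normcN le_normcD.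
move: (T (cint a b (fun x => f (x +i* c))) (cint a b (fun x => f (x +i* d)))).
move: (T (cint c d (fun x => f (b +i* x))) (cint c d (fun x => f (a +i* x)))).
lra.
Qed.

Lemma ccontZ k f z : ccont_at f z -> ccont_at (fun w => k * f w) z.
Proof.
move=> cf e e0; have k0 : 0 < normc k + 1 by rewrite ltr_wpDl ?normc_ge0.
have [|r r0 Hr] := cf (e / (normc k + 1)); first by rewrite divr_gt0.
exists r => // w /Hr; rewrite ler_pdivlMr// => h.
rewrite -mulrBr Normc.normcM mulrC; apply: le_trans h.
by rewrite ler_wpM2l ?normc_ge0// lerDl.
Qed.

Lemma ccont_affine A B z : ccont_at (fun w => A + B * w) z.
Proof.
move=> e e0.
have k0 : 0 < 1 + normc B by rewrite ltr_pwDl ?normc_ge0.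
exists (e / (1 + normc B)); first by rewrite divr_gt0.
move=> w; rewrite ler_pdivlMr// => we.
have -> : A + B * w - (A + B * z) = (w - z) * B by ring.
rewrite Normc.normcM; apply: le_trans we.
by rewrite ler_wpM2l ?normc_ge0// lerDr.
Qed.

(** The integrands on opposite sides differ by constants, B * 'i * (c - d)
and B * (b - a), whose contributions cancel.  This takes the place of
a primitive in Goursat's argument. *)
Lemma contour_affine A B a b c d : a <= b -> c <= d ->
  contour (fun w => A + B * w) a b c d = 0.
Proof.
move=> ab cd.
have h x y : ccont_at (fun w => A + B * w) (x +i* y) by exact: ccont_affine.
have hi x y k : cintb x y (fun t => A + B * (t +i* k)).
  exact: (@ccont_hline (fun w => A + B * w) x y k (fun t _ => h t k)).
have vi x y k : cintb x y (fun t => A + B * (k +i* t)).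
  exact: (@ccont_vline (fun w => A + B * w) x y k (fun t _ => h k t)).
rewrite /contour -!cintB//.
rewrite (_ : cint a b _ = cint a b (fun=> B * 'i * (c - d)%:C)); last first.
  by apply: eq_cint => x _; apply: complex_eqP; rewrite !ReImE /=; ring.
rewrite (_ : cint c d _ = cint c d (fun=> B * (b - a)%:C)); last first.
  by apply: eq_cint => x _; apply: complex_eqP; rewrite !ReImE /=; ring.
by rewrite !cint_cst// !rmorphB /=; ring.
Qed.

(** * Goursat's lemma *)

Lemma nested_intervals (u v : nat -> R) : (forall n, u n <= u n.+1) ->
  (forall n, v n.+1 <= v n) -> (forall n, u n <= v n) ->
  exists p, forall n, u n <= p <= v n.
Proof.
move=> uS vS uv.
have um m n : (m <= n)%N -> u m <= u n.
  by move/subnKC <-; elim: (n - m)%N => [|k IH]; rewrite ?addn0// addnS (le_trans _ (uS _)).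
have vm m n : (m <= n)%N -> v n <= v m.
  by move/subnKC <-; elim: (n - m)%N => [|k IH]; rewrite ?addn0// addnS (le_trans (vS _)).
have uvmn m n : u m <= v n.
  apply: (le_trans (um _ _ (leq_maxl m n))).
  by apply: (le_trans (uv _)); apply: vm; exact: leq_maxr.
exists (sup (range u)) => n; apply/andP; split.
  apply: ub_le_sup; last by exists n.
  by exists (v 0%N) => _ [m _ <-].
by apply: ge_sup; [exists (u 0%N), 0%N|move=> _ [m _ <-]].
Qed.

Lemma four_max (x a b c d : R) : x <= a + b + (c + d) ->
  [|| x <= 4 * a, x <= 4 * b, x <= 4 * c | x <= 4 * d].
Proof.
move=> h; rewrite -!implyNb -!ltNge; apply/implyP => ?; apply/implyP => ?.
by apply/implyP => ?; lra.
Qed.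

Section goursat.
Variables (f : R[i] -> R[i]) (a0 c0 w h : R).
Hypotheses (w0 : 0 <= w) (h0 : 0 <= h).
Hypothesis df : forall x y, a0 <= x <= a0 + w -> c0 <= y <= c0 + h ->
  exists d, is_cderiv f (x +i* y) d.

Let J n (p : R * R) := contour f p.1 (p.1 + w / 2 ^+ n) p.2 (p.2 + h / 2 ^+ n).
Let inrect n (p : R * R) := [&& a0 <= p.1, p.1 + w / 2 ^+ n <= a0 + w,
  c0 <= p.2 & p.2 + h / 2 ^+ n <= c0 + h].
Let quarter n (p : R * R) (i j : bool) :=
  (p.1 + i%:R * (w / 2 ^+ n.+1), p.2 + j%:R * (h / 2 ^+ n.+1)).

Let cf x y : a0 <= x <= a0 + w -> c0 <= y <= c0 + h -> ccont_at f (x +i* y).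
Proof. by move=> hx hy; have [d] := df hx hy; exact: is_cderiv_ccont. Qed.

Let side_ge0 n : 0 <= w / 2 ^+ n /\ 0 <= h / 2 ^+ n.
Proof. by rewrite !divr_ge0// exprn_ge0. Qed.

Let halve (t : R) n : t / 2 ^+ n = t / 2 ^+ n.+1 + t / 2 ^+ n.+1.
Proof. by rewrite exprS; field; rewrite expf_neq0. Qed.

Let quarter_in n p i j : inrect n p -> inrect n.+1 (quarter n p i j).
Proof.
move=> /and4P[]; have := halve w n; have := halve h n.
have [] := side_ge0 n.+1; rewrite /inrect /quarter /=.
set u := w / 2 ^+ n.+1; set v := h / 2 ^+ n.+1.
move=> u0 v0 -> ->; case: i; case: j; rewrite /= ?mul1r ?mul0r => *;
  apply/and4P; split; lra.
Qed.

Let J_split n p : inrect n p -> J n p =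
  J n.+1 (quarter n p false false) + J n.+1 (quarter n p true false) +
  (J n.+1 (quarter n p false true) + J n.+1 (quarter n p true true)).
Proof.
move=> /and4P[]; rewrite /J (halve w) (halve h) /quarter /= !mul1r !mul0r !addr0.
have [] := side_ge0 n.+1; set u := w / 2 ^+ n.+1; set v := h / 2 ^+ n.+1.
move=> u0 v0 p1 p2 p3 p4.
have fr a b c d : a0 <= a -> b <= a0 + w -> c0 <= c -> d <= c0 + h -> ccont_frame f a b c d.
  move=> aa bb cc dd x y /andP[ax xb] /andP[cy yd] _.
  by apply: cf; apply/andP; split; lra.
rewrite !(addrA p.1) !(addrA p.2) in p2 p4 *.
rewrite (@contour_vcut (p.2 + v)); [|lra|lra|lra|apply: fr; lra].
congr (_ + _).
  by rewrite (@contour_hcut (p.1 + u)) //; [lra|lra|lra|apply: fr; lra].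
by rewrite (@contour_hcut (p.1 + u)) //; [lra|lra|lra|apply: fr; lra].
Qed.

Let J_big n p : inrect n p -> exists i j : bool,
  normc (J n p) <= 4 * normc (J n.+1 (quarter n p i j)).
Proof.
move=> /J_split ->.
set A := J _ _; set B := J _ _; set C := J _ _; set D := J _ _.
have := four_max (le_trans (le_normcD (A + B) (C + D))
  (lerD (le_normcD A B) (le_normcD C D))).
case/or4P => ?; [exists false, false|exists true, false|exists false, true|exists true, true].
all: by [].
Qed.

Let quarters : exists s : nat -> R * R, s 0%N = (a0, c0) /\ forall n,
  [/\ inrect n (s n), exists i j : bool, s n.+1 = quarter n (s n) i j
    & normc (J n (s n)) <= 4 * normc (J n.+1 (s n.+1))].
Proof.
have Hex (q : nat * (R * R)) : exists ij : bool * bool, inrect q.1 q.2 ->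
    normc (J q.1 q.2) <= 4 * normc (J q.1.+1 (quarter q.1 q.2 ij.1 ij.2)).
  case: q => n p /=; case: (boolP (inrect n p)) => [/J_big[i [j Hij]]|_].
    by exists (i, j).
  by exists (true, true).
have [g Hg] := boolp.choice Hex.
pose s := fix s n := if n is m.+1 then quarter m (s m) (g (m, s m)).1 (g (m, s m)).2
  else (a0, c0).
have sin n : inrect n (s n).
  elim: n => [|n IH]; last exact: quarter_in.
  by rewrite /inrect /= expr0 !divr1 !lexx.
exists s; split=> // n; split=> //; last exact: (Hg (n, s n)).
by exists (g (n, s n)).1, (g (n, s n)).2.
Qed.

(** Quartering the rectangle and keeping a quarter with the largest
integral, the integrals decrease at most like 4^-n.  On the n-th rectangle f
differs from its tangent affine map at the limit point by e * 2^-n and the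
perimeter is of order 2^-n, while the affine map does not contribute. *)
Lemma goursat : contour f a0 (a0 + w) c0 (c0 + h) = 0.
Proof.
have [s [s0 Hs]] := quarters.
have J_geom n : normc (J 0 (a0, c0)) <= 4 ^+ n * normc (J n (s n)).
  elim: n => [|n IH]; first by rewrite mul1r s0.
  apply: (le_trans IH); rewrite exprSr -mulrA ler_pM2l ?exprn_gt0//.
  by case: (Hs n).
have nest (u : nat -> R) (t : R) : 0 <= t ->
    (forall n, exists i : bool, u n.+1 = u n + i%:R * (t / 2 ^+ n.+1)) ->
    exists x, forall n, u n <= x <= u n + t / 2 ^+ n.
  move=> t0 Hu; apply: nested_intervals => n.
  - by have [i ->] := Hu n; rewrite lerDl mulr_ge0// divr_ge0// exprn_ge0.
  - have [i ->] := Hu n; rewrite (halve t n) -addrA lerD2l lerD2r.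
    by rewrite ler_piMl ?divr_ge0 ?exprn_ge0//; case: i.
  - by rewrite lerDl divr_ge0// exprn_ge0.
have [x0 Hx] : exists x, forall n, (s n).1 <= x <= (s n).1 + w / 2 ^+ n.
  by apply: nest => // n; have [_ [i [j ->]] _] := Hs n; exists i.
have [y0 Hy] : exists x, forall n, (s n).2 <= x <= (s n).2 + h / 2 ^+ n.
  by apply: nest => // n; have [_ [i [j ->]] _] := Hs n; exists j.
have [d Hd] : exists d, is_cderiv f (x0 +i* y0) d.
  by apply: df; [have := Hx 0%N|have := Hy 0%N]; rewrite s0 expr0 divr1.
suff key e : 0 < e -> normc (J 0 (a0, c0)) <= e * (4 * (w + h) ^+ 2).
  have : normc (J 0 (a0, c0)) <= 0.
    apply/ler_addgt0Pr => e e0; rewrite add0r.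
    have k0 : 0 < 4 * (w + h) ^+ 2 + 1 by rewrite ltr_wpDl// mulr_ge0// sqr_ge0.
    apply: (le_trans (key (e / (4 * (w + h) ^+ 2 + 1)) _)); first by rewrite divr_gt0.
    by rewrite mulrAC ler_pdivrMr// ler_pM2l// lerDl.
  rewrite /J /= !expr0 !divr1 => h1; apply/eqP; rewrite -normc_eq0.
  by rewrite eq_le h1 normc_ge0.
move=> e0; have [r r0 Hr] := Hd e e0.
have [n Hn] : exists n, (w + h) / 2 ^+ n <= r.
  exists (Num.truncn ((w + h) / r)).+1; set m := Num.truncn _.
  rewrite ler_pdivrMr ?exprn_gt0// -ler_pdivrMl// mulrC ltW//.
  apply: (lt_le_trans (truncnS_gt _)); rewrite -natrX ler_nat.
  exact: (ltnW (ltn_expl _ _)).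
apply: (le_trans (J_geom n)).
have [+ _ _] := Hs n; have := Hx n; have := Hy n; set p := s n; move=> py px /and4P[p1 p2 p3 p4].
have [wn hn] := side_ge0 n.
have ex : (w + h) / 2 ^+ n = w / 2 ^+ n + h / 2 ^+ n by rewrite mulrDl.
set A := f (x0 +i* y0) - d * (x0 +i* y0).
have fr : ccont_frame f p.1 (p.1 + w / 2 ^+ n) p.2 (p.2 + h / 2 ^+ n).
  move=> x y /andP[h1 h2] /andP[h3 h4] _; apply: cf; apply/andP; split; lra.
have fr2 a b c d' : ccont_frame (fun z => A + d * z) a b c d'.
  by move=> x y *; exact: ccont_affine.
have -> : J n p = contour (fun z => f z - (A + d * z)) p.1 (p.1 + w / 2 ^+ n) p.2 (p.2 + h / 2 ^+ n).
  by rewrite contourB ?contour_affine ?subr0 ?lerDl.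
set S := (w + h) / 2 ^+ n.
have -> : e * (4 * (w + h) ^+ 2) = 4 ^+ n * (4 * (e * S) * S).
  have -> : (4 : R) ^+ n = 2 ^+ n * 2 ^+ n by rewrite -exprMn -natrM.
  rewrite /S; field.
  by rewrite expf_neq0.
rewrite ler_pM2l ?exprn_gt0//.
have SE : S = p.1 + w / 2 ^+ n - p.1 + (p.2 + h / 2 ^+ n - p.2) by rewrite /S ex; ring.
rewrite [X in _ <= _ * X]SE.
have np x y : p.1 <= x <= p.1 + w / 2 ^+ n -> p.2 <= y <= p.2 + h / 2 ^+ n ->
    normc ((x +i* y) - (x0 +i* y0)) <= S.
  move=> xx yy; apply: (le_trans (normc_le_ReIm _)); rewrite !ReImE /= /S ex.
  by apply: lerD; rewrite ler_norml; apply/andP; split; lra.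
apply: contour_bound; rewrite ?lerDl//.
  by move=> x y xx yy xy; apply: ccontB; [exact: fr|exact: ccont_affine].
move=> x y /np np1 /np1 {}np1 _.
have := Hr (x +i* y) (le_trans np1 Hn).
rewrite [X in normc X <= _ -> _](_ : _ = f (x +i* y) - (A + d * (x +i* y))); last first.
  by rewrite /A; ring.
by move=> hh; apply: (le_trans hh); rewrite ler_wpM2l// ltW.
Qed.

End goursat.

Definition holo_off f (z : R[i]) := forall w, w != z -> exists d, is_cderiv f w d.

Lemma goursat_rect f a b c d : a <= b -> c <= d ->
  (forall x y, a <= x <= b -> c <= y <= d -> exists d, is_cderiv f (x +i* y) d) ->
  contour f a b c d = 0.
Proof.
move=> ab cd df; rewrite -[b](subrK a) -[d](subrK c) ![_ - _ + _]addrC.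
by apply: goursat; rewrite ?subr_ge0// => x y; rewrite ![_ + (_ - _)]addrC !subrK; exact: df.
Qed.

Lemma holo_off_frame f z a b c d : holo_off f z -> a < Re z < b -> c < Im z < d ->
  ccont_frame f a b c d.
Proof.
case: z => zx zy hf /= /andP[az zb] /andP[cz zd] x y xab ycd xy.
have [|e] := hf (x +i* y); last exact: is_cderiv_ccont.
apply/negP => /eqP[xz yz]; move: az zb cz zd; rewrite -xz -yz.
by case/or4P: xy => /eqP ->; rewrite ltxx.
Qed.

(** Cutting along the four lines of the inner rectangle, the outer
pieces avoid z, so that Goursat's lemma applies. *)
Lemma contour_shrink f z a b c d a' b' c' d' : holo_off f z ->
  a <= a' -> a' < Re z < b' -> b' <= b -> c <= c' -> c' < Im z < d' -> d' <= d ->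
  contour f a b c d = contour f a' b' c' d'.
Proof.
move=> hf aa /andP[az zb] bb cc /andP[cz zd] dd.
have G k l m n : k <= l -> m <= n -> [|| l < Re z, Re z < k, n < Im z | Im z < m] ->
    contour f k l m n = 0.
  move=> kl mn out; apply: goursat_rect => // x y /andP[x1 x2] /andP[y1 y2].
  apply: hf; apply/negP => /eqP E; move: out; rewrite -E /=.
  by rewrite !ltNge x1 x2 y1 y2.
have F k l m n : k < Re z < l -> m < Im z < n -> ccont_frame f k l m n.
  exact: holo_off_frame.
rewrite (@contour_vcut c'); [|lra|lra|lra|apply: F; apply/andP; split; lra].
rewrite (@contour_vcut d' f a b c' d); [|lra|lra|lra|apply: F; apply/andP; split; lra].
rewrite (@contour_hcut a' f a b c' d'); [|lra|lra|lra|apply: F; apply/andP; split; lra].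
rewrite (@contour_hcut b' f a' b c' d'); [|lra|lra|lra|apply: F; apply/andP; split; lra].
rewrite (G a b c c') ?cz ?orbT//; [|lra..].
rewrite (G a b d' d) ?zd ?orbT//; [|lra..].
rewrite (G a a' c' d') ?az ?orbT//; [|lra..].
rewrite (G b' b c' d') ?zb ?orbT//; [|lra..].
by rewrite !(add0r, addr0).
Qed.

(** Shrinking the rectangle to z makes the perimeter, hence the
integral of a bounded function, arbitrarily small. *)
Lemma contour_removable f z a b c d (M r : R) : holo_off f z -> 0 < r ->
  (forall w, w != z -> normc (w - z) <= r -> normc (f w) <= M) ->
  a < Re z < b -> c < Im z < d -> contour f a b c d = 0.
Proof.
move=> hf r0 fM /andP[az zb] /andP[cz zd].
apply/eqP; rewrite -normc_eq0 eq_le normc_ge0 andbT.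
apply/ler_addgt0Pr => e e0; rewrite add0r.
have M0 : 0 <= M.
  apply: le_trans (fM (z + r%:C) _ _); first exact: normc_ge0.
    by rewrite -subr_eq0 addrC addKr -normc_eq0 normc_real gt_eqF// normr_gt0 gt_eqF.
  by rewrite addrC addKr normc_real gtr0_norm.
pose t := Num.min (Num.min (r / 2) (e / (16 * (M + 1))))
  (Num.min (Num.min (Re z - a) (b - Re z)) (Num.min (Im z - c) (d - Im z))).
have t0 : 0 < t by rewrite !lt_min !subr_gt0 az zb cz zd !divr_gt0 ?mulr_gt0 ?ltr_wpDl.
have := lexx t; rewrite {2}/t !le_min => /andP[/andP[tr te] /and3P[/andP[t1 t2] t3 t4]].
rewrite (@contour_shrink f z a b c d (Re z - t) (Re z + t) (Im z - t) (Im z + t)) //;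
  try (by lra); try (by apply/andP; split; lra).
have tt : 4 * M * (Re z + t - (Re z - t) + (Im z + t - (Im z - t))) <= e.
  have {}te : t * (16 * (M + 1)) <= e by rewrite -ler_pdivlMr// mulr_gt0// ltr_wpDl.
  nra.
apply: le_trans tt; apply: contour_bound; [lra|lra| |].
  by apply: (holo_off_frame hf); apply/andP; split; lra.
move=> x y /andP[x1 x2] /andP[y1 y2] xy; apply: fM.
  apply/negP => /eqP E; move: xy; rewrite -E /=.
  by case/or4P => /eqP; lra.
apply: (le_trans (normc_le_ReIm _)); rewrite !ReImE /= (splitr r).
by apply: lerD; rewrite ler_norml; apply/andP; split; lra.
Qed.

(** * Cauchy's formula *)

Lemma arctan_kernel_continuous (c e : R) : 0 < e ->
  continuous (fun x : R => e / ((x - c) ^+ 2 + e ^+ 2)).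
Proof.
move=> e0 x; apply: cvgM; first exact: cvg_cst.
apply: cvgV; first by rewrite gt_eqF// ltr_wpDl ?sqr_ge0// exprn_gt0.
apply: cvgD; last exact: cvg_cst.
by apply: cvgM; apply: cvgB => //; exact: cvg_cst.
Qed.

Lemma cintb_real (u v : R) (g : R -> R) : continuous g -> cintb u v (fun x => (g x)%:C).
Proof.
move=> cg; split; apply: continuous_compact_integrable; try exact: segment_compact.
  exact: continuous_subspaceT.
by apply: continuous_subspaceT => x; exact: cvg_cst.
Qed.

Lemma integral_arctan_kernel (c e : R) : 0 < e ->
  \int[@lebesgue_measure R]_(x in `[c - e, c + e]) (e / ((x - c) ^+ 2 + e ^+ 2)) = pi / 2.
Proof.
move=> e0; pose F x : R := atan ((x - c) / e).
have nz x : (x - c) ^+ 2 + e ^+ 2 != 0.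
  by rewrite gt_eqF// ltr_wpDl ?sqr_ge0// exprn_gt0.
have dF x : is_derive x 1 F (e / ((x - c) ^+ 2 + e ^+ 2)).
  have h : is_derive x 1 (fun x : R => (x - c) / e) (e^-1).
    by apply: is_derive_eq; rewrite scaler0 add0r subr0 [LHS]mulr1.
  have nzx := nz x; have e1 : e != 0 by rewrite gt_eqF.
  rewrite (_ : e / _ = (1 + ((x - c) / e) ^+ 2)^-1 / e); last first.
    by field; rewrite e1 addrC.
  exact: (@is_derive1_comp _ (@atan R) (fun x : R => (x - c) / e)).
have D x : derivable F x 1 by [].
have Fc : continuous F by move=> x; apply: differentiable_continuous; exact/derivable1_diffP.
rewrite /Rintegral (@continuous_FTC2 _ _ F); [|lra| | |].
- have e1 : e != 0 by rewrite gt_eqF.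
  rewrite /F (_ : (c + e - c) / e = 1); last by field.
  rewrite (_ : (c - e - c) / e = -1); last by field.
  by rewrite /= atanN atan1; field.
- exact/continuous_subspaceT/arctan_kernel_continuous.
- split; first by [].
    by apply: cvg_at_right_filter; exact: Fc.
  by apply: cvg_at_left_filter; exact: Fc.
- by move=> x _; rewrite derive1E; case: (dF x).
Qed.

Lemma holo_inv z : holo_off (fun w => (w - z)^-1) z.
Proof.
move=> w wz; exists (derive1 (fun w : R[i] => (w - z)^-1 : R[i]^o) w).
apply/is_cderivP; split=> //; apply: derivableV; first by rewrite subr_eq0.
by apply: derivableB.
Qed.

Lemma cint_real (u v : R) (g : R -> R) : cint u v (fun x => (g x)%:C) =
  (\int[@lebesgue_measure R]_(x in `[u, v]) g x)%:C.
Proof. by apply: complex_eqP; rewrite /= ?Rintegral_cst// mul0r. Qed.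

Lemma invcE (u v : R) : (u +i* v)^-1 = (u / (u ^+ 2 + v ^+ 2)) -i* (v / (u ^+ 2 + v ^+ 2)) :> R[i].
Proof. by []. Qed.

(** On a square of half side e centred at z, opposite sides combine to the
real kernel e / (x^2 + e^2), whose integral over the side is pi / 2. *)
Lemma contour_inv z a b c d : a < Re z < b -> c < Im z < d ->
  contour (fun w => (w - z)^-1) a b c d = (2 * pi)%:C * 'i.
Proof.
case: z => zx zy /= zab zcd; set z := zx +i* zy; have hf := @holo_inv z.
pose e := Num.min (Num.min (zx - a) (b - zx)) (Num.min (zy - c) (d - zy)).
move: (zab) (zcd) => /andP[az zb] /andP[cz zd].
have e0 : 0 < e by rewrite !lt_min !subr_gt0 az zb cz zd.
have := lexx e; rewrite {2}/e !le_min => /andP[/andP[t1 t2] /andP[t3 t4]].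
have -> : contour (fun w => (w - z)^-1) a b c d =
    contour (fun w => (w - z)^-1) (zx - e) (zx + e) (zy - e) (zy + e).
  by apply: (contour_shrink hf) => /=; first [lra|apply/andP; split; lra].
have := @frame_cintb (fun w => (w - z)^-1) (zx - e) (zx + e) (zy - e) (zy + e).
case; [lra|lra|by apply: (holo_off_frame hf); apply/andP; split => /=; lra|].
move=> i1 i2 i3 i4.
rewrite /contour -!cintB//.
have nz x : x ^+ 2 + e ^+ 2 != 0 by rewrite gt_eqF// ltr_wpDl ?sqr_ge0// exprn_gt0.
have nz' x : e ^+ 2 + x ^+ 2 != 0 by rewrite addrC.
have k1 : cintb (zx - e) (zx + e) (fun x => (e / ((x - zx) ^+ 2 + e ^+ 2))%:C).
  exact/cintb_real/arctan_kernel_continuous.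
have k2 : cintb (zy - e) (zy + e) (fun x => (e / ((x - zy) ^+ 2 + e ^+ 2))%:C).
  exact/cintb_real/arctan_kernel_continuous.
rewrite (_ : cint (zx - e) (zx + e) _ = cint (zx - e) (zx + e)
    (fun x => 2 * 'i * (e / ((x - zx) ^+ 2 + e ^+ 2))%:C)); last first.
  apply: eq_cint => x _; rewrite /z.
  have -> : (x +i* (zy - e)) - (zx +i* zy) = (x - zx) +i* (- e) :> R[i].
    by apply: complex_eqP; rewrite !ReImE /=; ring.
  have -> : (x +i* (zy + e)) - (zx +i* zy) = (x - zx) +i* e :> R[i].
    by apply: complex_eqP; rewrite !ReImE /=; ring.
  by rewrite !invcE sqrrN; apply: complex_eqP; rewrite !ReImE /=; field; exact: nz.
rewrite (_ : cint (zy - e) (zy + e) _ = cint (zy - e) (zy + e)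
    (fun x => 2 * (e / ((x - zy) ^+ 2 + e ^+ 2))%:C)); last first.
  apply: eq_cint => x _; rewrite /z.
  have -> : ((zx + e) +i* x) - (zx +i* zy) = e +i* (x - zy) :> R[i].
    by apply: complex_eqP; rewrite !ReImE /=; ring.
  have -> : ((zx - e) +i* x) - (zx +i* zy) = (- e) +i* (x - zy) :> R[i].
    by apply: complex_eqP; rewrite !ReImE /=; ring.
  by rewrite !invcE sqrrN [e ^+ 2 + _]addrC; apply: complex_eqP; rewrite !ReImE /=; field; exact: nz.
rewrite !cintZ// !cint_real !integral_arctan_kernel//.
by apply: complex_eqP; rewrite !ReImE /=; field.
Qed.

Lemma derivable_cderiv f z : (exists d, is_cderiv f z d) <->
  derivable (f : R[i]^o -> R[i]^o) z 1.
Proof.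
split=> [[d /is_cderivP[]]//|df].
by exists (derive1 (f : R[i] -> R[i]^o) z); apply/is_cderivP.
Qed.

Definition cdiff f := forall z, exists d, is_cderiv f z d.

Lemma cdiff_ccont f z : cdiff f -> ccont_at f z.
Proof. by move=> /(_ z)[d]; exact: is_cderiv_ccont. Qed.

(** The difference quotient (f w - f z) / (w - z) is bounded near z, so
its contour integral vanishes by [contour_removable]. *)
Theorem cauchy_formula f z a b c d : cdiff f -> a < Re z < b -> c < Im z < d ->
  contour (fun w => f w * (w - z)^-1) a b c d = (2 * pi)%:C * 'i * f z.
Proof.
move=> df zab zcd.
have h1 : holo_off (fun w => f w * (w - z)^-1) z.
  move=> w wz; apply/derivable_cderiv; apply: derivableM; first exact/derivable_cderiv.
  exact/derivable_cderiv/holo_inv.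
have h2 : holo_off (fun w => f z * (w - z)^-1) z.
  move=> w wz; apply/derivable_cderiv; apply: derivableM => //.
  exact/derivable_cderiv/holo_inv.
have h3 : holo_off (fun w => f w * (w - z)^-1 - f z * (w - z)^-1) z.
  move=> w wz; apply/derivable_cderiv; apply: derivableB; apply/derivable_cderiv.
    exact: h1.
  exact: h2.
have ab : a <= b by move: zab => /andP[]; lra.
have cd : c <= d by move: zcd => /andP[]; lra.
have : contour (fun w => f w * (w - z)^-1 - f z * (w - z)^-1) a b c d = 0.
  have [k Hk] := df z; have [r r0 Hr] := Hk _ ltr01.
  apply: (@contour_removable _ z _ _ _ _ (normc k + 1) r) => //.
  move=> w wz wr; have wz0 : w - z != 0 by rewrite subr_eq0.
  have -> : f w * (w - z)^-1 - f z * (w - z)^-1 = k + (f w - f z - k * (w - z)) / (w - z).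
    by field.
  apply: (le_trans (le_normcD _ _)); rewrite lerD2l Normc.normcM Normc.normcV.
  rewrite ler_pdivrMr ?normc_gt0// ; exact: Hr.
rewrite contourB//; [|exact: holo_off_frame h1 _ _|exact: holo_off_frame h2 _ _].
move=> /subr0_eq ->; rewrite contourZ//; last exact: holo_off_frame (@holo_inv z) _ _.
by rewrite contour_inv// mulrC.
Qed.

Lemma normc_lipschitz (z w : R[i]) : `|normc z - normc w| <= normc (z - w).
Proof.
have T (u v : R[i]) : normc u - normc v <= normc (u - v).
  by rewrite lerBlDr -{1}[u](subrK v) le_normcD.
by rewrite ler_norml T andbT lerNl opprB normcB T.
Qed.

Lemma frame_bounded f a b c d : a <= b -> c <= d -> ccont_frame f a b c d ->
  exists2 M : R, 0 <= M & forall x y, a <= x <= b -> c <= y <= d ->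
     [|| x == a, x == b, y == c | y == d] -> normc (f (x +i* y)) <= M.
Proof.
move=> ab cd cf.
have hl y : c <= y <= d -> (y == c) || (y == d) ->
    exists2 M : R, 0 <= M & forall x, a <= x <= b -> normc (f (x +i* y)) <= M.
  move=> yy yb; have [|m _ Hm] := @EVT_max _ (fun x => normc (f (x +i* y))) a b ab.
    apply: lipschitz_hline; first exact: normc_lipschitz.
    by move=> x xx; apply: cf => //; rewrite yb !orbT.
  by exists (normc (f (m +i* y))); [exact: normc_ge0|move=> x xx; apply: Hm; rewrite in_itv].
have vl x : a <= x <= b -> (x == a) || (x == b) ->
    exists2 M : R, 0 <= M & forall y, c <= y <= d -> normc (f (x +i* y)) <= M.
  move=> xx xb; have [|m _ Hm] := @EVT_max _ (fun y => normc (f (x +i* y))) c d cd.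
    apply: lipschitz_vline; first exact: normc_lipschitz.
    by move=> y yy; apply: cf => //; rewrite !orbA xb.
  by exists (normc (f (x +i* m))); [exact: normc_ge0|move=> y yy; apply: Hm; rewrite in_itv].
have [||M1 M10 H1] := hl c; rewrite ?lexx ?eqxx//.
have [||M2 M20 H2] := hl d; rewrite ?lexx ?cd ?eqxx ?orbT//.
have [||M3 M30 H3] := vl a; rewrite ?lexx ?eqxx//.
have [||M4 M40 H4] := vl b; rewrite ?lexx ?ab ?eqxx ?orbT//.
exists (M1 + M2 + M3 + M4); first by rewrite !addr_ge0.
move=> x y xx yy /or4P[] /eqP E; rewrite ?E.
- by apply: (le_trans (H3 y yy)); lra.
- by apply: (le_trans (H4 y yy)); lra.
- by apply: (le_trans (H1 x xx)); lra.
- by apply: (le_trans (H2 x xx)); lra.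
Qed.

(** * Derivatives of entire functions and Cauchy's estimates *)

(** Up to the factor 2 pi i these are f, f' and f'' / 2 for n = 1, 2, 3
([deriv_kernel]). *)
Definition ckernel n f a b c d z := contour (fun w => f w * ((w - z)^-1) ^+ n) a b c d.

Lemma frame_dist z x y a b c d (rho : R) : [|| x == a, x == b, y == c | y == d] ->
  a + rho <= Re z <= b - rho -> c + rho <= Im z <= d - rho ->
  rho <= normc ((x +i* y) - z).
Proof.
move=> xy /andP[z1 z2] /andP[z3 z4].
case/or4P: xy => /eqP ->.
- by apply: le_trans (Re_le_normc _); rewrite !ReImE /= distrC ler_normr; lra.
- by apply: le_trans (Re_le_normc _); rewrite !ReImE /= ler_normr; lra.
- by apply: le_trans (Im_le_normc _); rewrite !ReImE /= distrC ler_normr; lra.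
- by apply: le_trans (Im_le_normc _); rewrite !ReImE /= ler_normr; lra.
Qed.

Lemma derivable_expr f n w : derivable (f : R[i]^o -> R[i]^o) w 1 ->
  derivable ((fun v => f v ^+ n) : R[i]^o -> R[i]^o) w 1.
Proof.
move=> df; elim: n => [|n IH].
  have -> : (fun v : R[i]^o => f v ^+ 0 : R[i]^o) = cst (1 : R[i]^o).
    by apply/funext => v; rewrite expr0.
  exact: derivable_cst.
have -> : (fun v : R[i]^o => f v ^+ n.+1 : R[i]^o) =
    (f : R[i]^o -> R[i]^o) * (fun v : R[i]^o => f v ^+ n : R[i]^o).
  by apply/funext => v; rewrite exprS.
by apply: derivableM; [exact: df|exact: IH].
Qed.

Lemma ccont_kernel n f z w : cdiff f -> w != z ->
  ccont_at (fun w => f w * ((w - z)^-1) ^+ n) w.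
Proof.
move=> df wz; suff [d] : exists d, is_cderiv (fun w => f w * ((w - z)^-1) ^+ n) w d.
  exact: is_cderiv_ccont.
apply/derivable_cderiv; apply: derivableM; first exact/derivable_cderiv.
apply: (@derivable_expr (fun w => (w - z)^-1)).
exact/derivable_cderiv/holo_inv.
Qed.

Lemma frame_kernel n f z a b c d : cdiff f -> a < Re z < b -> c < Im z < d ->
  ccont_frame (fun w => f w * ((w - z)^-1) ^+ n) a b c d.
Proof.
case: z => zx zy df /= /andP[az zb] /andP[cz zd] x y xab ycd xy.
apply: ccont_kernel => //.
apply/negP => /eqP[xz yz]; move: az zb cz zd; rewrite -xz -yz.
by case/or4P: xy => /eqP ->; rewrite ltxx.
Qed.

Section kernel_derivative.
Variables (f : R[i] -> R[i]) (a b c d : R) (z : R[i]).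
Hypotheses (df : cdiff f) (za : a < Re z < b) (zc : c < Im z < d).

Notation K n := (ckernel n f a b c d).

Let rho := Num.min (Num.min (Re z - a) (b - Re z)) (Num.min (Im z - c) (d - Im z)).

Let rho_gt0 : 0 < rho.
Proof.
by move: za zc => /andP[z1 z2] /andP[z3 z4]; rewrite !lt_min !subr_gt0 z1 z2 z3 z4.
Qed.

Let rho_in : [/\ rho <= Re z - a, rho <= b - Re z, rho <= Im z - c & rho <= d - Im z].
Proof. by have := lexx rho; rewrite {2}/rho !le_min => /andP[/andP[]+ +/andP[]]. Qed.

Let ab : a <= b. Proof. by move: za => /andP[]; lra. Qed.
Let cd : c <= d. Proof. by move: zc => /andP[]; lra. Qed.

Let near_in w : normc (w - z) <= rho / 2 ->
  [/\ a + rho / 2 <= Re w <= b - rho / 2 & c + rho / 2 <= Im w <= d - rho / 2].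
Proof.
move=> wz; have [r1 r2 r3 r4] := rho_in; have r0 := rho_gt0.
have := le_trans (Re_le_normc _) wz; have := le_trans (Im_le_normc _) wz.
rewrite !ReImE !ler_norml => /andP[h1 h2] /andP[h3 h4].
by split; apply/andP; split; lra.
Qed.

Let frK n w : normc (w - z) <= rho / 2 ->
  ccont_frame (fun v => f v * ((v - w)^-1) ^+ n) a b c d.
Proof.
move=> /near_in[/andP[h1 h2] /andP[h3 h4]]; have := rho_gt0.
by move=> r0; apply: frame_kernel => //; apply/andP; split; lra.
Qed.

Let z_near : normc (z - z) <= rho / 2.
Proof. by rewrite subrr Normc.normc0 divr_ge0// ltW. Qed.

(** The second order remainder of the power kernel, integrated over the contour.
Only points at distance at least rho from z and rho / 2 from w occur there. *)
Let taylor n (k C : R[i]) :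
  (forall w v : R[i], v != z -> v != w -> normc (v - z)^-1 <= rho^-1 -> normc (v - w)^-1 <= 2 / rho ->
    normc (((v - w)^-1) ^+ n - ((v - z)^-1) ^+ n - (w - z) * k * ((v - z)^-1) ^+ n.+1)
      <= normc (w - z) ^+ 2 * normc C) ->
  is_cderiv (K n) z (k * K n.+1 z).
Proof.
move=> H; have r0 := rho_gt0.
have [M M0 HM] := frame_bounded ab cd (fun x y h1 h2 _ => cdiff_ccont (x +i* y) df).
pose L : R := 4 * (M * normc C) * ((b - a) + (d - c)).
have L0 : 0 <= L by rewrite !mulr_ge0// ?normc_ge0// addr_ge0// subr_ge0.
move=> e e0; exists (Num.min (rho / 2) (e / (L + 1))).
  by rewrite lt_min !divr_gt0// ltr_wpDl.
move=> w; rewrite le_min => /andP[wr we].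
have fr g g' : ccont_frame g a b c d -> ccont_frame g' a b c d ->
    ccont_frame (fun w => g w - g' w) a b c d.
  by move=> cg cg' x y xx yy xy; apply: ccontB; [exact: cg|exact: cg'].
have frZ (q : R[i]) g : ccont_frame g a b c d -> ccont_frame (fun w => q * g w) a b c d.
  by move=> cg x y xx yy xy; apply: ccontZ; exact: cg.
have k1 := frK n wr; have k0 := frK n z_near; have k2 := frK n.+1 z_near.
have -> : K n w - K n z - k * K n.+1 z * (w - z) =
  contour (fun v => f v * ((v - w)^-1) ^+ n - f v * ((v - z)^-1) ^+ n
    - (w - z) * k * (f v * ((v - z)^-1) ^+ n.+1)) a b c d.
  rewrite (contourB ab cd (fr _ _ k1 k0) (frZ _ _ k2)) (contourB ab cd k1 k0) (contourZ _ ab cd k2).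
  rewrite -/(K n w) -/(K n z) -/(K n.+1 z).
  by move: (K n w) (K n z) (K n.+1 z) => u v t; ring.
apply: (@le_trans _ _ (4 * (M * (normc (w - z) ^+ 2 * normc C)) * ((b - a) + (d - c)))).
  apply: contour_bound => //; first exact: (fr _ _ (fr _ _ k1 k0) (frZ _ _ k2)).
  move=> x y xx yy xy; set v := x +i* y.
  have [r1 r2 r3 r4] := rho_in.
  have vz : rho <= normc (v - z) by apply: (frame_dist xy); apply/andP; split; lra.
  have vw : rho / 2 <= normc (v - w) by have [] := near_in wr; exact: frame_dist xy.
  have vz0 : v != z by rewrite -subr_eq0 -normc_eq0 gt_eqF// (lt_le_trans _ vz).
  have vw0 : v != w by rewrite -subr_eq0 -normc_eq0 gt_eqF// (lt_le_trans _ vw)// divr_gt0.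
  have -> : f v * (v - w)^-1 ^+ n - f v * (v - z)^-1 ^+ n -
      (w - z) * k * (f v * (v - z)^-1 ^+ n.+1) =
     f v * ((v - w)^-1 ^+ n - (v - z)^-1 ^+ n - (w - z) * k * (v - z)^-1 ^+ n.+1) by ring.
  rewrite Normc.normcM; apply: ler_pM; rewrite ?normc_ge0//; first exact: HM.
  apply: H => //.
    by rewrite Normc.normcV lef_pV2// posrE// (lt_le_trans _ vz).
  rewrite Normc.normcV -[2 / rho]invf_div lef_pV2// posrE ?divr_gt0//.
  by rewrite (lt_le_trans _ vw)// divr_gt0.
have -> : 4 * (M * (normc (w - z) ^+ 2 * normc C)) * ((b - a) + (d - c)) =
   (normc (w - z) * L) * normc (w - z) by rewrite /L; ring.
rewrite ler_wpM2r ?normc_ge0//.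
apply: (@le_trans _ _ (e / (L + 1) * L)); first by rewrite ler_wpM2r.
by rewrite mulrAC ler_pdivrMr ?ltr_wpDl// ler_pM2l// lerDl.
Qed.

Let diffV (v w : R[i]) : v != z -> v != w ->
  (v - w)^-1 - (v - z)^-1 = (w - z) * (v - z)^-1 * (v - w)^-1.
Proof. by move=> vz vw; field; rewrite !subr_eq0 vz vw. Qed.

Lemma ckernel1_derivative : is_cderiv (K 1) z (K 2 z).
Proof.
rewrite -[K 2 z]mul1r; apply: (@taylor 1 1 (2 * rho^-1 ^+ 3)%:C) => w v vz vw uz uw.
rewrite !expr1 mulr1.
have -> : (v - w)^-1 - (v - z)^-1 - (w - z) * (v - z)^-1 ^+ 2 =
   (w - z) ^+ 2 * ((v - z)^-1 ^+ 2 * (v - w)^-1).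
  have := diffV vz vw; set s := (v - z)^-1; set t := (v - w)^-1 => E; rewrite E.
  have -> : (w - z) * s * t - (w - z) * s ^+ 2 = (w - z) * s * (t - s) by ring.
  by rewrite E; ring.
rewrite Normc.normcM normcX ler_wpM2l ?sqr_ge0// normc_real ger0_norm; last first.
  by rewrite mulr_ge0// exprn_ge0// invr_ge0 ltW.
rewrite Normc.normcM normcX.
have -> : 2 * rho^-1 ^+ 3 = rho^-1 ^+ 2 * (2 / rho) by rewrite exprSr; ring.
by rewrite ler_pM ?normc_ge0 ?sqr_ge0// lerXn2r ?nnegrE ?normc_ge0// invr_ge0 ltW.
Qed.

Lemma ckernel2_derivative : is_cderiv (K 2) z (2 * K 3 z).
Proof.
apply: (@taylor 2 2 (10 * rho^-1 ^+ 4)%:C) => w v vz vw uz uw.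
have -> : (v - w)^-1 ^+ 2 - (v - z)^-1 ^+ 2 - (w - z) * 2 * (v - z)^-1 ^+ 3 =
   (w - z) ^+ 2 * ((v - z)^-1 ^+ 2 * (v - w)^-1 * ((v - w)^-1 + 2 * (v - z)^-1)).
  have := diffV vz vw; set s := (v - z)^-1; set t := (v - w)^-1 => E.
  rewrite subr_sqr E.
  have -> : (w - z) * s * t * (t + s) - (w - z) * 2 * s ^+ 3 =
     (w - z) * s * ((t - s) * (t + 2 * s)) by ring.
  by rewrite E; ring.
rewrite Normc.normcM normcX ler_wpM2l ?sqr_ge0// normc_real ger0_norm; last first.
  by rewrite mulr_ge0// exprn_ge0// invr_ge0 ltW.
have r0 : 0 <= rho^-1 by rewrite invr_ge0 ltW.
have s0 := normc_ge0 (v - z)^-1; have t0 := normc_ge0 (v - w)^-1.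
have n2 : normc (2 : R[i]) = 2 by rewrite -(rmorph_nat (real_complex R) 2) normc_real normr_nat.
rewrite Normc.normcM (Normc.normcM (_ ^+ 2)) normcX.
have -> : 10 * rho^-1 ^+ 4 = rho^-1 ^+ 2 * (2 / rho) * (5 * rho^-1) by ring.
apply: ler_pM; rewrite ?normc_ge0 ?mulr_ge0 ?sqr_ge0//.
  by apply: ler_pM; rewrite ?sqr_ge0// lerXn2r ?nnegrE.
apply: (le_trans (le_normcD _ _)); rewrite Normc.normcM n2; lra.
Qed.

End kernel_derivative.

Lemma is_cderiv_near f g z k (r : R) : 0 < r ->
  (forall w, normc (w - z) <= r -> f w = g w) -> is_cderiv f z k -> is_cderiv g z k.
Proof.
move=> r0 fg fk e e0; have [q q0 Hq] := fk e e0.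
exists (Num.min r q); first by rewrite lt_min r0.
move=> w; rewrite le_min => /andP[wr wq].
by rewrite -!fg// ?subrr ?Normc.normc0 ?(ltW r0)//; exact: Hq.
Qed.

Lemma is_cderivZ q f z k : is_cderiv f z k -> is_cderiv (fun w => q * f w) z (q * k).
Proof.
move=> fk e e0; have q0 : 0 < normc q + 1 by rewrite ltr_wpDl ?normc_ge0.
have [|r r0 Hr] := fk (e / (normc q + 1)); first by rewrite divr_gt0.
exists r => // w /Hr h.
have -> : q * f w - q * f z - q * k * (w - z) = q * (f w - f z - k * (w - z)) by ring.
rewrite Normc.normcM; apply: (@le_trans _ _ ((normc q + 1) * (e / (normc q + 1) * normc (w - z)))).
  by apply: ler_pM; rewrite ?normc_ge0// lerDl.
by rewrite mulrA mulrCA divff ?gt_eqF// mulr1.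
Qed.

Notation tpi := ((2 * pi)%:C * 'i : R[i]).

Lemma normc_tpi : normc tpi = 2 * pi.
Proof.
rewrite Normc.normcM normc_real ger0_norm ?mulr_ge0 ?pi_ge0//.
by rewrite /= expr0n expr1n add0r sqrtr1 mulr1.
Qed.

Lemma tpi_neq0 : tpi != 0.
Proof. by rewrite -normc_eq0 normc_tpi gt_eqF// mulr_gt0// pi_gt0. Qed.

Lemma open_rect z a b c d : a < Re z < b -> c < Im z < d ->
  exists2 r : R, 0 < r & forall w, normc (w - z) <= r -> a < Re w < b /\ c < Im w < d.
Proof.
move=> /andP[z1 z2] /andP[z3 z4].
pose r := Num.min (Num.min (Re z - a) (b - Re z)) (Num.min (Im z - c) (d - Im z)).
have r0 : 0 < r by rewrite !lt_min !subr_gt0 z1 z2 z3 z4.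
have := lexx r; rewrite {2}/r !le_min => /andP[/andP[r1 r2] /andP[r3 r4]].
exists (r / 2); first by rewrite divr_gt0.
move=> w wz; have := le_trans (Re_le_normc _) wz; have := le_trans (Im_le_normc _) wz.
rewrite !ReImE !ler_norml => /andP[h1 h2] /andP[h3 h4].
by split; apply/andP; split; lra.
Qed.

Notation deriv f := (derive1 (f : R[i] -> R[i]^o)).

Lemma deriv_kernel f z a b c d : cdiff f -> a < Re z < b -> c < Im z < d ->
  deriv f z = tpi^-1 * ckernel 2 f a b c d z.
Proof.
move=> df za zc; have [r r0 Hr] := open_rect za zc.
suff /is_cderivP[_ //] : is_cderiv f z (tpi^-1 * ckernel 2 f a b c d z).
apply: (@is_cderiv_near (fun w => tpi^-1 * ckernel 1 f a b c d w) _ _ _ r) => //.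
  move=> w /Hr[wa wc]; rewrite /ckernel; under [X in contour X]eq_fun do rewrite expr1.
  by rewrite cauchy_formula// mulKf// tpi_neq0.
exact/is_cderivZ/ckernel1_derivative.
Qed.

(** f' is the second order Cauchy kernel near z, and that kernel is
differentiable. *)
Theorem cdiff_deriv f : cdiff f -> cdiff (deriv f).
Proof.
move=> df z.
have za : Re z - 1 < Re z < Re z + 1 by apply/andP; split; lra.
have zc : Im z - 1 < Im z < Im z + 1 by apply/andP; split; lra.
have [r r0 Hr] := open_rect za zc.
set K := fun n => ckernel n f (Re z - 1) (Re z + 1) (Im z - 1) (Im z + 1).
exists (tpi^-1 * (2 * K 3%N z)).
apply: (@is_cderiv_near (fun w => tpi^-1 * K 2%N w) _ _ _ r) => //.
  by move=> w /Hr[wa wc]; rewrite (deriv_kernel df wa wc).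
exact/is_cderivZ/ckernel2_derivative.
Qed.

(** The kernel is at most M / r^2 on the boundary of the square of half
side r, so [contour_bound] gives 16 M / r, to be divided by 2 pi >= 4. *)
Lemma cauchy_estimate f z (r M : R) : cdiff f -> 0 < r ->
  (forall w, `|Re (w - z)| <= r -> `|Im (w - z)| <= r -> normc (f w) <= M) ->
  normc (deriv f z) <= 4 / r * M.
Proof.
move=> df r0 fM.
have za : Re z - r < Re z < Re z + r by apply/andP; split; lra.
have zc : Im z - r < Im z < Im z + r by apply/andP; split; lra.
have M0 : 0 <= M.
  by apply: le_trans (fM z _ _); rewrite ?normc_ge0// subrr normr0 ltW.
rewrite (deriv_kernel df za zc) Normc.normcM Normc.normcV normc_tpi.
have pi2 := pi_ge2 R.
rewrite ler_pdivrMl; last by rewrite mulr_gt0// pi_gt0.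
apply: (@le_trans _ _ (4 * (M * r^-1 ^+ 2) * ((Re z + r - (Re z - r)) + (Im z + r - (Im z - r))))).
  apply: contour_bound; [lra|lra|exact: frame_kernel|].
  move=> x y /andP[x1 x2] /andP[y1 y2] xy; rewrite Normc.normcM normcX Normc.normcV.
  have rz : r <= normc ((x +i* y) - z) by apply: (frame_dist xy); apply/andP; split; lra.
  apply: ler_pM; rewrite ?normc_ge0 ?sqr_ge0//.
    by apply: fM; rewrite !ReImE /= ler_norml; apply/andP; split; lra.
  by rewrite lerXn2r ?nnegrE ?invr_ge0 ?normc_ge0 ?(ltW r0)// lef_pV2// posrE// (lt_le_trans r0).
have -> : 4 * (M * r^-1 ^+ 2) * (Re z + r - (Re z - r) + (Im z + r - (Im z - r))) =
   2 * 2 * (4 / r * M) by field; rewrite gt_eqF.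
have q0 : 0 <= 4 / r * M by rewrite mulr_ge0// divr_ge0// ltW.
by rewrite ler_wpM2r// ler_wpM2l.
Qed.

Lemma cdiff_cderiv n f : cdiff f -> cdiff (cderiv n f).
Proof.
elim: n f => [//|n IH] f df; rewrite /cderiv derive1Sn.
exact/(IH (deriv f))/cdiff_deriv.
Qed.

(** Each differentiation uses up a margin r, whence the margin n r. *)
Lemma cauchy_estimates n f z (r M : R) : cdiff f -> 0 < r ->
  (forall w, `|Re (w - z)| <= n%:R * r -> `|Im (w - z)| <= n%:R * r -> normc (f w) <= M) ->
  normc (cderiv n f z) <= (4 / r) ^+ n * M.
Proof.
elim: n f M => [|n IH] f M df r0 fM.
  by rewrite expr0 mul1r; apply: fM; rewrite subrr normr0 mul0r.
rewrite /cderiv derive1Sn exprSr -mulrA.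
apply: (IH (deriv f)) => //; first exact: cdiff_deriv.
move=> w w1 w2; apply: cauchy_estimate => // v v1 v2.
have -> : v = (v - w) + w by rewrite subrK.
have E (x y t : R) : `|x| <= r -> `|y| <= n%:R * r -> t = x + y -> `|t| <= n.+1%:R * r.
  move=> xr yr ->; rewrite -natr1 mulrDl mul1r addrC.
  by apply: (le_trans (ler_normD _ _)); exact: lerD.
apply: fM; rewrite -addrA.
  by apply: E v1 w1 _; rewrite !ReImE.
by apply: E v2 w2 _; rewrite !ReImE.
Qed.

End contour.

(** * Measurability on the plane and the mean value inequality *)

Section plane.
Context (R : realType).
Notation leb := (@lebesgue_measure R).
Implicit Types (f : R[i] -> R[i]) (p q : R * R).

Notation area := (leb \x leb)%E.

Lemma area_sigma_finite : sigma_finite setT (area : set (R * R) -> \bar R).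
Proof.
exists (fun n : nat => `]- n%:R, n%:R[ `*` `]- n%:R, n%:R[ : set (R * R)).
  apply/seteqP; split=> // -[x y] _.
  exists (Num.truncn (`|x| + `|y|)).+1 => //; split; rewrite /= in_itv /= -ltr_norml;
    by rewrite (le_lt_trans _ (truncnS_gt _))// ?lerDl ?lerDr.
move=> n; split; first exact: measurableX.
rewrite product_measure1E//=.
by rewrite lebesgue_measure_itv/=; case: ifP; rewrite ?mule0// -EFinB -EFinM ltry.
Qed.

Let box (c : rat * rat * rat) : set (R * R) :=
  `]ratr c.1.1 - ratr c.2, ratr c.1.1 + ratr c.2[ `*`
  `]ratr c.1.2 - ratr c.2, ratr c.1.2 + ratr c.2[.

(** The sigma-algebra of R * R is the product one; open sets belong to it
as countable unions of rational boxes. *)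
Lemma measurable_box_open (U : set (R * R)) :
  (forall p, U p -> exists2 r : R, 0 < r &
    forall q, `|q.1 - p.1| < r -> `|q.2 - p.2| < r -> U q) ->
  measurable U.
Proof.
move=> oU.
pose F (a b e : rat) := [set p | box (a, b, e) p /\ box (a, b, e) `<=` U].
suff -> : U = \bigcup_a \bigcup_b \bigcup_e F a b e.
  apply: bigcupT_measurable_rat => a; apply: bigcupT_measurable_rat => b.
  apply: bigcupT_measurable_rat => e.
  have [BU|BU] := pselect (box (a, b, e) `<=` U).
    by rewrite (_ : F a b e = box (a, b, e)); [exact: measurableX|apply/seteqP; split=> // p []].
  by rewrite (_ : F a b e = set0); [exact: measurable0|apply/seteqP; split=> // p []].
apply/seteqP; split; last by move=> p [a _ [b _ [e _ [Bp BU]]]]; exact: BU.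
move=> [x y] /oU[r r0 H].
have [e] : exists e : rat, ratr e \in `]0, (r / 2)[%R by apply: rat_in_itvoo; rewrite divr_gt0.
rewrite in_itv /= => /andP[e0 er].
have [a] : exists a : rat, ratr a \in `](x - ratr e), x[%R by apply: rat_in_itvoo; lra.
rewrite in_itv /= => /andP[a1 a2].
have [b] : exists b : rat, ratr b \in `](y - ratr e), y[%R by apply: rat_in_itvoo; lra.
rewrite in_itv /= => /andP[b1 b2].
exists a => //; exists b => //; exists e => //; split.
  by rewrite /box; split => /=; rewrite in_itv /=; apply/andP; split; lra.
move=> -[u v] /= []; rewrite /= !in_itv /= => /andP[u1 u2] /andP[v1 v2].
by apply: H; rewrite /= ltr_norml; apply/andP; split; lra.
Qed.

Lemma measurable_box_continuous (h : R * R -> R) :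
  (forall p (e : R), 0 < e -> exists2 r : R, 0 < r &
    forall q, `|q.1 - p.1| < r -> `|q.2 - p.2| < r -> `|h q - h p| < e) ->
  measurable_fun setT h.
Proof.
move=> hc; apply: (measurability _ (RGenOInfty.measurableE R)).
move=> _ [_ [t ->] <-]; rewrite setTI; apply: measurable_box_open => p /=.
rewrite in_itv /= andbT => tp.
have [|r r0 H] := hc p (h p - t); first by rewrite subr_gt0.
exists r => // q q1 q2; rewrite /= in_itv /= andbT.
by have := H q q1 q2; rewrite ltr_norml => /andP[]; lra.
Qed.

(** As in [lipschitz_hline], k stands for the modulus or one of the two
parts. *)
Lemma measurable_normc_z f (k : R[i] -> R) : (forall z w, `|k z - k w| <= normc (z - w)) ->
  (forall z, ccont_at f z) -> measurable_fun setT (fun p : R * R => k (f (z_of p))).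
Proof.
move=> kl cf; apply: measurable_box_continuous => p e e0.
have [|r r0 H] := cf (z_of p) (e / 2); first by rewrite divr_gt0.
exists (r / 2); first by rewrite divr_gt0.
move=> q q1 q2; apply: (@le_lt_trans _ _ (e / 2)); last by rewrite ltr_pdivrMr// ltr_pMr// ltr1n.
apply: (le_trans (kl _ _)); apply: H.
by apply: (le_trans (normc_le_ReIm _)); rewrite !ReImE /= (splitr r) lerD// ltW.
Qed.

Lemma cint_ereal (a b : R) (phi : R -> R[i]) (g : R -> R) : cintb a b phi ->
  measurable_fun `[a, b] g -> (forall x, a <= x <= b -> normc (phi x) <= g x) ->
  ((normc (cint a b phi))%:E <= 2%:E * \int[leb]_(x in `[a, b]) (g x)%:E)%E.
Proof.
move=> [i1 i2] mg phig.
have key (k : R[i] -> R) : (forall z, `|k z| <= normc z) ->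
   leb.-integrable `[a, b] (EFin \o (fun x => k (phi x))) ->
   (`|\int[leb]_(x in `[a, b]) k (phi x)|%:E <= \int[leb]_(x in `[a, b]) (g x)%:E)%E.
  move=> kl ik; rewrite EFin_normr_Rintegral//.
  apply: le_trans; first by apply: le_abse_integral => //; exact: measurable_int ik.
  apply: ge0_le_integral => //.
  - by apply: measurableT_comp; [exact: abse_measurable|exact: measurable_int ik].
  - by apply/measurable_EFinP.
  - move=> x /=; rewrite in_itv /= => xab; rewrite lee_fin.
    exact: le_trans (kl _) (phig _ xab).
apply: (@le_trans _ _ (`|Re (cint a b phi)|%:E + `|Im (cint a b phi)|%:E)%E).
  by rewrite -EFinD lee_fin; exact: normc_le_ReIm.
rewrite (_ : 2%:E = 1%:E + 1%:E)%E; last by rewrite -EFinD.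
rewrite ge0_muleDl// mul1e; apply: leeD; apply: key => //.
- exact: Re_le_normc.
- exact: Im_le_normc.
Qed.

(** A function is somewhere at most its mean; the margin e makes the
contradiction strict. *)
Lemma average_pick (a b S e : R) (G : R -> \bar R) : a < b -> 0 < e ->
  measurable_fun `[a, b] G -> (forall x, 0 <= G x)%E ->
  (\int[leb]_(x in `[a, b]) G x <= S%:E)%E ->
  exists2 x, a <= x <= b & (G x <= ((S + e) / (b - a))%:E)%E.
Proof.
move=> ab e0 mG G0 GS; have ba : 0 < b - a by rewrite subr_gt0.
apply: contrapT => H.
suff : ((S + e)%:E <= S%:E)%E by rewrite lee_fin gerDl leNgt e0.
apply: le_trans GS.
have -> : ((S + e)%:E = \int[leb]_(x in `[a, b]) ((S + e) / (b - a))%:E)%E.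
  rewrite integral_cst//= lebesgue_measure_itv/= lte_fin ab -EFinB -EFinM.
  by rewrite divfK// gt_eqF.
have lb x : a <= x <= b -> (((S + e) / (b - a))%:E <= G x)%E.
  by move=> xab; rewrite leNgt; apply/negP => /ltW Gx; apply: H; exists x.
have [S0|S0] := leP 0 ((S + e) / (b - a)).
  by apply: ge0_le_integral => // x; rewrite /= in_itv /= => /lb.
apply: (@le_trans _ _ 0%E); last exact: integral_ge0.
rewrite integral_cst//= lebesgue_measure_itv/= lte_fin ab -EFinB -EFinM lee_fin.
by rewrite mulr_le0_ge0// ltW.
Qed.

Definition square (z : R[i]) (r : R) : set (R * R) :=
  `[Re z - r, Re z + r] `*` `[Im z - r, Im z + r].

Lemma measurable_square z r : measurable (square z r).
Proof. exact: measurableX. Qed.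

Lemma squareP z r p : square z r p <-> `|p.1 - Re z| <= r /\ `|p.2 - Im z| <= r.
Proof. by rewrite /square /= !in_itv /= -!ler_distl. Qed.

Section mean_value.
Variables (f : R[i] -> R[i]) (z : R[i]).
Hypothesis df : cdiff f.

Let F (p : R * R) : \bar R := (normc (f (z_of p)) * \1_(square z (1/2)) p)%:E.

Let mF : measurable_fun setT F.
Proof.
apply/measurable_EFinP; apply: measurable_funM.
  by apply: measurable_normc_z; [exact: normc_lipschitz|move=> ?; exact: cdiff_ccont].
apply: measurable_indic; exact: measurable_square.
Qed.

Let F0 p : (0 <= F p)%E.
Proof. by rewrite lee_fin mulr_ge0 ?normc_ge0// indicE ler0n. Qed.

Let GX x : \bar R := (\int[leb]_y F (x, y))%E.
Let GY y : \bar R := (\int[leb]_x F (x, y))%E.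

Let GX0 x : (0 <= GX x)%E. Proof. exact: integral_ge0. Qed.
Let GY0 x : (0 <= GY x)%E. Proof. exact: integral_ge0. Qed.

Let mGX : measurable_fun setT GX.
Proof. exact: (measurable_fun_fubini_tonelli_F (m2 := leb) _ mF F0). Qed.

Let mGY : measurable_fun setT GY.
Proof. exact: (measurable_fun_fubini_tonelli_G (m1 := leb) _ mF F0). Qed.

Let intGX : (\int[leb]_x GX x = \int[area]_p F p)%E.
Proof. exact/esym/(fubini_tonelli1 (m1 := leb) (m2 := leb) _ mF F0). Qed.

Let intGY : (\int[leb]_x GY x = \int[area]_p F p)%E.
Proof. exact/esym/(fubini_tonelli2 (m1 := leb) (m2 := leb) _ mF F0). Qed.

Let GX_in x : `|x - Re z| <= 1/2 ->
  GX x = (\int[leb]_(y in `[(Im z - 1/2)%R, (Im z + 1/2)%R]) (normc (f (x +i* y)))%:E)%E.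
Proof.
move=> xz; rewrite [RHS]integral_mkcond; apply: eq_integral => y _.
rewrite /F patchE indicE; case: ifPn => yz.
  rewrite mem_set ?mulr1//; split => /=; rewrite in_itv /= -ler_distl//.
  by move: yz; rewrite inE /= in_itv /= -ler_distl.
rewrite memNset ?mulr0//; case=> _ /= h; move: yz; rewrite notin_setE; exact.
Qed.

Let GY_in y : `|y - Im z| <= 1/2 ->
  GY y = (\int[leb]_(x in `[(Re z - 1/2)%R, (Re z + 1/2)%R]) (normc (f (x +i* y)))%:E)%E.
Proof.
move=> xz; rewrite [RHS]integral_mkcond; apply: eq_integral => x _.
rewrite /F patchE indicE; case: ifPn => yz.
  rewrite mem_set ?mulr1//; split => /=; rewrite in_itv /= -ler_distl//.
  by move: yz; rewrite inE /= in_itv /= -ler_distl.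
rewrite memNset ?mulr0//; case=> /= h _; move: yz; rewrite notin_setE; exact.
Qed.

Notation g := (fun w => f w * (w - z)^-1).

(** One side of the rectangle: 8 is the kernel bound 4 times the factor 2 of
[cint_ereal]. *)
Let side (h : R -> R[i]) (a b a' b' t : R) : a' <= a -> b <= b' ->
  (forall x, a <= x <= b -> 1/4 <= normc (h x - z)) ->
  measurable_fun `[a', b'] (fun x => normc (f (h x))) ->
  cintb a b (fun x => g (h x)) ->
  (\int[leb]_(x in `[a', b']) (normc (f (h x)))%:E <= t%:E)%E ->
  normc (cint a b (fun x => g (h x))) <= 8 * t.
Proof.
move=> aa bb hz mf ig It; rewrite -lee_fin.
have sub : `[a, b] `<=` (`[a', b'] : set R) by apply: subset_itv; rewrite bnd_simp.
have mf' : measurable_fun `[a, b] (fun x => normc (f (h x))).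
  by apply: measurable_funS mf.
apply: (@le_trans _ _ (2%:E * \int[leb]_(x in `[a, b]) (4 * normc (f (h x)))%:E)%E).
  apply: cint_ereal => //; first exact: measurable_funM.
  move=> x /hz hx; rewrite Normc.normcM mulrC; apply: ler_wpM2r; first exact: normc_ge0.
  rewrite Normc.normcV -[4]invrK lef_pV2 ?posrE ?invr_gt0//.
    by apply: le_trans hx; rewrite mul1r.
  by apply: lt_le_trans hx; rewrite divr_gt0.
under eq_integral do rewrite EFinM.
rewrite ge0_integralZl//; last 2 first.
  - exact/measurable_EFinP.
  - by move=> x _; rewrite lee_fin normc_ge0.
rewrite muleA -EFinM -natrM EFinM; apply: lee_wpmul2l => //.
apply: le_trans It; apply: ge0_subset_integral => //; first exact/measurable_EFinP.
by move=> x _; rewrite lee_fin normc_ge0.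
Qed.

(** By averaging, the four sides can be chosen at distance between 1/4 and
1/2 from z with the integral of |f| over each of them essentially at
most 4 times its integral over the square.  Cauchy's formula on that
rectangle, where the kernel is at most 4, gives the bound. *)
Theorem mean_value_L1 : ((normc (f z))%:E <= 32%:E * \int[area]_p F p)%E.
Proof.
have S0 : (0 <= \int[area]_p F p)%E by exact: integral_ge0.
case: (eqVneq (\int[area]_p F p)%E +oo%E) => [->|Sfin].
  by rewrite gt0_muley ?lte_fin// leey.
have [s sE] : exists s : R, (\int[area]_p F p = s%:E)%E.
  by exists (fine (\int[area]_p F p)%E); rewrite fineK// ge0_fin_numE// ltey.
rewrite sE -EFinM lee_fin.
apply/ler_addgt0Pr => e0 e00.
have [e ee ->] : exists2 e, 0 < e & e0 = 32 * e.
  by exists (e0 / 32); [rewrite divr_gt0|rewrite mulrC divfK].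
rewrite -mulrDr.
have pick (G : R -> \bar R) (a b : R) : b - a = 1/4 -> measurable_fun setT G ->
    (forall x, 0 <= G x)%E -> (\int[leb]_x G x = \int[area]_p F p)%E ->
    exists2 x, a <= x <= b & (G x <= (4 * (s + e))%:E)%E.
  move=> ba mG G0 GS; have [||||x xab Gx] := @average_pick a b s e G _ ee.
  - by rewrite -subr_gt0 ba divr_gt0.
  - exact: measurable_funS mG.
  - exact: G0.
  - rewrite -sE -GS; exact: ge0_subset_integral.
  - exists x => //; apply: (le_trans Gx); rewrite lee_fin ba.
    by rewrite mul1r invrK mulrC.
have [|a /andP[a1 a2] Ga] := pick GX (Re z - 1/2) (Re z - 1/4) _ mGX GX0 intGX; first lra.
have [|b /andP[b1 b2] Gb] := pick GX (Re z + 1/4) (Re z + 1/2) _ mGX GX0 intGX; first lra.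
have [|c /andP[c1 c2] Gc] := pick GY (Im z - 1/2) (Im z - 1/4) _ mGY GY0 intGY; first lra.
have [|d /andP[d1 d2] Gd] := pick GY (Im z + 1/4) (Im z + 1/2) _ mGY GY0 intGY; first lra.
rewrite GX_in in Ga; last by rewrite ler_norml; apply/andP; split; lra.
rewrite GX_in in Gb; last by rewrite ler_norml; apply/andP; split; lra.
rewrite GY_in in Gc; last by rewrite ler_norml; apply/andP; split; lra.
rewrite GY_in in Gd; last by rewrite ler_norml; apply/andP; split; lra.
have za : a < Re z < b by apply/andP; split; lra.
have zc : c < Im z < d by apply/andP; split; lra.
have dist x y : a <= x <= b -> c <= y <= d -> [|| x == a, x == b, y == c | y == d] ->
    1/4 <= normc ((x +i* y) - z).
  by move=> _ _ xy; apply: (frame_dist xy); apply/andP; split; lra.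
have := frame_cintb _ _ (@frame_kernel _ 1 f z a b c d df za zc).
case; [lra|lra|move=> i1 i2 i3 i4].
have mh (k l y : R) : measurable_fun `[k, l] (fun x => normc (f (x +i* y))).
  apply: subspace_continuous_measurable_fun => //.
  by apply: lipschitz_hline; [exact: normc_lipschitz|move=> x _; exact: cdiff_ccont].
have mv (k l x : R) : measurable_fun `[k, l] (fun y => normc (f (x +i* y))).
  apply: subspace_continuous_measurable_fun => //.
  by apply: lipschitz_vline; [exact: normc_lipschitz|move=> y _; exact: cdiff_ccont].
have s1 := @side (fun x => x +i* c) a b _ _ _ a1 b2 (fun x h => dist x c h _ _) (mh _ _ _) i1 Gc.
have s2 := @side (fun x => x +i* d) a b _ _ _ a1 b2 (fun x h => dist x d h _ _) (mh _ _ _) i2 Gd.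
have s3 := @side (fun x => b +i* x) c d _ _ _ c1 d2 (fun x h => dist b x _ h _) (mv _ _ _) i3 Gb.
have s4 := @side (fun x => a +i* x) c d _ _ _ c1 d2 (fun x h => dist a x _ h _) (mv _ _ _) i4 Ga.
have ab : a <= b by case/andP: za => az zb; exact: ltW (lt_trans az zb).
have cd : c <= d by case/andP: zc => cz zd; exact: ltW (lt_trans cz zd).
have n1 : normc ('i : R[i]) = 1 by rewrite /= expr0n expr1n add0r sqrtr1.
have T (u v : R[i]) : normc (u - v) <= normc u + normc v.
  by rewrite -[normc v]normcN le_normcD.
have pi2 := pi_ge2 R; have fz := normc_ge0 (f z).
have E := congr1 (@normc R) (cauchy_formula df za zc).
rewrite Normc.normcM normc_tpi in E.
have : normc (contour (fun w => f w * (w - z)^-1) a b c d) <= 128 * (s + e).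
  apply: (le_trans (le_normcD _ _)); rewrite Normc.normcM n1 mul1r.
  apply: (le_trans (lerD (T _ _) (T _ _))).
  have -> : 128 * (s + e) = 8 * (4 * (s + e)) + 8 * (4 * (s + e)) +
    (8 * (4 * (s + e)) + 8 * (4 * (s + e))) by ring.
  apply: lerD; apply: lerD; [apply: s1|apply: s2|apply: s3|apply: s4] => *;
    by rewrite ?lexx ?ab ?cd ?eqxx ?orbT.
rewrite E => h.
have : 2 * 2 * normc (f z) <= 128 * (s + e).
  by apply: le_trans h; rewrite ler_wpM2r// ler_wpM2l.
move=> h4; rewrite -(@ler_pM2l _ (2 * 2)) ?mulr_gt0//; apply: (le_trans h4).
by rewrite le_eqVlt; apply/orP; left; apply/eqP; ring.
Qed.

End mean_value.

End plane.

(** * The complex exponential *)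

Section complex_exponential.
Context (R : realType).
Implicit Types (f : R[i] -> R[i]) (z w : R[i]).

Definition cexp z : R[i] :=
  (expR (Re z) * cos (Im z)) +i* (expR (Re z) * sin (Im z)).

Lemma cexpD z w : cexp (z + w) = cexp z * cexp w.
Proof.
by apply: complex_eqP; rewrite !ReImE /= ?ReD ?ImD expRD ?cosD ?sinD; ring.
Qed.

Lemma cexp0 : cexp 0 = 1.
Proof. by apply: complex_eqP; rewrite /= expR0 ?cos0 ?sin0 ?mulr1 ?mulr0. Qed.

Lemma normc_cexp z : normc (cexp z) = expR (Re z).
Proof.
rewrite /= !exprMn -mulrDr cos2Dsin2 mulr1 sqrtr_sqr ger0_norm// expR_ge0.
Qed.

(** The first order expansion with an explicit radius, the form in which
the real derivatives of exp, cos and sin enter the complex one. *)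
Lemma is_derive_eps (h : R -> R) (x d : R) : is_derive x 1 h d ->
  forall e : R, 0 < e -> exists2 r : R, 0 < r &
    forall t, `|t| <= r -> `|h (x + t) - h x - d * t| <= e * `|t|.
Proof.
move=> [dh dE] e e0.
have : (fun t => t^-1 *: (h (t + x) - h x)) @ 0^' --> d.
  rewrite -dE; move: dh; rewrite /derivable /derive.
  by under eq_fun do rewrite scaler1.
move=> /cvgrPdist_le /(_ e e0) /nbhs_ballP[r /= r0 H].
exists (r / 2); first by rewrite divr_gt0.
move=> t tr; have [->|t0] := eqVneq t 0.
  by rewrite addr0 subrr mulr0 subrr normr0 mulr0.
have := H t; rewrite /ball /= sub0r normrN => H'.
have tp : 0 < `|t| by rewrite normr_gt0.
rewrite -ler_pdivrMr// -normfV -normrM.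
rewrite (_ : _ * t^-1 = - (d - t^-1 *: (h (t + x) - h x))); last first.
  by rewrite /GRing.scale /= [t + x]addrC; field.
rewrite normrN; apply: H' => //.
by rewrite (le_lt_trans tr)// ltr_pdivrMr// ltr_pMr// ltr1n.
Qed.

(** Expansion of the real factors exp, cos and sin; at other points the
derivative follows from the functional equation. *)
Lemma is_cderiv_cexp0 : is_cderiv cexp 0 1.
Proof.
move=> e e0; pose k := Num.min (e / 8) 1.
have k0 : 0 < k by rewrite lt_min divr_gt0/=.
have ke : 8 * k <= e by rewrite mulrC -ler_pdivlMr// ge_min lexx.
have k1 : k <= 1 by rewrite ge_min lexx orbT.
have [r1 r10 H1] := is_derive_eps (is_derive_expR 0) k0.
have [r2 r20 H2] := is_derive_eps (is_derive_cos 0) k0.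
have [r3 r30 H3] := is_derive_eps (is_derive_sin 0) k0.
exists (Num.min (Num.min r1 r2) (Num.min r3 (k / 2))).
  by rewrite !lt_min r10 r20 r30 divr_gt0.
move=> w; rewrite !le_min subr0 => /andP[/andP[w1 w2] /andP[w3 w4]].
rewrite cexp0 mul1r; case: w w1 w2 w3 w4 => a b w1 w2 w3 w4.
have an := Re_le_normc (a +i* b); have bn := Im_le_normc (a +i* b).
set N := normc (a +i* b) in an bn w1 w2 w3 w4 *.
have := H1 a (le_trans an w1); have := H2 b (le_trans bn w2); have := H3 b (le_trans bn w3).
rewrite !add0r expR0 cos0 sin0 oppr0 mul0r !subr0 !mul1r ?addr0 => h3 h2 h1.
apply: (le_trans (normc_le_ReIm _)); rewrite !ReImE /=.
set E := expR a in h1 *; set C := cos b in h2 *; set S := sin b in h3 *.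
have N0 : 0 <= N by exact: normc_ge0.
have E1 : `|E - 1| <= k.
  have -> : E - 1 = (E - 1 - a) + a by ring.
  apply: (le_trans (ler_normD _ _)).
  have : k * `|a| <= 1 * `|a| by rewrite ler_wpM2r.
  by lra.
have E2 : `|E| <= 2.
  have -> : E = (E - 1) + 1 by ring.
  by apply: (le_trans (ler_normD _ _)); rewrite normr1; lra.
have kb : k * `|b| <= k * N by rewrite ler_wpM2l// ltW.
have ka : k * `|a| <= k * N by rewrite ler_wpM2l// ltW.
apply: (@le_trans _ _ (8 * k * N)); last by rewrite ler_wpM2r.
have -> : E * C - 1 - a = E * (C - 1) + (E - 1 - a) by ring.
have -> : E * S - 0 - b = E * (S - b) + (E - 1) * b by ring.
have q1 : `|E * (C - 1)| <= 2 * (k * N).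
  by rewrite normrM; apply: ler_pM => //; exact: le_trans h2 kb.
have q2 : `|E * (S - b)| <= 2 * (k * N).
  by rewrite normrM; apply: ler_pM => //; exact: le_trans h3 kb.
have q3 : `|(E - 1) * b| <= k * N by rewrite normrM; apply: ler_pM.
have := ler_normD (E * (C - 1)) (E - 1 - a).
have := ler_normD (E * (S - b)) ((E - 1) * b).
by have kN : 0 <= k * N by [rewrite mulr_ge0// ltW]; lra.
Qed.

Lemma is_cderiv_affine f A B z k : is_cderiv f (A + B * z) k ->
  is_cderiv (fun w => f (A + B * w)) z (B * k).
Proof.
move=> fk e e0; have B0 : 0 < normc B + 1 by rewrite ltr_wpDl ?normc_ge0.
have [|r r0 Hr] := fk (e / (normc B + 1)); first by rewrite divr_gt0.
exists (r / (normc B + 1)); first by rewrite divr_gt0.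
move=> w wr; have E : A + B * w - (A + B * z) = B * (w - z) by ring.
have nE : normc (B * (w - z)) <= (normc B + 1) * normc (w - z).
  by rewrite Normc.normcM ler_wpM2r ?normc_ge0// lerDl.
have := Hr (A + B * w); rewrite E => H.
have -> : B * k * (w - z) = k * (B * (w - z)) by ring.
apply: le_trans (H _) _.
  by apply: (le_trans nE); rewrite mulrC -ler_pdivlMr.
apply: (@le_trans _ _ (e / (normc B + 1) * ((normc B + 1) * normc (w - z)))).
  by apply: ler_wpM2l => //; rewrite divr_ge0// ltW.
by rewrite mulrA divfK// gt_eqF.
Qed.

Lemma is_cderiv_cexp z : is_cderiv cexp z (cexp z).
Proof.
have E w : cexp w = cexp z * cexp (- z + 1 * w).
  by rewrite -cexpD mul1r addNKr.
have -> : cexp = (fun w => cexp z * cexp (- z + 1 * w)) by apply/funext.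
suff : is_cderiv (fun w => cexp z * cexp (- z + 1 * w)) z (cexp z * (1 * 1)).
  by rewrite !mulr1 mul1r addNr cexp0 mulr1.
apply/is_cderivZ/is_cderiv_affine.
by rewrite mul1r addNr; exact: is_cderiv_cexp0.
Qed.

Lemma is_cderiv_cexp_affine A B z :
  is_cderiv (fun w => cexp (A + B * w)) z (B * cexp (A + B * z)).
Proof. exact/is_cderiv_affine/is_cderiv_cexp. Qed.

Lemma cderiv_cexp_affine n A B :
  cderiv n (fun w => cexp (A + B * w)) = (fun w => B ^+ n * cexp (A + B * w)).
Proof.
elim: n => [|n IH]; first by apply/funext => w; rewrite expr0 mul1r.
apply/funext => w; rewrite /cderiv derive1nS -/(cderiv n _) IH.
suff /is_cderivP[_ ->] : is_cderiv (fun w => B ^+ n * cexp (A + B * w)) w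
    (B ^+ n * (B * cexp (A + B * w))) by rewrite exprSr mulrA.
exact/is_cderivZ/is_cderiv_cexp_affine.
Qed.

Lemma cdiffM f g : cdiff f -> cdiff g -> cdiff (fun w => f w * g w).
Proof.
by move=> df dg w; apply/derivable_cderiv; apply: derivableM; apply/derivable_cderiv.
Qed.

Lemma sqmodE z : sqmod z = Re z ^+ 2 + Im z ^+ 2.
Proof. exact: sqr_normc. Qed.

Lemma sqmod_ge0 z : 0 <= sqmod z.
Proof. exact: sqr_ge0. Qed.

Lemma sqmodM z w : sqmod (z * w) = sqmod z * sqmod w.
Proof. by rewrite /sqmod Normc.normcM exprMn. Qed.

Lemma sqmod_cexp z : sqmod (cexp z) = expR (2 * Re z).
Proof. by rewrite /sqmod normc_cexp expr2 -expRD; congr expR; ring. Qed.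

End complex_exponential.

(** * Pointwise bounds for derivatives in Gaussian weight *)

Section local_estimate.
Context (R : realType).
Implicit Types (f : R[i] -> R[i]) (z w : R[i]).
Notation leb := (@lebesgue_measure R).
Notation area := (leb \x leb)%E.

Lemma measurable_sqmod f : (forall z, ccont_at f z) ->
  measurable_fun setT (fun p : R * R => sqmod (f (z_of p))).
Proof.
move=> cf; apply: measurable_funX; apply: measurable_normc_z => //.
exact: normc_lipschitz.
Qed.

Lemma measurable_gauss : measurable_fun setT (@gauss R).
Proof.
apply: measurableT_comp; first exact: measurable_expR.
apply: measurable_funN; apply: (@measurable_sqmod id) => z e e0.
by exists e.
Qed.

Lemma indic_ge0 (A : set (R * R)) p : 0 <= \1_A p :> R.
Proof. by rewrite indicE ler0n. Qed.

Lemma mass_ge0 z (A : set (R * R)) p q : 0 <= sqmod z * gauss p * \1_A q.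
Proof.
by apply: mulr_ge0; [apply: mulr_ge0; [exact: sqmod_ge0|exact: expR_ge0]|exact: indic_ge0].
Qed.

Definition local_mass f z (r : R) : \bar R :=
  (\int[area]_p (sqmod (f (z_of p)) * gauss p * \1_(square z r) p)%:E)%E.

Lemma local_mass_ge0 f z r : (0 <= local_mass f z r)%E.
Proof.
by apply: integral_ge0 => p _; rewrite lee_fin mass_ge0.
Qed.

(** Completing the square: twisting by e^{-conj z (w - z)} exchanges the
Gaussian at w for the one at z, up to e^{|w - z|^2}. *)
Lemma twist_exponent z w : 2 * Re (- z^* * (w - z)) =
  sqmod (w - z) - sqmod w + sqmod z.
Proof. by rewrite !sqmodE; case: z => a b; case: w => c d /=; ring. Qed.

(** The mean value inequality for the square of the twisted function
v |-> f v e^{-conj z (v - z)}, an entire function.  Taking the square is what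
produces an L^2 norm out of the L^1 inequality. *)
Lemma twisted_mean_value f z v : cdiff f -> `|Re (v - z)| <= 1/4 -> `|Im (v - z)| <= 1/4 ->
  ((sqmod (f v) * expR (2 * Re (- z^* * (v - z))))%:E <=
    (32 * expR 2 * expR (sqmod z))%:E * local_mass f z (3/4))%E.
Proof.
move=> df v1 v2.
pose H w := (f w * cexp (z^* * z + - z^* * w)) * (f w * cexp (z^* * z + - z^* * w)).
have dH : cdiff H.
  have dc : cdiff (fun w => cexp (z^* * z + - z^* * w)).
    by move=> w; eexists; exact: is_cderiv_cexp_affine.
  by apply: cdiffM; exact: cdiffM.
have nH w : normc (H w) = sqmod (f w) * expR (2 * Re (- z^* * (w - z))).
  rewrite /H Normc.normcM -expr2 -/(sqmod _) sqmodM sqmod_cexp; congr (_ * expR (2 * Re _)).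
  by ring.
rewrite -nH; apply: (le_trans (mean_value_L1 v dH)).
have c0 : 0 <= 32 * expR 2 * expR (sqmod z) by rewrite !mulr_ge0 ?expR_ge0.
have ms : measurable_fun setT (fun p : R * R => sqmod (f (z_of p)) * gauss p * \1_(square z (3/4)) p).
  apply: measurable_funM; last by apply: measurable_indic; exact: measurable_square.
  apply: measurable_funM; last exact: measurable_gauss.
  by apply: measurable_sqmod => ?; exact: cdiff_ccont.
have mH : measurable_fun setT (fun p : R * R => normc (H (z_of p)) * \1_(square v (1/2)) p).
  apply: measurable_funM; last by apply: measurable_indic; exact: measurable_square.
  by apply: measurable_normc_z; [exact: normc_lipschitz|move=> ?; exact: cdiff_ccont].
rewrite /local_mass -ge0_integralZl_EFin//; last 2 first.
  by move=> p _; rewrite lee_fin mulr_ge0 ?normc_ge0 ?indic_ge0.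
  exact/measurable_EFinP.
rewrite -ge0_integralZl_EFin//; last 2 first.
  by move=> p _; rewrite lee_fin mass_ge0.
  exact/measurable_EFinP.
apply: ge0_le_integral => //.
- by move=> p _; rewrite -EFinM lee_fin mulr_ge0// mulr_ge0 ?normc_ge0 ?indic_ge0.
- by apply/measurable_EFinP; apply: measurable_funM.
- by apply/measurable_EFinP; apply: measurable_funM.
move=> p _; rewrite -!EFinM lee_fin -(mulrA 32) -(mulrA 32) ler_wpM2l// nH.
have [pv|pv] := pselect (square v (1/2) p); last first.
  rewrite [\1_(square v _) p]indicE memNset// mulr0.
  by apply: mulr_ge0; [rewrite mulr_ge0 ?expR_ge0|exact: mass_ge0].
have /squareP[p1 p2] := pv.
have pz : square z (3/4) p.
  by apply/squareP; move: p1 p2 v1 v2; rewrite !ReImE !ler_norml => /andP[? ?] /andP[? ?]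
    /andP[? ?] /andP[? ?]; split; apply/andP; split; lra.
rewrite !indicE !mem_set// !mulr1 twist_exponent !expRD /gauss.
rewrite [leLHS](_ : _ = expR (sqmod (z_of p - z)) * (expR (sqmod z) * (sqmod (f (z_of p)) * expR (- sqmod (z_of p))))); last by ring.
rewrite -expRD -(mulrA (expR (1 + 1))).
apply: ler_wpM2r; first by rewrite mulr_ge0 ?expR_ge0// mulr_ge0 ?sqmod_ge0 ?expR_ge0.
rewrite ler_expR sqmodE !ReImE /=.
have /squareP[q1 q2] := pz.
have s1 : (p.1 - Re z) ^+ 2 <= 1.
  by rewrite -real_normK ?num_real// -[1](expr1n _ 2) lerXn2r ?nnegrE//; lra.
have s2 : (p.2 - Im z) ^+ 2 <= 1.
  by rewrite -real_normK ?num_real// -[1](expr1n _ 2) lerXn2r ?nnegrE//; lra.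
by rewrite lerD.
Qed.

Definition local_const (n : nat) : R := (16 * n.+1%:R) ^+ n ^+ 2 * (32 * expR 3).

Lemma local_const_gt0 n : 0 < local_const n.
Proof. by rewrite /local_const !mulr_gt0 ?expR_gt0// !exprn_gt0// mulr_gt0. Qed.

(** On a square of half side n r with n r w(z) <= 1/4 the twist is bounded
below, so [twisted_mean_value] bounds f itself there and Cauchy's estimates at
radius r lose (1 / r)^(2n), of order w(z)^(2n). *)
Theorem local_estimate n f z : cdiff f ->
  ((sqmod (cderiv n f z) * expR (- sqmod z))%:E <=
   (local_const n * (1 + sqmod z) ^+ n)%:E * local_mass f z (3/4))%E.
Proof.
move=> df; have w0 : 0 < 1 + sqmod z by rewrite ltr_pwDl ?sqmod_ge0.
have [->|mfin] := eqVneq (local_mass f z (3/4)) +oo%E.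
  by rewrite gt0_muley ?leey// lte_fin mulr_gt0 ?local_const_gt0 ?exprn_gt0.
have := local_mass_ge0 f z (3/4).
have [s sE] : exists s : R, local_mass f z (3/4) = s%:E.
  by exists (fine (local_mass f z (3/4))); rewrite fineK// ge0_fin_numE ?local_mass_ge0// ltey.
have tm := twisted_mean_value df; rewrite sE lee_fin => s0; rewrite -EFinM lee_fin.
pose om := Num.sqrt (1 + sqmod z).
have om1 : 1 <= om by rewrite -[1]sqrtr1 ler_sqrt ?(ltW w0)// lerDl sqmod_ge0.
have om0 : 0 < om by exact: lt_le_trans om1.
have om2 : om ^+ 2 = 1 + sqmod z by rewrite sqr_sqrtr// ltW.
(* at this radius the squared modulus of the twist is at least e^-1 on the
   square of half side n * r *)
pose r := (4 * n.+1%:R * om)^-1.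
have r0 : 0 < r by rewrite invr_gt0 !mulr_gt0.
have nr : n%:R * r * om <= 1/4.
  have -> : n%:R * r * om = n%:R / n.+1%:R / 4.
    have n0 : n.+1%:R != 0 :> R by rewrite pnatr_eq0.
    by rewrite /r; move: (n.+1%:R) n0 => m n0; field; rewrite n0 gt_eqF.
  by rewrite mul1r ler_piMl// ler_pdivrMr// mul1r ler_nat.
have nr' : n%:R * r <= 1/4.
  by apply: le_trans nr; rewrite ler_peMr// mulr_ge0// ltW.
have zom : normc z <= om.
  by rewrite -[normc z]ger0_norm ?normc_ge0// -sqrtr_sqr ler_sqrt ?(ltW w0)// -/(sqmod z) lerDr.
pose M := Num.sqrt (32 * expR 3 * expR (sqmod z) * s).
have M2 : M ^+ 2 = 32 * expR 3 * expR (sqmod z) * s.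
  by rewrite sqr_sqrtr// !mulr_ge0 ?expR_ge0.
have fM v : `|Re (v - z)| <= n%:R * r -> `|Im (v - z)| <= n%:R * r -> normc (f v) <= M.
  move=> v1 v2; rewrite -[normc _]ger0_norm ?normc_ge0// -sqrtr_sqr ler_sqrt; last first.
    by rewrite !mulr_ge0 ?expR_ge0.
  have := tm z v (le_trans v1 nr') (le_trans v2 nr'); rewrite sE -EFinM lee_fin.
  rewrite -/(sqmod (f v)) => h.
  have e1 : expR (-1) <= expR (2 * Re (- z^* * (v - z))).
    rewrite ler_expR -[_ * Re _]opprK lerN2; apply: (le_trans (ler_norm _)).
    rewrite normrN normrM normr_nat.
    have : `|Re (- z^* * (v - z))| <= om * (2 * (n%:R * r)).
      apply: (le_trans (Re_le_normc _)); rewrite Normc.normcM normcN normc_conj.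
      apply: ler_pM; rewrite ?normc_ge0//.
      by apply: (le_trans (normc_le_ReIm _)); lra.
    by move=> h1; move: nr; rewrite [_ * om]mulrC; lra.
  have : sqmod (f v) * expR (-1) <= 32 * expR 2 * expR (sqmod z) * s.
    by apply: le_trans h; rewrite ler_wpM2l ?sqmod_ge0.
  move=> /(ler_wpM2r (ltW (expR_gt0 1))); rewrite -[_ * expR (-1) * _]mulrA -expRD addNr.
  rewrite expR0 mulr1 => h2.
  have e3 : expR 3 = expR 2 * expR 1 :> R by rewrite -expRD; congr expR; ring.
  apply: (le_trans h2); rewrite e3.
  by rewrite le_eqVlt; apply/orP; left; apply/eqP; ring.
have := cauchy_estimates df r0 fM.
rewrite /local_const => h; rewrite /sqmod.
have {}h : normc (cderiv n f z) ^+ 2 <= ((4 / r) ^+ n * M) ^+ 2.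
  by rewrite lerXn2r ?nnegrE ?normc_ge0// mulr_ge0 ?sqrtr_ge0// exprn_ge0// divr_ge0// ltW.
have e0 := expR_gt0 (- sqmod z).
rewrite -/(sqmod z).
apply: (le_trans (ler_wpM2r (ltW e0) h)).
rewrite exprMn M2 /r invrK -om2 expRN.
have ez := expR_gt0 (sqmod z).
rewrite le_eqVlt; apply/orP; left; apply/eqP.
have -> : 4 * (4 * n.+1%:R * om) = (16 * n.+1%:R) * om by ring.
rewrite [(_ * om) ^+ n]exprMn [(_ ^+ n * om ^+ n) ^+ 2]exprMn -[om ^+ n ^+ 2]exprM mulnC exprM.
by field; rewrite gt_eqF.
Qed.

End local_estimate.

(** * Coherent states *)

Section coherent_states.
Context (R : realType).
Implicit Types (f : R[i] -> R[i]) (z w : R[i]) (p q : R * R).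
Notation leb := (@lebesgue_measure R).
Notation area := (leb \x leb)%E.

(** The reproducing kernel at w divided by its norm. *)
Definition coherent w z : R[i] := cexp ((- sqmod w / 2)%:C + w^* * z).

Lemma coherent_mass w p : sqmod (coherent w (z_of p)) * gauss p = expR (- sqmod (z_of p - w)).
Proof.
rewrite sqmod_cexp /gauss -expRD; congr expR; rewrite !sqmodE.
by case: w => a b; case: p => x y /=; field.
Qed.

Lemma cdiff_coherent w : cdiff (coherent w).
Proof. by move=> z; eexists; exact: is_cderiv_cexp_affine. Qed.

Lemma entireP f : entire f <-> cdiff f.
Proof. by split=> df z; [apply/derivable_cderiv; exact: df|exact/derivable_cderiv]. Qed.

Lemma gauss_normal_pdf (m x : R) :
  normal_pdf m (Num.sqrt 2)^-1 x = (Num.sqrt pi)^-1 * expR (- (x - m) ^+ 2).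
Proof.
have s0 : (Num.sqrt 2)^-1 != 0 :> R by rewrite invr_eq0 sqrtr_eq0 -ltNge.
rewrite normal_pdfE// /normal_peak /normal_fun exprVn sqr_sqrtr//.
congr ((Num.sqrt _)^-1 * expR _); first by rewrite -mulrnAl; field.
by field.
Qed.

(** The Gaussian mass density of the coherent state at w is a product of
two normal densities centred at w. *)
Lemma coherent_sqnorm w : fock_sqnorm (coherent w) = 1%E.
Proof.
pose g (m x : R) := normal_pdf m (Num.sqrt 2)^-1 x.
have mg m : measurable_fun setT (g m) by exact: measurable_normal_pdf.
have mgE m : measurable_fun setT (fun x => (g m x)%:E) by apply/measurable_EFinP; exact: mg.
have g0 m x : 0 <= g m x by exact: normal_pdf_ge0.
rewrite /fock_sqnorm.
under eq_integral => p _.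
  rewrite (_ : _ * _ = g (Re w) p.1 * g (Im w) p.2); last first.
    rewrite mulrCA coherent_mass /g !gauss_normal_pdf sqmodE !ReImE /=.
    rewrite opprD expRD mulrACA -invfM -expr2 sqr_sqrtr ?pi_ge0//.
  over.
have mG : measurable_fun setT (fun p : R * R => (g (Re w) p.1 * g (Im w) p.2)%:E).
  apply/measurable_EFinP; apply: measurable_funM.
    by apply: measurableT_comp; [exact: mg|exact: measurable_fst].
  by apply: measurableT_comp; [exact: mg|exact: measurable_snd].
rewrite (fubini_tonelli1 (m1 := leb) (m2 := leb) _ mG); last first.
  by move=> p; rewrite lee_fin mulr_ge0.
rewrite /fubini_F /=.
rewrite -[RHS](integral_normal_pdf (Re w) (Num.sqrt 2)^-1).
apply: eq_integral => x _; under eq_integral do rewrite EFinM.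
rewrite ge0_integralZl_EFin//.
- by rewrite integral_normal_pdf mule1.
- by move=> y _; rewrite lee_fin.
- exact: mgE.
Qed.

Lemma fock_coherent w : fock (coherent w).
Proof. by split; [exact/entireP/cdiff_coherent|rewrite coherent_sqnorm ltry]. Qed.

End coherent_states.

(** * Growth of the variation and weighted Carleson bounds *)

Section ball_bound.
Context (R : realType) (mu : complex_measure R).
Implicit Types (f : R[i] -> R[i]) (z w : R[i]) (p q : R * R).
Notation leb := (@lebesgue_measure R).
Notation area := (leb \x leb)%E.
Notation tv := (Defs.variation mu).

Lemma measurable_disk p (r : R) : measurable (disk p r).
Proof.
apply: measurable_box_open => q qp; have {}qp : normc (z_of q - z_of p) < r by [].
exists ((r - normc (z_of q - z_of p)) / 2); first by rewrite divr_gt0// subr_gt0.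
move=> t t1 t2; suff : normc (z_of t - z_of p) < r by [].
have -> : z_of t - z_of p = (z_of t - z_of q) + (z_of q - z_of p) by ring.
apply: (le_lt_trans (le_normcD _ _)); rewrite -ltrBrDr.
apply: (le_lt_trans (normc_le_ReIm _)); rewrite !ReImE /= [ltRHS]splitr.
exact: ltrD.
Qed.

(** The k-th derivative of the coherent state is the state itself times
(conj w)^k. *)
Lemma fc_bound_coherent k c w : fc_bound mu k c ->
  ((sqmod w ^+ k)%:E * \int[tv]_p (expR (- sqmod (z_of p - w)))%:E <= c%:E)%E.
Proof.
move=> /(_ _ (fock_coherent w)); rewrite coherent_sqnorm mule1; apply: le_trans.
have m1 : measurable_fun setT (fun p : R * R => expR (- sqmod (z_of p - w))).
  apply: measurableT_comp; first exact: measurable_expR.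
  apply: measurable_funN; apply: (@measurable_sqmod _ (fun z => z - w)) => z e e0.
  by exists e => // v; rewrite opprB addrA subrK.
rewrite -ge0_integralZl_EFin//; last 2 first.
- exact/measurable_EFinP.
- by rewrite exprn_ge0 ?sqmod_ge0.
rewrite le_eqVlt; apply/orP; left; apply/eqP; apply: eq_integral => p _.
rewrite -EFinM; congr EFin.
rewrite /coherent cderiv_cexp_affine sqmodM -mulrA -/(coherent w _) coherent_mass.
congr (_ * _).
by rewrite /sqmod normcX normc_conj -!exprM mulnC.
Qed.

Definition weight p : R := Num.sqrt (1 + sqmod (z_of p)).

Lemma weight_sqr p : weight p ^+ 2 = 1 + sqmod (z_of p).
Proof. by rewrite sqr_sqrtr// addr_ge0 ?sqmod_ge0. Qed.

Lemma weight_ge1 p : 1 <= weight p.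
Proof. by rewrite -[1]sqrtr1 ler_sqrt ?addr_ge0 ?sqmod_ge0// lerDl sqmod_ge0. Qed.

Lemma weight_gt0 p : 0 < weight p.
Proof. exact: lt_le_trans (weight_ge1 p). Qed.

Lemma sqrt2_le2 : Num.sqrt 2 <= 2 :> R.
Proof. by have := sqr_sqrtr (ler0n R 2); have := sqrtr_ge0 (2 : R); nra. Qed.

(** The coherent state is taken at a point w one unit away from p,
on the side where |w|^2 >= 1 + |p|^2, so that |w|^(2k) dominates the weight also
near the origin.  Points of the disk are at distance at most sqrt 2 + 1 <= 3 from w,
whence the factor e^9. *)
Lemma fc_bound_ball k c p : fc_bound mu k c ->
  (tv (disk p (Num.sqrt 2)) * (weight p ^+ k.*2)%:E <= (c * expR 9)%:E)%E.
Proof.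
move=> fc.
(* moving the abscissa away from 0 increases |p|^2 by at least 1 *)
pose s : R := if 0 <= p.1 then 1 else -1.
pose w := (p.1 + s) +i* p.2.
have sw : 1 + sqmod (z_of p) <= sqmod w.
  rewrite !sqmodE /= /s; case: ifPn => [p0|]; first by nra.
  by rewrite -ltNge => p0; nra.
have c0 : (0 <= c%:E)%E.
  apply: le_trans (fc_bound_coherent w fc); apply: mule_ge0.
    by rewrite lee_fin; apply: exprn_ge0; exact: sqmod_ge0.
  by apply: integral_ge0 => q _; rewrite lee_fin expR_ge0.
rewrite lee_fin in c0.
have mexp : measurable_fun setT (fun q : R * R => (expR (- sqmod (z_of q - w)))%:E).
  apply/measurable_EFinP; apply: measurableT_comp; first exact: measurable_expR.
  apply: measurable_funN; apply: (@measurable_sqmod _ (fun z => z - w)) => z e e0.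
  by exists e => // v; rewrite opprB addrA subrK.
have low : ((expR (- 9))%:E * tv (disk p (Num.sqrt 2)) <= \int[tv]_q (expR (- sqmod (z_of q - w)))%:E)%E.
  rewrite -integral_cst; last exact: measurable_disk.
  apply: (@le_trans _ _ (\int[tv]_(q in disk p (Num.sqrt 2)) (expR (- sqmod (z_of q - w)))%:E)%E).
    apply: ge0_le_integral => //.
    - exact: measurable_disk.
    - by move=> q _; rewrite lee_fin expR_ge0.
    - exact: measurable_funS mexp.
    move=> q pq; rewrite lee_fin ler_expR lerN2.
    have {}pq : normc (z_of q - z_of p) < Num.sqrt 2 by [].
    have qw : normc (z_of q - w) <= 3.
      have -> : z_of q - w = (z_of q - z_of p) + (- s)%:C.
        by apply: complex_eqP; rewrite !ReImE /=; ring.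
      apply: (le_trans (le_normcD _ _)); rewrite normc_real normrN.
      have -> : `|s| = 1 by rewrite /s; case: ifP; rewrite ?normrN1 ?normr1.
      by have := sqrt2_le2; lra.
    rewrite /sqmod (_ : 9 = 3 ^+ 2); last by ring.
    by apply: lerXn2r; rewrite ?nnegrE ?normc_ge0.
  by apply: ge0_subset_integral => //; exact: measurable_disk.
have := fc_bound_coherent w fc.
set T := (\int[tv]_q _)%E in low *; set D := tv _ in low *.
have D0 : (0 <= D)%E by exact: measure_ge0.
move=> h.
apply: (@le_trans _ _ ((sqmod w ^+ k)%:E * (D * (expR (- 9))%:E) * (expR 9)%:E)%E).
  rewrite -muleA -[(D * _ * _)%E]muleA -EFinM -expRD addNr expR0 mule1 muleC.
  apply: lee_wpmul2r => //; rewrite lee_fin -mul2n exprM weight_sqr.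
  by apply: lerXn2r; rewrite ?nnegrE ?addr_ge0 ?sqmod_ge0.
rewrite EFinM; apply: lee_wpmul2r; first by rewrite lee_fin expR_ge0.
apply: le_trans h; apply: lee_wpmul2l; last by rewrite muleC.
by rewrite lee_fin; apply: exprn_ge0; exact: sqmod_ge0.
Qed.

(** Here n is twice the order, so that integer and half-integer orders are
treated alike. *)
Definition ball_bounded (n : nat) (M : R) := forall p,
  (tv (disk p (Num.sqrt 2)) * (weight p ^+ n)%:E <= M%:E)%E.

Lemma fc_measure_ball k2 : fc_measure mu k2 -> exists2 M : R, 0 <= M & ball_bounded k2 M.
Proof.
have nn M n : ball_bounded n M -> 0 <= M.
  move=> H; rewrite -lee_fin; apply: le_trans (H (0, 0)).
  by apply: mule_ge0; rewrite ?measure_ge0// lee_fin exprn_ge0// ltW// weight_gt0.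
suff H : fc_measure mu k2 -> exists M, ball_bounded k2 M.
  by move=> /H[M HM]; exists M => //; exact: nn HM.
rewrite /fc_measure; case: ifPn => [_ fs|ev [c fc]]; last first.
  exists (c * expR 9) => p; rewrite -[k2 in weight p ^+ k2]odd_double_half (negbTE ev) add0n.
  exact: fc_bound_ball.
have w2 p : (1 + sqmod (z_of p)) `^ (k2%:R / 2) = weight p ^+ k2.
  by rewrite mulrC powRrM powR12_sqrt ?addr_ge0 ?sqmod_ge0// powR_mulrn ?sqrtr_ge0.
have up p : (tv (disk p (Num.sqrt 2)) * (weight p ^+ k2)%:E <= fc_sup mu (k2%:R / 2))%E.
  by apply: ereal_sup_ubound; exists p => //; rewrite w2.
have fs0 : (0 <= fc_sup mu (k2%:R / 2))%E.
  apply: le_trans (up (0, 0)); apply: mule_ge0; first exact: measure_ge0.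
  by rewrite lee_fin exprn_ge0// ltW// weight_gt0.
exists (fine (fc_sup mu (k2%:R / 2))) => p; rewrite fineK//.
by rewrite ge0_fin_numE.
Qed.

Lemma ball_bounded_fin n M p : ball_bounded n M -> (tv (disk p (Num.sqrt 2)) < +oo)%E.
Proof.
move=> /(_ p) H; have w1 : 1 <= weight p ^+ n by rewrite exprn_ege1// weight_ge1.
apply: le_lt_trans (ltry M); apply: le_trans H.
rewrite -[leLHS]mule1; apply: lee_wpmul2l; first exact: measure_ge0.
by rewrite lee_fin.
Qed.

(** Under [ball_bounded] these disks are of finite variation, which makes the
variation sigma-finite. *)
Lemma rational_disks_cover : \bigcup_i (if unpickle i is Some (a, b)
    then disk (ratr a : R, ratr b : R) (Num.sqrt 2) else set0) = setT.
Proof.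
apply/seteqP; split=> // -[x y] _.
have [a] : exists a : rat, ratr a \in `](x - 1/2), x[%R by apply: rat_in_itvoo; lra.
rewrite in_itv /= => /andP[a1 a2].
have [b] : exists b : rat, ratr b \in `](y - 1/2), y[%R by apply: rat_in_itvoo; lra.
rewrite in_itv /= => /andP[b1 b2].
exists (pickle (a, b)); first exact: I.
rewrite pickleK.
suff : normc (z_of (x, y) - z_of (ratr a, ratr b)) < Num.sqrt 2 by [].
apply: (@le_lt_trans _ _ 1).
  apply: (le_trans (normc_le_ReIm _)); rewrite !ReImE /= [leRHS]splitr.
  by apply: lerD; rewrite ler_norml; apply/andP; split; lra.
by rewrite -[ltLHS]sqrtr1 ltr_sqrt// ltr1n.
Qed.

Lemma ball_sigma_finite n M : ball_bounded n M -> sigma_finite setT tv.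
Proof.
move=> H; exists (fun i => if unpickle i is Some (a, b)
    then disk (ratr a, ratr b) (Num.sqrt 2) else set0).
  by rewrite rational_disks_cover.
move=> i; case: unpickle => [[a b]|]; last by rewrite measure0; split.
by split; [exact: measurable_disk|exact: ball_bounded_fin H].
Qed.

(** Tonelli's theorem takes measures bundled with their sigma-finiteness. *)
Definition area_sf := HB.pack_for {sigma_finite_measure set (measurableTypeR R * measurableTypeR R)%type -> \bar R}
  (leb \x leb)%E (@Measure_isSigmaFinite.Build _ _ _ (leb \x leb)%E (@area_sigma_finite R)).

Definition variation_sf (sf : sigma_finite setT tv) :=
  HB.pack_for {sigma_finite_measure set (R * R)%type -> \bar R} tv
    (@Measure_isSigmaFinite.Build _ _ _ tv sf).

(** Written as a function of differences of coordinates, the indicator is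
seen to be measurable in the centre and in the point jointly. *)
Lemma square_indicE p q (r : R) : \1_(square (z_of p) r) q =
  \1_(`[- r, r] : set R) (q.1 - p.1) * \1_(`[- r, r] : set R) (q.2 - p.2) :> R.
Proof.
rewrite !indicE -natrM mulnb; congr (_%:R); congr nat_of_bool.
apply/idP/andP; rewrite !inE /=.
  by move=> /squareP[/= h1 h2]; rewrite !in_itv /= -!ler_norml.
by rewrite !in_itv /= -!ler_norml => -[h1 h2]; apply/squareP.
Qed.

Lemma measurable_square_indic (r : R) :
  measurable_fun setT (fun u : (R * R) * (R * R) => \1_(square (z_of u.1) r) u.2 : R).
Proof.
under eq_fun do rewrite square_indicE.
have mI : measurable_fun setT (\1_(`[- r, r] : set R) : R -> R) by exact: measurable_indic.
apply: measurable_funM.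
  apply: (measurableT_comp mI); apply: measurable_funB.
    exact: (measurableT_comp measurable_fst measurable_snd).
  exact: (measurableT_comp measurable_fst measurable_fst).
apply: (measurableT_comp mI); apply: measurable_funB.
  exact: (measurableT_comp measurable_snd measurable_snd).
exact: (measurableT_comp measurable_snd measurable_fst).
Qed.

Lemma measurable_weight : measurable_fun setT weight.
Proof.
apply: (measurableT_comp (continuous_measurable_fun (@sqrt_continuous R))).
apply: measurable_funD => //; apply: (@measurable_sqmod _ id) => z e e0.
by exists e.
Qed.

(** The inverse is obtained from a continuous function of the modulus,
the kernel of [arctan_kernel_continuous] with centre 0 and e = 1. *)
Lemma measurable_weightV : measurable_fun setT (fun p => (weight p)^-1).
Proof.
have E p : (weight p)^-1 = Num.sqrt (1 / ((normc (z_of p) - 0) ^+ 2 + 1 ^+ 2)).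
  by rewrite mul1r subr0 expr1n sqrtrV ?addr_ge0 ?sqr_ge0// addrC.
under eq_fun do rewrite E.
apply: (measurableT_comp (continuous_measurable_fun (@sqrt_continuous R))).
have mk := continuous_measurable_fun (@arctan_kernel_continuous R 0 1 ltr01).
apply: (measurableT_comp mk).
apply: (@measurable_normc_z _ id) => [|z e e0]; first exact: normc_lipschitz.
by exists e.
Qed.

Lemma square_sub_disk p q : square (z_of p) (3/4) q ->
  disk q (Num.sqrt 2) p /\ weight p <= 3 * weight q.
Proof.
move=> /squareP[h1 h2].
have s1 : (q.1 - p.1) ^+ 2 <= (3/4) ^+ 2.
  by rewrite -real_normK ?num_real//; apply: lerXn2r => //; rewrite nnegrE//; lra.
have s2 : (q.2 - p.2) ^+ 2 <= (3/4) ^+ 2.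
  by rewrite -real_normK ?num_real//; apply: lerXn2r => //; rewrite nnegrE//; lra.
split.
  suff : normc (z_of p - z_of q) < Num.sqrt 2 by [].
  rewrite -[normc _]ger0_norm ?normc_ge0// -sqrtr_sqr ltr_sqrt//.
  by rewrite sqr_normc !ReImE /=; nra.
rewrite -[3 * _]ger0_norm ?mulr_ge0 ?sqrtr_ge0// -sqrtr_sqr ler_sqrt ?sqr_ge0//.
rewrite exprMn weight_sqr !sqmodE /=.
by have := sqr_ge0 (p.1 - 2 * q.1); have := sqr_ge0 (p.2 - 2 * q.2); nra.
Qed.

(** After [local_estimate] the total weight at p is w(p)^(alpha + beta).
Exchanging the integrals by Tonelli's theorem, a fixed q collects the variation
of the disk around q; there w(p) <= 3 w(q), and the growth condition absorbs
w(q)^n. *)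
Theorem weighted_estimate n M (alpha beta : nat) : ball_bounded n M -> (alpha + beta)%N = n ->
  forall f, cdiff f ->
  (\int[tv]_p (sqmod (cderiv alpha f (z_of p)) * gauss p * (weight p ^+ beta / weight p ^+ alpha))%:E
    <= (local_const R alpha * 3 ^+ n * M)%:E *
       \int[area]_p (sqmod (f (z_of p)) * gauss p)%:E)%E.
Proof.
move=> HM abn f df.
pose phi q : R := sqmod (f (z_of q)) * gauss q.
have phi0 q : 0 <= phi q by apply: mulr_ge0; [exact: sqmod_ge0|exact: expR_ge0].
have mphi : measurable_fun setT phi.
  apply: measurable_funM; last exact: measurable_gauss.
  by apply: measurable_sqmod => z; exact: cdiff_ccont.
pose C := local_const R alpha.
have C0 : 0 < C by exact: local_const_gt0.
pose G (u : (R * R) * (R * R)) : \bar R :=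
  (C * (weight u.1 ^+ n * (phi u.2 * \1_(square (z_of u.1) (3/4)) u.2)))%:E.
have mG : measurable_fun setT G.
  apply/measurable_EFinP; apply: measurable_funM => //; apply: measurable_funM.
    by apply: measurable_funX; exact: (measurableT_comp measurable_weight measurable_fst).
  apply: measurable_funM; last exact: measurable_square_indic.
  exact: (measurableT_comp mphi measurable_snd).
have G0 u : (0 <= G u)%E.
  rewrite lee_fin mulr_ge0 ?(ltW C0)//; apply: mulr_ge0.
    by rewrite exprn_ge0// ltW// weight_gt0.
  by apply: mulr_ge0 => //; exact: indic_ge0.
have stv := variation_sf (ball_sigma_finite HM).
have GE p : (\int[area]_q G (p, q) = (C * weight p ^+ n)%:E * local_mass f (z_of p) (3/4))%E.
  rewrite /local_mass -ge0_integralZl_EFin//; last 3 first.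
  - by move=> q _; rewrite lee_fin mass_ge0.
  - apply/measurable_EFinP; apply: measurable_funM; first exact: mphi.
    by apply: measurable_indic; exact: measurable_square.
  - by rewrite mulr_ge0 ?(ltW C0)// exprn_ge0// ltW// weight_gt0.
  by apply: eq_integral => q _; rewrite /G /= -EFinM mulrA.
have wfin (k : nat) p : weight p ^+ k != 0 by rewrite expf_neq0// gt_eqF// weight_gt0.
have wge0 (k : nat) p : 0 <= weight p ^+ k by rewrite exprn_ge0// ltW// weight_gt0.
apply: (@le_trans _ _ (\int[tv]_p \int[area]_q G (p, q))%E).
  apply: ge0_le_integral => //.
  - move=> p _; rewrite lee_fin; apply: mulr_ge0; last by rewrite divr_ge0.
    by apply: mulr_ge0; [exact: sqmod_ge0|exact: expR_ge0].
  - apply/measurable_EFinP; apply: measurable_funM.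
      apply: measurable_funM; last exact: measurable_gauss.
      by apply: measurable_sqmod => z; apply: cdiff_ccont; exact: cdiff_cderiv.
    apply: measurable_funM; first by apply: measurable_funX; exact: measurable_weight.
    by under eq_fun do rewrite -exprVn; apply: measurable_funX; exact: measurable_weightV.
  - exact: (measurable_fun_fubini_tonelli_F (m2 := area_sf) _ mG G0).
  move=> p _; rewrite GE.
  have le := local_estimate alpha (z_of p) df.
  have r0 : 0 <= weight p ^+ beta / weight p ^+ alpha by rewrite divr_ge0.
  rewrite mulrC EFinM.
  apply: le_trans; first by apply: lee_wpmul2l le; rewrite lee_fin.
  rewrite muleA -EFinM le_eqVlt; apply/orP; left; apply/eqP; congr ((_ : R)%:E * _)%E.
  rewrite -/C -weight_sqr -exprM mul2n -addnn exprD -abn exprD.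
  by have := wfin alpha p; move: (weight p ^+ alpha) => u u0; field.
have -> : (\int[tv]_p \int[area]_q G (p, q) = \int[area]_q \int[tv]_p G (p, q))%E.
  exact: (fubini_tonelli (m1 := variation_sf (ball_sigma_finite HM)) (m2 := area_sf) _ mG G0).
have K0 : 0 <= C * 3 ^+ n * M.
  rewrite !mulr_ge0 ?exprn_ge0 ?(ltW C0)//; rewrite -lee_fin; apply: le_trans (HM (0, 0)).
  by apply: mule_ge0; [exact: measure_ge0|rewrite lee_fin].
rewrite -ge0_integralZl_EFin//; last 2 first.
- by move=> q _; rewrite lee_fin; exact: phi0.
- exact/measurable_EFinP.
apply: ge0_le_integral => //.
- by move=> q _; exact: integral_ge0.
- exact: (measurable_fun_fubini_tonelli_G (m1 := variation_sf (ball_sigma_finite HM)) _ mG G0).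
- by apply/measurable_EFinP; apply: measurable_funM.
move=> q _.
apply: (@le_trans _ _ ((C * phi q * (3 * weight q) ^+ n)%:E * tv (disk q (Num.sqrt 2)))%E).
  rewrite -integral_cst; last exact: measurable_disk.
  rewrite [leRHS]integral_mkcond; apply: ge0_le_integral => //.
  - exact: (measurableT_comp mG (measurable_pair2 q)).
  - by apply/(measurable_restrictT _ (measurable_disk _ _)).
  move=> p _; rewrite patchE.
  have [pq|pq] := pselect (square (z_of p) (3/4) q); last first.
    rewrite /G /= indicE memNset// !mulr0.
    by case: ifP => // _; rewrite lee_fin; apply: mulr_ge0; [rewrite mulr_ge0// ltW|rewrite exprn_ge0// mulr_ge0// ltW// weight_gt0].
  have [dp wp] := square_sub_disk pq.
  rewrite mem_set// /G /= indicE mem_set// mulr1 lee_fin -mulrA ler_wpM2l ?(ltW C0)//.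
  rewrite mulrC ler_wpM2l//; apply: lerXn2r => //; rewrite nnegrE.
    by rewrite ltW// weight_gt0.
  by rewrite mulr_ge0// ltW// weight_gt0.
have -> : ((C * phi q * (3 * weight q) ^+ n)%:E * tv (disk q (Num.sqrt 2)) =
   (C * phi q * 3 ^+ n)%:E * (tv (disk q (Num.sqrt 2)) * (weight q ^+ n)%:E))%E.
  by rewrite exprMn mulrA EFinM -muleA [(tv _ * _)%E]muleC.
have -> : ((C * 3 ^+ n * M)%:E * (sqmod (f (z_of q)) * gauss q)%:E =
   (C * phi q * 3 ^+ n)%:E * M%:E)%E.
  by rewrite -!EFinM; congr EFin; rewrite -/(phi q); ring.
apply: lee_wpmul2l => //; rewrite lee_fin; apply: mulr_ge0; last exact: exprn_ge0.
by apply: mulr_ge0; [exact: ltW|exact: phi0].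
Qed.

End ball_bound.

(** * The Jordan decomposition of a complex measure *)

Section jordan.
Context (R : realType) (mu : complex_measure R).
Notation tv := (Defs.variation mu).

Lemma bounded_setS (A B : set (R * R)) : A `<=` B -> bounded_set B -> bounded_set A.
Proof.
move=> AB; rewrite /bounded_set /= /bounded_near; apply: filterS => M bM x /AB.
exact: bM.
Qed.

Lemma bounded_set0 : bounded_set (set0 : set (R * R)).
Proof. by exists 0; split=> // x _ y. Qed.

Lemma bounded_disk (p : R * R) (r : R) : bounded_set (disk p r).
Proof.
exists (`|p| + r); split; first exact: num_real.
move=> M hM q pq; have {}pq : normc (z_of q - z_of p) < r by [].
apply/ltW/(le_lt_trans _ hM).
have h1 := le_lt_trans (Re_le_normc _) pq; have h2 := le_lt_trans (Im_le_normc _) pq.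
rewrite !ReImE /= in h1 h2.
rewrite -[q](subrK p) addrC; apply: (le_trans (ler_normD _ _)); rewrite lerD2l.
by rewrite prod_normE ge_max (ltW h1) (ltW h2).
Qed.

Lemma cmeas_cvg_const (A : (set (R * R))^nat) (n : nat) (v : R[i]) :
  (forall n, measurable (A n)) -> trivIset setT A -> bounded_set (\bigcup_n A n) ->
  (forall m, (n <= m)%N -> \sum_(i < m) mu (A i) = v) -> mu (\bigcup_n A n) = v.
Proof.
move=> mA tA bA E; have hd := @norm_hausdorff _ (R[i]^o : normedModType R[i]).
have cv := @cmeas_sigma_additive R mu A mA tA bA.
have cv2 : (fun n => \sum_(i < n) mu (A i) : R[i]^o) @ \oo --> (v : R[i]^o).
  apply: cvg_near_cst; exists n => // m /= nm; exact: E.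
exact: etrans (esym (cvg_lim hd cv)) (cvg_lim hd cv2).
Qed.

Lemma cmeas0 : mu set0 = 0.
Proof.
have t0 : trivIset [set: nat] (fun=> set0 : set (R * R)) by move=> i j _ _ [x []].
have hd := @norm_hausdorff _ (R[i]^o : normedModType R[i]).
have := @cmeas_sigma_additive R mu (fun=> set0) (fun=> measurable0) t0.
rewrite bigcup0// => /(_ bounded_set0) cv.
have cv1 : (fun n => \sum_(i < n.+1) mu set0 : R[i]^o) @ \oo -->
    (mu set0 : R[i]^o) by rewrite -cvg_shiftS in cv.
have cv2 : (fun n => \sum_(i < n.+1) mu set0 : R[i]^o) @ \oo -->
    (mu set0 + mu set0 : R[i]^o).
  under eq_fun do rewrite big_ord_recr /=.
  by apply: cvgD cv _; exact: cvg_cst.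
have h : mu set0 + mu set0 = mu set0.
  exact: etrans (esym (cvg_lim hd cv2)) (cvg_lim hd cv1).
by apply: (addrI (mu set0)); rewrite addr0.
Qed.

(** Additivity for a finite disjoint family completed by its complement
in A, the form needed to compare variations. *)
Lemma cmeas_sum n (B : (set (R * R))^nat) A : bounded_borel A ->
  (forall i, (i < n)%N -> measurable (B i) /\ B i `<=` A) ->
  trivIset [set i | (i < n)%N] B ->
  mu A = \sum_(i < n) mu (B i) + mu (A `\` \bigcup_(i < n) B i).
Proof.
move=> [mA bA] HB tB; pose A0 := A `\` \bigcup_(i < n) B i.
(* sigma-additivity of mu is only available for sequences *)
pose F i := if (i < n)%N then B i else if i == n then A0 else set0.
have mU : measurable (\bigcup_(i < n) B i).
  by apply: bigcup_measurable => i /= /HB[].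
have UF : \bigcup_i F i = A.
  apply/seteqP; split=> [x [i _]|x Ax]; rewrite /F.
    by case: ifP => [/HB[_]|_]; [exact|case: ifP => // _ []].
  have [[i ltin Bx]|nB] := pselect ((\bigcup_(i < n) B i) x).
    by exists i => //; rewrite ltin.
  by exists n => //; rewrite ltnn eqxx.
rewrite -[in LHS]UF.
apply: (@cmeas_cvg_const F n.+1).
- move=> i; rewrite /F; case: ifP => [/HB[]//|_]; case: ifP => // _; exact: measurableD.
- move=> i j _ _ [x [Fi Fj]]; move: Fi Fj; rewrite /F.
  case: (boolP (i < n)%N) => ilt; case: (boolP (j < n)%N) => jlt.
  + by move=> Bi Bj; apply: tB => //; exists x.
  + by move=> Bx; case: eqP => // _ [_ nB]; case: nB; exists i.
  + by case: eqP => // _ [_ nB] Bx; case: nB; exists j.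
  + by case: (eqVneq i n) => [->|_]; case: (eqVneq j n) => [->|_].
- by rewrite UF.
move=> m nm; rewrite -(big_mkord xpredT (fun i => mu (F i))).
rewrite (@big_cat_nat _ _ _ n.+1)//= big_nat_recr//= [X in _ + X]big_nat_cond.
rewrite [X in _ + X]big1 ?addr0; last first.
  move=> i; rewrite andbT => /andP[ni _]; rewrite /F ltnNge (ltnW ni) /=.
  by rewrite gtn_eqF// cmeas0.
rewrite {2}/F ltnn eqxx big_mkord; congr (_ + _).
by apply: eq_bigr => i _; rewrite /F ltn_ord.
Qed.

Lemma phi_variation_le (phi : R[i] -> R) A : (forall w, phi w <= normc w) ->
  (phi_variation phi mu A <= tv A)%E.
Proof.
move=> le; apply: ge_ereal_sup => _ [n [B [HB tB ->]]].
apply: (@le_trans _ _ (\sum_(i < n) normc (mu (B i)))%:E).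
  by rewrite lee_fin; apply: ler_sum.
by apply: ereal_sup_ubound; exists n, B.
Qed.

Lemma normc_cmeas_le A : bounded_borel A -> ((normc (mu A))%:E <= tv A)%E.
Proof.
move=> bA; apply: ereal_sup_ubound; exists 1%N, (fun=> A); split.
- by move=> i _; split.
- by move=> [|i] [|j].
- by rewrite big_ord_recl big_ord0 addr0.
Qed.

(** Any disjoint family in A is completed to a partition of A; then l (mu A) is
the sum of all positive parts minus the sum of all negative parts, the latter being at most the negative variation. *)
Lemma phi_variation_jordan (l : R[i] -> R) A : {morph l : x y / x + y} ->
  bounded_borel A ->
  (phi_variation (fun w => Num.max (l w) 0)%R mu A <=
   (l (mu A))%:E + phi_variation (fun w => Num.max (- l w) 0)%R mu A)%E.
Proof.
move=> lD bA; apply: ge_ereal_sup => _ [n [B [HB tB ->]]].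
have l0 : l 0 = 0 by apply: (addrI (l 0)); rewrite -lD !addr0.
have mU : measurable (\bigcup_(i < n) B i).
  by apply: bigcup_measurable => i /= /HB[[]].
pose A0 := A `\` \bigcup_(i < n) B i.
have bA0 : bounded_borel A0.
  by case: bA => mA bA; split; [exact: measurableD|apply: bounded_setS bA => x []].
pose C i := if (i < n)%N then B i else A0.
have muA : l (mu A) = \sum_(i < n) l (mu (B i)) + l (mu A0).
  rewrite (@cmeas_sum n B) ?lD; first by congr (_ + _); apply: big_morph.
  - exact: bA.
  - by move=> i /HB[[]].
  - exact: tB.
apply: (@le_trans _ _ ((l (mu A))%:E + (\sum_(i < n.+1) Num.max (- l (mu (C i))) 0)%:E)%E).
  rewrite -EFinD lee_fin big_ord_recr /= {2}/C ltnn.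
  under [X in _ <= _ + (X + _)]eq_bigr => i _ do rewrite /C ltn_ord.
  rewrite muA addrACA -big_split /=.
  have pm (x : R) : Num.max x 0 = x + Num.max (- x) 0.
    by case: (lerP x 0) => x0; case: (lerP (- x) 0) => y0; lra.
  under eq_bigr do rewrite pm.
  rewrite lerDl; case: (lerP (- l (mu A0)) 0) => h; lra.
rewrite leeD2l//; apply: ereal_sup_ubound; exists n.+1, C; split=> //.
- move=> i _; rewrite /C; case: ifP => [/HB//|_]; split=> // x; by case.
- move=> i j /=; rewrite !ltnS /C => ilt jlt.
  case: ifPn => i1; case: ifPn => j1; first exact: tB.
  + by move=> [x [Bx [_]]]; case; exists i.
  + by move=> [x [[_ nB] Bx]]; case: nB; exists j.
  + move=> _; apply/eqP; rewrite eqn_leq.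
    by rewrite -!leqNgt in i1 j1; rewrite (leq_trans ilt j1) (leq_trans jlt i1).
Qed.

Notation V1 := (re_pos_variation mu).
Notation V2 := (re_neg_variation mu).
Notation V3 := (im_pos_variation mu).
Notation V4 := (im_neg_variation mu).

Let max_le (w : R[i]) (x : R) : `|x| <= normc w -> Num.max x 0 <= normc w.
Proof. by move=> h; rewrite ge_max normc_ge0 andbT (le_trans (ler_norm _) h). Qed.

Lemma V1_le A : (V1 A <= tv A)%E.
Proof. by apply: phi_variation_le => w; apply: max_le; exact: Re_le_normc. Qed.
Lemma V2_le A : (V2 A <= tv A)%E.
Proof. by apply: phi_variation_le => w; apply: max_le; rewrite normrN; exact: Re_le_normc. Qed.
Lemma V3_le A : (V3 A <= tv A)%E.
Proof. by apply: phi_variation_le => w; apply: max_le; exact: Im_le_normc. Qed.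
Lemma V4_le A : (V4 A <= tv A)%E.
Proof. by apply: phi_variation_le => w; apply: max_le; rewrite normrN; exact: Im_le_normc. Qed.

Lemma jordan_decomposition A : bounded_borel A -> (tv A < +oo)%E ->
  Re (mu A) = fine (V1 A) - fine (V2 A) /\ Im (mu A) = fine (V3 A) - fine (V4 A).
Proof.
move=> bA fA.
have fin (m : {measure set (R * R)%type -> \bar R}) : (m A <= tv A)%E -> m A \is a fin_num.
  by move=> h; rewrite ge0_fin_numE ?measure_ge0//; exact: le_lt_trans h fA.
have key (l : R[i] -> R) (P N : {measure set (R * R)%type -> \bar R}) :
    {morph l : x y / x + y} -> (P A <= tv A)%E -> (N A <= tv A)%E ->
    P A = phi_variation (fun w => Num.max (l w) 0) mu A ->
    N A = phi_variation (fun w => Num.max (- l w) 0) mu A -> l (mu A) = fine (P A) - fine (N A).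
  move=> lD /fin Pf /fin Nf PE NE.
  have h1 := phi_variation_jordan lD bA; rewrite -PE -NE in h1.
  have lND : {morph (fun w => - l w) : x y / x + y} by move=> x y; rewrite lD opprD.
  have := phi_variation_jordan lND bA; rewrite -NE.
  rewrite (_ : (fun w => Num.max (- - l w) 0) = (fun w => Num.max (l w) 0)); last first.
    by apply/funext => w; rewrite opprK.
  rewrite -PE => h2.
  move: h1 h2; rewrite -(fineK Pf) -(fineK Nf) -!EFinD !lee_fin /= => h1 h2.
  by apply/eqP; rewrite eq_le; apply/andP; split; lra.
split.
  apply: (key (@complex.Re R) V1 V2) => //; [exact: ReD|exact: V1_le|exact: V2_le].
apply: (key (@complex.Im R) V3 V4) => //; [exact: ImD|exact: V3_le|exact: V4_le].
Qed.

(** * The modulus of an integral against a complex measure *)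

Section dominated.
Variables (D : (set (R * R))^nat).
Hypotheses (mD : forall i, measurable (D i)) (bD : forall i, bounded_set (D i))
  (fD : forall i, (tv (D i) < +oo)%E) (coverD : \bigcup_i D i = setT).

Let comb (k : nat -> {nonneg R}) : {measure set (R * R)%type -> \bar R} :=
  measure_add (mscale (k 0%N) V1) (measure_add (mscale (k 1%N) V2)
    (measure_add (mscale (k 2%N) V3) (measure_add (mscale (k 3%N) V4) (mscale (k 4%N) tv)))).

Let combE k A : comb k A = ((k 0%N)%:num%:E * V1 A + ((k 1%N)%:num%:E * V2 A +
  ((k 2%N)%:num%:E * V3 A + ((k 3%N)%:num%:E * V4 A + (k 4%N)%:num%:E * tv A))))%E.
Proof.
by do 4 (apply: (etrans (measure_addE _ _ _)); congr (_ + _)%E).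
Qed.

Let int_comb k (f : R * R -> \bar R) : measurable_fun setT f -> (forall x, 0 <= f x)%E ->
  (\int[comb k]_x f x = (k 0%N)%:num%:E * \int[V1]_x f x + ((k 1%N)%:num%:E * \int[V2]_x f x +
  ((k 2%N)%:num%:E * \int[V3]_x f x + ((k 3%N)%:num%:E * \int[V4]_x f x +
   (k 4%N)%:num%:E * \int[tv]_x f x))))%E.
Proof.
move=> mf f0; rewrite /comb.
by do !rewrite ge0_integral_measure_add//; rewrite !ge0_integral_mscale.
Qed.

Let comb_le k k' : (forall A, bounded_borel A -> (tv A < +oo)%E -> (comb k A <= comb k' A)%E) ->
  forall A, measurable A -> (comb k A <= comb k' A)%E.
Proof.
move=> H A mA; pose F i := A `&` seqDU D i.
have mF i : measurable (F i) by apply: measurableI => //; exact: seqDU_measurable.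
have tF : trivIset setT F by apply: trivIset_setIl; exact: trivIset_seqDU.
have AE : A = \bigcup_i F i.
  by rewrite -setI_bigcupr -seqDU_bigcup_eq coverD setIT.
have S (m : {measure set (R * R)%type -> \bar R}) : (m A = \sum_(0 <= i <oo) m (F i))%E.
  by rewrite AE measure_semi_bigcup// -AE.
rewrite !S.
have FD i : F i `<=` D i by move=> x [_]; exact: subset_seqDU.
apply: lee_nneseries => i _; first by move=> _; exact: measure_ge0.
apply: H; first by split=> //; exact: bounded_setS (FD i) (bD i).
by apply: le_lt_trans (fD i); apply: le_measure; rewrite ?inE.
Qed.

Let I (m : {measure set (R * R)%type -> \bar R}) (f : R * R -> R) : R := \int[m]_x f x.

Let pos (x : R) : 0 <= Num.max x 0. Proof. by rewrite le_max lexx orbT. Qed.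

Let coeffs (a b c : R) (c0 : 0 <= c) (i : nat) : {nonneg R} :=
  match i with
  | 0%N => NngNum (pos a) | 1%N => NngNum (pos (- a))
  | 2%N => NngNum (pos (- b)) | 3%N => NngNum (pos b) | _ => NngNum c0
  end.

Lemma integrable_le_tv (m : {measure set (R * R)%type -> \bar R}) (f : R * R -> \bar R) :
  (forall A, (m A <= tv A)%E) -> tv.-integrable setT f -> m.-integrable setT f.
Proof.
move=> le /integrableP[mf fi]; apply/integrableP; split=> //.
apply: le_lt_trans fi; apply: ge0_le_measure_integral => //.
by apply: measurableT_comp; [exact: abse_measurable|exact: mf].
Qed.

(** The set-wise inequality Re ((a + ib) mu(A)) <= |a + ib| |mu|(A),
integrated.  Integrals are monotone in the measure only for positive measures,
so the terms with a negative coefficient are first moved to the other side. *)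
Lemma directional_bound (a b : R) (f : R * R -> R) : (forall x, 0 <= f x) ->
  tv.-integrable setT (EFin \o f) ->
  a * (I V1 f - I V2 f) - b * (I V3 f - I V4 f) <= Num.sqrt (a ^+ 2 + b ^+ 2) * I tv f.
Proof.
move=> f0 fi; set N := Num.sqrt _.
have N0 : 0 <= N by exact: sqrtr_ge0.
have pm (x : R) : x = Num.max x 0 - Num.max (- x) 0.
  by case: (lerP x 0) => h1; case: (lerP (- x) 0) => h2; lra.
have le : forall A, measurable A ->
    (comb (coeffs a b (lexx 0)) A <= comb (coeffs (- a) (- b) N0) A)%E.
  apply: comb_le => A bA fA; rewrite !combE /= !opprK mul0e adde0.
  have [re im] := jordan_decomposition bA fA.
  have fin (m : {measure set (R * R)%type -> \bar R}) : (m A <= tv A)%E -> m A = (fine (m A))%:E.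
    by move=> h; rewrite fineK// ge0_fin_numE ?measure_ge0//; exact: le_lt_trans h fA.
  have tn := normc_cmeas_le bA.
  rewrite (fin tv)// in tn *; rewrite lee_fin in tn.
  rewrite (fin V1) ?V1_le// (fin V2) ?V2_le// (fin V3) ?V3_le// (fin V4) ?V4_le//.
  have := Re_le_normc ((a +i* b) * mu A); rewrite Normc.normcM ReM /= -/N re im.
  move=> /(le_trans (ler_norm _)) h.
  have {}h : a * (fine (V1 A) - fine (V2 A)) - b * (fine (V3 A) - fine (V4 A)) <= N * fine (tv A).
    by apply: (le_trans h); rewrite ler_wpM2l.
  rewrite -!EFinM -!EFinD lee_fin -subr_ge0; rewrite -subr_ge0 in h.
  apply: le_trans h _; rewrite le_eqVlt; apply/orP; left; apply/eqP.
  rewrite {1}(pm a) {1}(pm b); ring.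
have mf := measurable_int _ fi.
have fin (m : {measure set (R * R)%type -> \bar R}) : (forall A, (m A <= tv A)%E) ->
    (\int[m]_x (f x)%:E = (I m f)%:E)%E.
  move=> h; rewrite /I /Rintegral fineK//; apply: integrable_fin_num => //.
  exact: integrable_le_tv h fi.
have := ge0_le_measure_integral le measurableT (fun x => f0 x : (0 <= (EFin \o f) x)%E) mf.
rewrite !int_comb//= !opprK mul0e adde0.
rewrite (fin tv)// (fin V1)//; last exact: V1_le.
rewrite (fin V2)//; last exact: V2_le.
rewrite (fin V3)//; last exact: V3_le.
rewrite (fin V4)//; last exact: V4_le.
rewrite -!EFinM -!EFinD lee_fin -subr_ge0 => h; rewrite -subr_ge0.
apply: le_trans h _; rewrite le_eqVlt; apply/orP; left; apply/eqP.
rewrite {5}(pm a) {5}(pm b); ring.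
Qed.

(** The real part of the integral of u + iv against mu. *)
Let T (u v : R * R -> R) : R := I V1 u - I V2 u - (I V3 v - I V4 v).

Let tvi (f : R * R -> R) := tv.-integrable setT (EFin \o f).

Let tviP (m : {measure set (R * R)%type -> \bar R}) f : (forall A, (m A <= tv A)%E) ->
  tvi f -> m.-integrable setT (EFin \o f).
Proof. exact: integrable_le_tv. Qed.

Let tviB f g : tvi f -> tvi g -> tvi (fun x => f x - g x).
Proof.
move=> fi gi; rewrite /tvi (_ : _ \o _ = (EFin \o f) \- (EFin \o g))%E; first exact: integrableB.
by apply/funext => x /=; rewrite EFinB.
Qed.

Let tviZ (k : R) f : tvi f -> tvi (fun x => k * f x).
Proof.
move=> fi; rewrite /tvi (_ : _ \o _ = (fun x => k%:E * (EFin \o f) x))%E.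
  exact: integrableZl.
by apply/funext => x /=; rewrite EFinM.
Qed.

Let I_B (m : {measure set (R * R)%type -> \bar R}) f g : (forall A, (m A <= tv A)%E) -> tvi f -> tvi g ->
  I m (fun x => f x - g x) = I m f - I m g.
Proof. by move=> h fi gi; apply: RintegralB => //; exact: tviP h _. Qed.

Let I_Z (m : {measure set (R * R)%type -> \bar R}) k f : (forall A, (m A <= tv A)%E) -> tvi f -> I m (fun x => k * f x) = k * I m f.
Proof. by move=> h fi; apply: RintegralZl => //; exact: tviP h _. Qed.

Let T_B u v u' v' : tvi u -> tvi v -> tvi u' -> tvi v' ->
  T (fun x => u x - u' x) (fun x => v x - v' x) = T u v - T u' v'.
Proof.
move=> ui vi u'i v'i; rewrite /T.
rewrite (I_B V1_le)// (I_B V2_le)// (I_B V3_le)// (I_B V4_le)//; ring.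
Qed.

Let I_bound (m : {measure set (R * R)%type -> \bar R}) u phi : (forall A, (m A <= tv A)%E) -> tvi u -> tvi phi ->
  (forall x, `|u x| <= phi x) -> `|I m u| <= I tv phi.
Proof.
move=> h ui fi up.
have phi0 x : 0 <= phi x by exact: le_trans (up x).
have mi := tviP h fi.
apply: (@le_trans _ _ (I m phi)).
  apply: (le_trans (le_normr_Rintegral measurableT (tviP h ui))).
  apply: le_Rintegral => //; by have := integrable_norm (tviP h ui).
rewrite /I /Rintegral fine_le ?integrable_fin_num//.
apply: ge0_le_measure_integral => //; exact: measurable_int fi.
Qed.

Let cell_arith (x1 x2 x3 x4 y P delta : R) : `|x1| <= delta * P -> `|x2| <= delta * P ->
  `|x3| <= delta * P -> `|x4| <= delta * P -> y <= (1 + 2 * delta) * P ->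
  x1 - x2 - (x3 - x4) + y <= (1 + 6 * delta) * P.
Proof.
move=> /ler_normlP[_ h1] /ler_normlP[h2 _] /ler_normlP[h3 _] /ler_normlP[_ h4] h5; lra.
Qed.

(** When u + iv is close to the multiple a + ib of its modulus bound phi,
[directional_bound] applies to the main term; the four error terms and the
excess of |a + ib| over 1 cost at most 6 delta. *)
Let cell_bound (a b delta : R) phi u v : 0 <= delta -> tvi phi -> tvi u -> tvi v ->
  (forall x, 0 <= phi x) ->
  (forall x, normc (u x +i* v x) <= phi x) ->
  (forall x, `|u x - a * phi x| <= delta * phi x) ->
  (forall x, `|v x - b * phi x| <= delta * phi x) ->
  T u v <= (1 + 6 * delta) * I tv phi.
Proof.
move=> d0 fi ui vi f0 uv ua vb.
have ai := tviZ a fi; have bi := tviZ b fi; have di := tviZ delta fi.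
have -> : T u v = T (fun x => u x - a * phi x) (fun x => v x - b * phi x) +
    (a * (I V1 phi - I V2 phi) - b * (I V3 phi - I V4 phi)).
  rewrite T_B// [T (fun x => a * _) _]/T.
  rewrite (I_Z _ V1_le)// (I_Z _ V2_le)// (I_Z _ V3_le)// (I_Z _ V4_le)//; ring.
have h1 := I_bound V1_le (tviB ui ai) di ua.
have h2 := I_bound V2_le (tviB ui ai) di ua.
have h3 := I_bound V3_le (tviB vi bi) di vb.
have h4 := I_bound V4_le (tviB vi bi) di vb.
have tvle A : (tv A <= tv A)%E by [].
rewrite (I_Z _ tvle)// in h1 h2 h3 h4.
have h5 := directional_bound a b f0 fi.
have h6 : Num.sqrt (a ^+ 2 + b ^+ 2) * I tv phi <= (1 + 2 * delta) * I tv phi.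
  rewrite -!(I_Z _ tvle)//; apply: le_Rintegral => //; [exact: tviZ|exact: tviZ|].
  move=> x _; have -> : Num.sqrt (a ^+ 2 + b ^+ 2) * phi x = normc ((a +i* b) * (phi x)%:C).
    by rewrite Normc.normcM normc_real ger0_norm.
  have -> : (a +i* b) * (phi x)%:C = (u x +i* v x) + ((a * phi x - u x) +i* (b * phi x - v x)).
    by apply: complex_eqP; rewrite !ReImE /=; ring.
  apply: (le_trans (le_normcD _ _)).
  have := normc_le_ReIm ((a * phi x - u x) +i* (b * phi x - v x)); rewrite /= distrC [`|b * _ - _|]distrC.
  by have := uv x; have := ua x; have := vb x; rewrite /=; lra.
exact: cell_arith h1 h2 h3 h4 (le_trans h5 h6).
Qed.

Let tvi_sum (K : Type) (s : seq K) (f : K -> R * R -> R) : (forall k, tvi (f k)) ->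
  tvi (fun x => \sum_(k <- s) f k x).
Proof.
move=> fi; have := integrable_sum measurableT s (P := xpredT) (fun k _ => fi k).
by congr (_.-integrable _ _); apply/funext => x /=; rewrite sumEFin.
Qed.

Let I_sum (m : {measure set (R * R)%type -> \bar R}) (K : Type) (s : seq K)
    (f : K -> R * R -> R) : (forall A, (m A <= tv A)%E) -> (forall k, tvi (f k)) ->
  I m (fun x => \sum_(k <- s) f k x) = \sum_(k <- s) I m (f k).
Proof.
move=> h fi; elim: s => [|k s IH].
  rewrite big_nil /I (_ : (fun x => _) = fun x => 0 * 0); last first.
    by apply/funext => x; rewrite big_nil mul0r.
  rewrite RintegralZl ?mul0r//; exact: integrable0.
rewrite big_cons -IH /I -RintegralD//; [|exact: tviP|by apply: (tviP h); exact: tvi_sum].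
by apply: eq_Rintegral => x _; rewrite big_cons.
Qed.

Let T_sum (K : Type) (s : seq K) (u v : K -> R * R -> R) :
  (forall k, tvi (u k)) -> (forall k, tvi (v k)) ->
  T (fun x => \sum_(k <- s) u k x) (fun x => \sum_(k <- s) v k x) = \sum_(k <- s) T (u k) (v k).
Proof.
move=> ui vi; rewrite /T !I_sum//; first by rewrite -!sumrB.
- exact: V4_le.
- exact: V3_le.
- exact: V2_le.
- exact: V1_le.
Qed.

(** The set where i / n.+1 - 1 <= u / phi < i.+1 / n.+1 - 1, written without
division so that it is empty where phi vanishes. *)
Let slice (n : nat) (phi u : R * R -> R) (i : nat) : set (R * R) :=
  [set x | i%:R * phi x <= n.+1%:R * (u x + phi x)] `\`
  [set x | i.+1%:R * phi x <= n.+1%:R * (u x + phi x)].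

Let measurable_slice n phi u i : tvi phi -> tvi u -> measurable (slice n phi u i).
Proof.
move=> /measurable_int/measurable_EFinP mp /measurable_int/measurable_EFinP mu_.
have m1 (k : R) : measurable_fun setT (fun x => k * phi x) by exact: measurable_funM.
have m2 : measurable_fun setT (fun x => n.+1%:R * (u x + phi x)).
  by apply: measurable_funM => //; exact: measurable_funD.
apply: measurableD.
  by have := measurable_fun_le measurableT (m1 i%:R) m2; rewrite setTI.
by have := measurable_fun_le measurableT (m1 i.+1%:R) m2; rewrite setTI.
Qed.

Let slice_exists n phi u x : `|u x| <= phi x -> 0 < phi x ->
  exists2 i : 'I_(n.+1.*2.+1), slice n phi u i x & forall j, slice n phi u j x -> j = i :> nat.
Proof.
move=> up f0.
have uniqi i j : (i < j)%N -> slice n phi u i x -> slice n phi u j x -> False.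
  move=> ij [_ /= h1] [/= h2 _]; apply: h1; apply: le_trans h2.
  by rewrite ler_pM2r// ler_nat.
move: up; rewrite ler_norml => /andP[u1 u2].
pose y := n.+1%:R * (u x + phi x) / phi x.
have y0 : 0 <= y by apply: divr_ge0 (ltW f0); apply: mulr_ge0 => //; lra.
have /andP[h1 h2] := truncn_itv y0.
have S : slice n phi u (Num.truncn y) x.
  split=> /=; first by rewrite -ler_pdivlMr.
  by apply/negP; rewrite -ltNge -ltr_pdivrMr.
have lt : (Num.truncn y < n.+1.*2.+1)%N.
  rewrite ltnS -(ler_nat R); apply: (le_trans h1).
  rewrite ler_pdivrMr// -muln2 natrM -mulrA ler_pM2l// ?ltr0n//; lra.
exists (Ordinal lt) => // j Sj /=; case: (ltngtP j (Num.truncn y)) => // ij.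
  by case: (uniqi _ _ ij).
by case: (uniqi _ _ ij).
Qed.

Let slice_approx n phi u i x : slice n phi u i x ->
  `|u x - (i%:R / n.+1%:R - 1) * phi x| <= n.+1%:R^-1 * phi x.
Proof.
move=> [/= h1 /negP]; rewrite -ltNge => h2.
have N0 : 0 < n.+1%:R :> R by rewrite ltr0n.
rewrite -(ler_pM2l N0) mulrA divff ?gt_eqF// mul1r -{1}(gtr0_norm N0) -normrM.
have -> : n.+1%:R * (u x - (i%:R / n.+1%:R - 1) * phi x) = n.+1%:R * (u x + phi x) - i%:R * phi x.
  by field; rewrite gt_eqF.
move: h2; rewrite -natr1 mulrDl mul1r => h2.
by rewrite ler_norml; apply/andP; split; lra.
Qed.

(** The range [-1, 1] of u / phi and of v / phi is cut into slices of
length 1 / (n + 1); on each cell the error of [cell_bound] is of relative size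
6 / (n + 1), and the errors add up to that fraction of the whole integral. *)
Let modulus_bound (u v : R * R -> R) : tvi u -> tvi v -> tvi (fun x => normc (u x +i* v x)) ->
  T u v <= I tv (fun x => normc (u x +i* v x)).
Proof.
move=> ui vi fi; set phi := (fun x => _) in fi *.
have f0 x : 0 <= phi x by exact: normc_ge0.
have up x : `|u x| <= phi x := Re_le_normc (u x +i* v x).
have vp x : `|v x| <= phi x := Im_le_normc (u x +i* v x).
suff key n : T u v <= (1 + 6 / n.+1%:R) * I tv phi.
  have I0 : 0 <= I tv phi by exact: Rintegral_ge0.
  apply/ler_addgt0Pr => e e0.
  (* large enough for 6 / n.+1 * I tv phi <= e *)
  pose n := Num.truncn (6 * I tv phi / e).
  apply: (le_trans (key n)); rewrite mulrDl mul1r lerD2l.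
  have /andP[_] := truncn_itv (divr_ge0 (mulr_ge0 (ler0n R 6) I0) (ltW e0)).
  rewrite -/n ltr_pdivrMr// => /ltW h.
  by rewrite mulrAC ler_pdivrMr ?ltr0n// [leRHS]mulrC.
pose K := ('I_(n.+1.*2.+1) * 'I_(n.+1.*2.+1))%type.
pose E (k : K) := slice n phi u k.1 `&` slice n phi v k.2.
have mE k : measurable (E k) by apply: measurableI; exact: measurable_slice.
have cut (h : R * R -> R) k : tvi h -> tvi (fun x => h x * \1_(E k) x).
  move=> hi; have : tv.-integrable setT ((EFin \o h) \* (EFin \o \1_(E k)))%E.
    apply: integrableMl => //; exists 1; split; first exact: num_real.
    move=> M M1 x _ /=; rewrite ger0_norm ?indic_ge0//.
    by apply: le_trans (ltW M1); rewrite indicE lern1 leq_b1.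
  by congr (_.-integrable _ _); apply/funext => x /=.
have dec (h : R * R -> R) : (forall x, `|h x| <= phi x) ->
    h = (fun x => \sum_(k <- index_enum K) h x * \1_(E k) x).
  move=> hp; apply/funext => x; have [p0|p0] := eqVneq (phi x) 0.
    have -> : h x = 0 by apply/normr0_eq0/le_anti; rewrite normr_ge0 andbT -p0.
    by rewrite big1// => k _; rewrite mul0r.
  have {}p0 : 0 < phi x by rewrite lt_neqAle eq_sym p0 f0.
  have [i Si Ui] := slice_exists n (up x) p0; have [j Sj Uj] := slice_exists n (vp x) p0.
  rewrite (bigD1 (i, j))//= big1 ?addr0 => [|[i' j'] /= ne].
    by rewrite indicE mem_set ?mulr1.
  rewrite indicE memNset ?mulr0// => -[/Ui/= i'i /Uj/= j'j].
  by case/negP: ne; apply/eqP; congr (_, _); apply/val_inj.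
have pp x : `|phi x| <= phi x by rewrite ger0_norm.
rewrite {1}(dec u up) {1}(dec v vp) T_sum; [|by move=> k; exact: cut|by move=> k; exact: cut].
rewrite {1}(dec phi pp) I_sum//; last by move=> k; exact: cut.
rewrite mulr_sumr; apply: ler_sum => k _.
have onE (f g : R) x : (E k x -> f <= g) -> f * \1_(E k) x <= g * \1_(E k) x.
  rewrite indicE; have [Ex|nEx] := pselect (E k x).
    by rewrite mem_set// !mulr1; exact.
  by rewrite memNset// !mulr0.
apply: (@cell_bound (k.1%:R / n.+1%:R - 1) (k.2%:R / n.+1%:R - 1)); try exact: cut.
- by rewrite invr_ge0.
- by move=> x; apply: mulr_ge0.
- move=> x; have -> : (u x * \1_(E k) x) +i* (v x * \1_(E k) x) =
    (u x +i* v x) * (\1_(E k) x)%:C by apply: complex_eqP; rewrite !ReImE /=; ring.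
  by rewrite Normc.normcM normc_real ger0_norm.
- move=> x; rewrite !mulrA -mulrBl normrM (@ger0_norm _ (\1_(E k) x)) ?indic_ge0//.
  by apply: onE => -[Sx _]; exact: slice_approx Sx.
- move=> x; rewrite !mulrA -mulrBl normrM (@ger0_norm _ (\1_(E k) x)) ?indic_ge0//.
  by apply: onE => -[_ Sx]; exact: slice_approx Sx.
Qed.

Lemma Re_conj (w : R[i]) : Re (w^*) = Re w. Proof. by case: w. Qed.
Lemma Im_conj (w : R[i]) : Im (w^*) = - Im w. Proof. by case: w. Qed.

Lemma Re_rotation (w : R[i]) : w != 0 -> Re (w^* * (normc w)^-1%:C * w) = normc w.
Proof.
rewrite -normc_gt0 => w0; have := sqr_normc w; rewrite !ReImE Re_conj Im_conj /= => h2.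
have N0 : normc w != 0 by rewrite gt_eqF.
apply: (mulfI N0); rewrite -expr2 h2; field; exact: N0.
Qed.

(** Multiplying the integrand by the constant c of modulus one that makes
the integral real and nonnegative reduces the claim to real parts. *)
Lemma normc_cintegral_le (h : R * R -> R[i]) : cintegrable mu h ->
  normc (cintegral mu h) <= \int[tv]_x normc (h x).
Proof.
move=> [hre him]; set w := cintegral mu h.
have hi : tvi (fun x => normc (h x)).
  have hs : tv.-integrable setT (fun x => `|(Re (h x))%:E| + `|(Im (h x))%:E|)%E.
    by apply: integrableD => //; exact: integrable_norm.
  apply: le_integrable hs => //.
    apply/measurable_EFinP; have mr := measurable_int _ hre; have mi := measurable_int _ him.
    move/measurable_EFinP in mr; move/measurable_EFinP in mi.
    have -> : (fun x => normc (h x)) = (fun x => Num.sqrt (Re (h x) ^+ 2 + Im (h x) ^+ 2)).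
      by apply/funext => x; case: (h x).
    apply: (measurableT_comp (continuous_measurable_fun (@sqrt_continuous R))).
    by apply: measurable_funD; exact: measurable_funX.
  move=> x _; suff H : `|normc (h x)| <= `| `|Re (h x)| + `|Im (h x)| | by rewrite -lee_fin in H.
  rewrite (ger0_norm (normc_ge0 _)) (ger0_norm (addr_ge0 (normr_ge0 _) (normr_ge0 _))).
  exact: normc_le_ReIm.
have [w0|w0] := eqVneq w 0.
  have -> : normc w = 0 by apply/eqP; rewrite normc_eq0 w0.
  by apply: Rintegral_ge0 => x _; exact: normc_ge0.
pose c := w^* * (normc w)^-1%:C.
have nc : normc c = 1.
  rewrite Normc.normcM normc_conj normc_real ger0_norm ?invr_ge0 ?normc_ge0// divff// .
  by rewrite gt_eqF// normc_gt0.
have cw : Re (c * w) = normc w := Re_rotation w0.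
pose u x := Re (c * h x); pose v x := Im (c * h x).
have E1 x : (u x +i* v x) = c * h x by rewrite /u /v; case: (c * h x).
have E2 : (fun x => normc (u x +i* v x)) = (fun x => normc (h x)).
  by apply/funext => x; rewrite E1 Normc.normcM nc mul1r.
have lin (s t : R) : tvi (fun x => s * Re (h x) - t * Im (h x)).
  by apply: tviB; exact: tviZ.
have uE : u = (fun x => Re c * Re (h x) - Im c * Im (h x)).
  by apply/funext => x; rewrite /u ReM.
have vE : v = (fun x => Im c * Re (h x) - (- Re c) * Im (h x)).
  by apply/funext => x; rewrite /v ImM; ring.
have := @modulus_bound u v; rewrite E2 uE vE => /(_ (lin _ _) (lin _ _) hi).
apply: le_trans; rewrite -cw le_eqVlt; apply/orP; left; apply/eqP.
rewrite /T !(I_B V1_le) ?(I_B V2_le) ?(I_B V3_le) ?(I_B V4_le); try exact: tviZ.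
do !(rewrite (I_Z _ V1_le)// || rewrite (I_Z _ V2_le)// || rewrite (I_Z _ V3_le)// || rewrite (I_Z _ V4_le)//).
rewrite ReM /w /cintegral /= -!/(I _ _).
move: (I V1 _) (I V2 _) (I V3 _) (I V4 _) (I V1 _) (I V2 _) (I V3 _) (I V4 _) => *; ring.
Qed.

End dominated.

Lemma ball_normc_cintegral_le n M (h : R * R -> R[i]) : ball_bounded mu n M ->
  cintegrable mu h -> normc (cintegral mu h) <= \int[tv]_x normc (h x).
Proof.
move=> H; pose D i := if unpickle i is Some (a, b)
    then disk (ratr a : R, ratr b : R) (Num.sqrt 2) else set0.
apply: (@normc_cintegral_le D).
- by move=> i; rewrite /D; case: unpickle => [[a b]|//]; exact: measurable_disk.
- move=> i; rewrite /D; case: unpickle => [[a b]|]; first exact: bounded_disk.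
  exact: bounded_set0.
- move=> i; rewrite /D; case: unpickle => [[a b]|]; first exact: ball_bounded_fin H.
  by rewrite measure0.
- exact: rational_disks_cover.
Qed.

End jordan.

(** * The sesquilinear form *)

Section form.
Context (R : realType) (mu : complex_measure R).
Notation tv := (Defs.variation mu).
Notation leb := (@lebesgue_measure R).

Lemma integral_cauchy_schwarz d (T : measurableType d) (m : {measure set T -> \bar R})
    (F G : T -> R) : measurable_fun setT F -> measurable_fun setT G ->
  (forall x, 0 <= F x) -> (forall x, 0 <= G x) ->
  (\int[m]_x (F x * G x)%:E <=
   sqrte (\int[m]_x (F x ^+ 2)%:E) * sqrte (\int[m]_x (G x ^+ 2)%:E))%E.
Proof.
move=> mF mG F0 G0.
have norm2 (H : T -> R) : (forall x, 0 <= H x) ->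
    ('N[m]_2%:E[EFin \o H] = sqrte (\int[m]_x (H x ^+ 2)%:E))%E.
  move=> H0; rewrite unlock -poweR12_sqrt; last first.
    by apply: integral_ge0 => x _; rewrite lee_fin sqr_ge0.
  congr (_ `^ _)%E; apply: eq_integral => x _.
  by rewrite /= ger0_norm// powR_mulrn.
have h2 : 2^-1 + 2^-1 = 1 :> R by lra.
have := hoelder m mF mG (ltr0n R 2) (ltr0n R 2) h2.
rewrite Lnorm1 !norm2//; apply: le_trans.
rewrite le_eqVlt; apply/orP; left; apply/eqP; apply: eq_integral => x _ /=.
by rewrite ger0_norm ?mulr_ge0.
Qed.

Lemma sqrte_pmul_le (x y : \bar R) (a b : R) : 0 <= a -> 0 <= b ->
  (x <= a%:E)%E -> (y <= b%:E)%E -> (sqrte x * sqrte y <= (Num.sqrt (a * b))%:E)%E.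
Proof.
move=> a0 b0 xa yb; rewrite sqrtrM// EFinM.
apply: lee_pmul; rewrite ?sqrte_ge0//.
  by rewrite (lee_sqrt x (_ : (0 <= a%:E)%E)).
by rewrite (lee_sqrt y (_ : (0 <= b%:E)%E)).
Qed.

Lemma fock_sqnormE (f : R[i] -> R[i]) : fock f -> exists2 s : R, 0 <= s & fock_sqnorm f = s%:E.
Proof.
move=> [_ fin]; have s0 : (0 <= fock_sqnorm f)%E.
  apply: integral_ge0 => p _; rewrite lee_fin; apply: mulr_ge0; first exact: sqmod_ge0.
  by apply: mulr_ge0; [rewrite invr_ge0 pi_ge0|exact: expR_ge0].
by exists (fine (fock_sqnorm f)); rewrite ?fine_ge0// fineK// ge0_fin_numE.
Qed.

(** The bounds are closed conditions on the constant, so the infimum is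
itself a bound. *)
Lemma fc_const_attained k : (fc_const mu k < +oo)%E ->
  exists c : R, [/\ 0 <= c, fc_const mu k = c%:E & fc_bound mu k c].
Proof.
move=> lt.
have ge : (0 <= fc_const mu k)%E.
  by apply: le_ereal_inf_tmp => _ [c [c0 _] <-]; rewrite lee_fin.
exists (fine (fc_const mu k)); split; [exact: fine_ge0|by rewrite fineK ?ge0_fin_numE|].
move=> f ff; have [s s0 sE] := fock_sqnormE ff.
rewrite sE; apply/lee_addgt0Pr => e e0.
have d0 : 0 < e / (s + 1) by rewrite divr_gt0// ltr_wpDl.
have [_ [c [c0 fb] <-]] : exists2 x, [set c%:E | c in [set c | 0 <= c /\ fc_bound mu k c]] x &
    (x < fc_const mu k + (e / (s + 1))%:E)%E.
  by apply: lb_ereal_inf_adherent => //; rewrite ge0_fin_numE.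
rewrite -(fineK (_ : fc_const mu k \is a fin_num)) ?ge0_fin_numE//.
rewrite -EFinD lte_fin /= => /ltW ch.
apply: (le_trans (fb f ff)); rewrite sE -!EFinM -EFinD lee_fin.
apply: (le_trans (ler_wpM2r s0 ch)); rewrite mulrDl lerD2l.
rewrite mulrAC ler_pdivrMr ?ltr_wpDl//; apply: ler_wpM2l; [exact: ltW|lra].
Qed.

Definition weighted_mass k (rho : R * R -> R) f :=
  (\int[tv]_p (sqmod (cderiv k f (z_of p)) * gauss p * rho p)%:E)%E.

(** The power w^(l - k), whose exponent may be negative. *)
Definition weight_ratio k l (p : R * R) : R := weight p ^+ l * (weight p)^-1 ^+ k.

Lemma weight_ratio_ge0 k l p : 0 <= weight_ratio k l p.
Proof. by apply: mulr_ge0; apply: exprn_ge0; rewrite ?invr_ge0 ltW// weight_gt0. Qed.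

Lemma weight_ratioV k l p : weight_ratio k l p * weight_ratio l k p = 1.
Proof.
have w0 : weight p != 0 :> R by rewrite gt_eqF// weight_gt0.
rewrite /weight_ratio !exprVn; field; rewrite !expf_neq0//.
Qed.

Lemma measurable_weight_ratio k l : measurable_fun setT (weight_ratio k l).
Proof.
apply: measurable_funM; apply: measurable_funX; first exact: measurable_weight.
exact: measurable_weightV.
Qed.

Definition mass_const n (M : R) k : R := local_const R k * 3 ^+ n * M * pi.

Section bounded_form.
Variables (n : nat) (M : R) (alpha beta : nat).
Hypotheses (M0 : 0 <= M) (bM : ball_bounded mu n M) (hk : (alpha + beta)%N = n).

(** Cauchy-Schwarz with the factors weighted by rho and by its inverse
sigma. *)
Lemma weighted_form_bound (rho sigma : R * R -> R) f g : cdiff f -> cdiff g ->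
  measurable_fun setT rho -> measurable_fun setT sigma ->
  (forall p, 0 <= rho p) -> (forall p, 0 <= sigma p) -> (forall p, rho p * sigma p = 1) ->
  (\int[tv]_p (normc (fc_integrand alpha beta f g p))%:E <=
   sqrte (weighted_mass alpha rho f) * sqrte (weighted_mass beta sigma g))%E.
Proof.
move=> df dg mr ms r0 s0 rs.
have part k (h : R[i] -> R[i]) (w : R * R -> R) : cdiff h -> measurable_fun setT w ->
    measurable_fun setT (fun p => normc (cderiv k h (z_of p)) * Num.sqrt (gauss p * w p)).
  move=> dh mw; apply: measurable_funM.
    apply: measurable_normc_z; first exact: normc_lipschitz.
    by move=> z; apply: cdiff_ccont; exact: cdiff_cderiv.
  apply: (measurableT_comp (continuous_measurable_fun (@sqrt_continuous R))).
  by apply: measurable_funM => //; exact: measurable_gauss.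
have g0 p : 0 <= gauss p :> R by exact: expR_ge0.
have := integral_cauchy_schwarz tv (part alpha f rho df mr) (part beta g sigma dg ms)
  (fun p => mulr_ge0 (normc_ge0 _) (sqrtr_ge0 _)) (fun p => mulr_ge0 (normc_ge0 _) (sqrtr_ge0 _)).
have sq k (h : R[i] -> R[i]) (w : R * R -> R) : (forall p, 0 <= w p) ->
    (\int[tv]_p ((normc (cderiv k h (z_of p)) * Num.sqrt (gauss p * w p)) ^+ 2)%:E)%E = weighted_mass k w h.
  move=> w0; apply: eq_integral => p _; congr EFin.
  rewrite exprMn sqr_sqrtr ?mulrA//; exact: mulr_ge0.
rewrite (sq _ _ _ r0) (sq _ _ _ s0); apply: le_trans.
rewrite le_eqVlt; apply/orP; left; apply/eqP; apply: eq_integral => p _; congr EFin.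
rewrite /fc_integrand !Normc.normcM normc_conj normc_real (ger0_norm (g0 p)) mulrACA.
congr (_ * _); rewrite -sqrtrM ?mulr_ge0// mulrACA rs mulr1 -expr2 sqrtr_sqr ger0_norm//.
Qed.

Let entire_cdiff (f : R[i] -> R[i]) : fock f -> cdiff f. Proof. by case=> /entireP. Qed.

Lemma mass_const_ge0 k : 0 <= mass_const n M k.
Proof.
by rewrite /mass_const !mulr_ge0 ?exprn_ge0 ?pi_ge0// ltW// local_const_gt0.
Qed.

Lemma fock_area f : cdiff f -> (\int[leb \x leb]_p (sqmod (f (z_of p)) * gauss p)%:E =
  pi%:E * fock_sqnorm f)%E.
Proof.
move=> df; rewrite /fock_sqnorm -ge0_integralZl_EFin ?pi_ge0//; last 2 first.
- by move=> p _; rewrite lee_fin; apply: mulr_ge0; [exact: sqmod_ge0|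
    apply: mulr_ge0; [rewrite invr_ge0 pi_ge0|exact: expR_ge0]].
- apply/measurable_EFinP; apply: measurable_funM.
    by apply: measurable_sqmod => z; exact: cdiff_ccont.
  by apply: measurable_funM => //; exact: measurable_gauss.
apply: eq_integral => p _; rewrite -EFinM; congr EFin.
by rewrite mulrCA !mulrA mulfK ?gt_eqF ?pi_gt0.
Qed.

Lemma weighted_fock_bound k l f : (k + l)%N = n -> fock f ->
  (weighted_mass k (weight_ratio k l) f <= (mass_const n M k)%:E * fock_sqnorm f)%E.
Proof.
move=> kl /entire_cdiff df; have := weighted_estimate bM kl df.
rewrite fock_area// muleA -EFinM -/(mass_const n M k); apply: le_trans.
rewrite le_eqVlt; apply/orP; left; apply/eqP; apply: eq_integral => p _; congr EFin.
by rewrite /weight_ratio exprVn.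
Qed.

Lemma fc_integrand_cintegrable f g : fock f -> fock g ->
  cintegrable mu (fc_integrand alpha beta f g).
Proof.
move=> ff fg; have df := entire_cdiff ff; have dg := entire_cdiff fg.
have [s s0 sE] := fock_sqnormE ff; have [t t0 tE] := fock_sqnormE fg.
have fin : (\int[tv]_p (normc (fc_integrand alpha beta f g p))%:E < +oo)%E.
  apply: le_lt_trans (weighted_form_bound df dg (measurable_weight_ratio alpha beta)
    (measurable_weight_ratio beta alpha) (weight_ratio_ge0 _ _) (weight_ratio_ge0 _ _) (weight_ratioV _ _)) _.
  have ka := weighted_fock_bound hk ff; have kb := weighted_fock_bound (etrans (addnC _ _) hk) fg.
  rewrite sE -EFinM in ka; rewrite tE -EFinM in kb.
  apply: (le_lt_trans (sqrte_pmul_le _ _ ka kb)); last exact: ltry.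
    by rewrite mulr_ge0// mass_const_ge0.
  by rewrite mulr_ge0// mass_const_ge0.
have part k (h : R[i] -> R[i]) (l : R[i] -> R) : cdiff h ->
    (forall z w, `|l z - l w| <= normc (z - w)) ->
    measurable_fun setT (fun p => l (cderiv k h (z_of p))).
  move=> dh ll; apply: measurable_normc_z => // z.
  by apply: cdiff_ccont; exact: cdiff_cderiv.
have lr (z w : R[i]) : `|Re z - Re w| <= normc (z - w) by have := Re_le_normc (z - w); rewrite !ReImE.
have li (z w : R[i]) : `|Im z - Im w| <= normc (z - w) by have := Im_le_normc (z - w); rewrite !ReImE.
have m1 := part alpha f _ df lr; have m2 := part alpha f _ df li.
have m3 := part beta g _ dg lr; have m4 := part beta g _ dg li.
have mg := @measurable_gauss R.
have mRe : measurable_fun setT (fun p => Re (fc_integrand alpha beta f g p)).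
  have -> : (fun p => Re (fc_integrand alpha beta f g p)) = (fun p =>
      (Re (cderiv alpha f (z_of p)) * Re (cderiv beta g (z_of p)) +
       Im (cderiv alpha f (z_of p)) * Im (cderiv beta g (z_of p))) * gauss p).
    by apply/funext => p; rewrite /fc_integrand !ReImE Re_conj Im_conj /=; ring.
  by apply: measurable_funM => //; apply: measurable_funD; exact: measurable_funM.
have mIm : measurable_fun setT (fun p => Im (fc_integrand alpha beta f g p)).
  have -> : (fun p => Im (fc_integrand alpha beta f g p)) = (fun p =>
      (Im (cderiv alpha f (z_of p)) * Re (cderiv beta g (z_of p)) -
       Re (cderiv alpha f (z_of p)) * Im (cderiv beta g (z_of p))) * gauss p).
    by apply/funext => p; rewrite /fc_integrand !ReImE Re_conj Im_conj /=; ring.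
  by apply: measurable_funM => //; apply: measurable_funB; exact: measurable_funM.
have mN : measurable_fun setT (fun p => normc (fc_integrand alpha beta f g p)).
  have -> : (fun p => normc (fc_integrand alpha beta f g p)) = (fun p =>
      normc (cderiv alpha f (z_of p)) * normc (cderiv beta g (z_of p)) * gauss p).
    apply/funext => p; rewrite /fc_integrand !Normc.normcM normc_conj normc_real.
    by rewrite (ger0_norm (expR_ge0 _)).
  apply: measurable_funM => //; apply: measurable_funM.
    exact: (part alpha f (@Normc.normc R) df (@normc_lipschitz R)).
  exact: (part beta g (@Normc.normc R) dg (@normc_lipschitz R)).
split; apply/integrableP; split.
- exact/measurable_EFinP.
- apply: le_lt_trans fin; apply: ge0_le_integral => //.
  + by apply: measurableT_comp => //; apply/measurable_EFinP; exact: mRe.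
  + by apply/measurable_EFinP.
  + by move=> p _; rewrite lee_fin; exact: Re_le_normc.
- exact/measurable_EFinP.
- apply: le_lt_trans fin; apply: ge0_le_integral => //.
  + by apply: measurableT_comp => //; apply/measurable_EFinP; exact: mIm.
  + by apply/measurable_EFinP.
  + by move=> p _; rewrite lee_fin; exact: Im_le_normc.
Qed.

(** Kept in the extended reals: an infinite second factor is harmless when
the first one vanishes. *)
Lemma normc_form_le (rho sigma : R * R -> R) f g : fock f -> fock g ->
  measurable_fun setT rho -> measurable_fun setT sigma ->
  (forall p, 0 <= rho p) -> (forall p, 0 <= sigma p) -> (forall p, rho p * sigma p = 1) ->
  ((normc (fc_form mu alpha beta f g))%:E <=
   sqrte (weighted_mass alpha rho f) * sqrte (weighted_mass beta sigma g))%E.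
Proof.
move=> ff fg mr ms r0 s0 rs; have [hre him] := fc_integrand_cintegrable ff fg.
have h := ball_normc_cintegral_le bM (conj hre him).
apply: le_trans (weighted_form_bound (entire_cdiff ff) (entire_cdiff fg) mr ms r0 s0 rs).
have i0 : (0 <= \int[tv]_p (normc (fc_integrand alpha beta f g p))%:E)%E.
  by apply: integral_ge0 => p _; rewrite lee_fin normc_ge0.
have [fin|inf] := ltP (\int[tv]_p (normc (fc_integrand alpha beta f g p))%:E)%E +oo%E.
  rewrite -ge0_fin_numE// in fin.
  by rewrite -(fineK fin) lee_fin.
exact: le_trans (leey _) inf.
Qed.

Lemma form_bound (rho sigma : R * R -> R) f g (a b : R) : fock f -> fock g -> 0 <= a -> 0 <= b ->
  measurable_fun setT rho -> measurable_fun setT sigma ->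
  (forall p, 0 <= rho p) -> (forall p, 0 <= sigma p) -> (forall p, rho p * sigma p = 1) ->
  (weighted_mass alpha rho f <= a%:E * fock_sqnorm f)%E ->
  (weighted_mass beta sigma g <= b%:E * fock_sqnorm g)%E ->
  normc (fc_form mu alpha beta f g) <= Num.sqrt (a * b) * fock_norm f * fock_norm g.
Proof.
move=> ff fg a0 b0 mr ms r0 s0 rs ha hb.
have [s s_ge0 sE] := fock_sqnormE ff; have [t t_ge0 tE] := fock_sqnormE fg.
rewrite -lee_fin; apply: (le_trans (normc_form_le ff fg mr ms r0 s0 rs)).
rewrite sE -EFinM in ha; rewrite tE -EFinM in hb.
apply: (le_trans (sqrte_pmul_le (mulr_ge0 a0 s_ge0) (mulr_ge0 b0 t_ge0) ha hb)).
by rewrite /fock_norm sE tE lee_fin /= -!sqrtrM ?mulr_ge0// mulrACA mulrA.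
Qed.

End bounded_form.

End form.

Theorem proposition6p1 (R : realType) (k2 : nat) (mu : complex_measure R)
    (alpha beta : nat) (hmu : fc_measure mu k2)
    (hk : (alpha + beta)%N = k2) :
  (forall f g : R[i] -> R[i], fock f -> fock g ->
     cintegrable mu (fc_integrand alpha beta f g)) /\
  (exists C : R,
     [/\ 0 <= C,
         (C%:E <= sqrte (fc_const mu alpha * fc_const mu beta))%E
       & forall f g : R[i] -> R[i], fock f -> fock g ->
           Normc.normc (fc_form mu alpha beta f g)
             <= C * fock_norm f * fock_norm g]).
Proof.
have [M M0 bM] := fc_measure_ball hmu.
split; first by move=> f g; exact: (fc_integrand_cintegrable M0 bM hk).
have m1 : measurable_fun setT (cst 1 : R * R -> R) by exact: measurable_cst.
have bound k f c : fc_bound mu k c -> fock f ->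
    (weighted_mass mu k (cst 1%R) f <= c%:E * fock_sqnorm f)%E.
  by move=> b ff; rewrite /weighted_mass; under eq_integral do rewrite /= mulr1; exact: b.
have sqrtE (a b : R) : sqrte (a%:E * b%:E)%E = (Num.sqrt (a * b))%:E by [].
have ge0 k : (0 <= fc_const mu k)%E.
  by apply: le_ereal_inf_tmp => _ [c [c0 _] <-]; rewrite lee_fin.
(* an infinite product bounds every constant *)
have [pfin|] := ltP (fc_const mu alpha * fc_const mu beta)%E +oo%E; last first.
  rewrite leye_eq => /eqP ->.
  exists (Num.sqrt (mass_const k2 M alpha * mass_const k2 M beta)); split.
  - exact: sqrtr_ge0.
  - exact: leey.
  - move=> f g ff fg; apply: (form_bound M0 bM hk ff fg _ _
      (measurable_weight_ratio alpha beta) (measurable_weight_ratio beta alpha)).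
    + exact: mass_const_ge0.
    + exact: mass_const_ge0.
    + exact: weight_ratio_ge0.
    + exact: weight_ratio_ge0.
    + exact: weight_ratioV.
    + exact: weighted_fock_bound.
    + by apply: weighted_fock_bound => //; rewrite addnC.
have zero f k : fc_const mu k = 0%E -> fock f -> (weighted_mass mu k (cst 1%R) f = 0)%E.
  move=> k0 ff; have [c [_ cE bc]] := @fc_const_attained _ mu k (eq_ind_r (fun x => (x < +oo)%E) (ltry 0) k0).
  apply/le_anti/andP; split.
    by have := bound k f c bc ff; rewrite -cE k0 mul0e.
  apply: integral_ge0 => p _; rewrite lee_fin mulr1; apply: mulr_ge0; [exact: sqmod_ge0|exact: expR_ge0].
have fin0 k l : (fc_const mu k * fc_const mu l < +oo)%E -> fc_const mu l = +oo%E -> fc_const mu k = 0%E.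
  move=> + lE; rewrite lE; case: (eqVneq (fc_const mu k) 0%E) => // k0.
  by rewrite gt0_muley ?ltxx// lt_neqAle eq_sym k0 ge0.
(* a vanishing least constant forces the form to vanish even when the other
   one is infinite, in accordance with 0 * +oo = 0 *)
have degenerate : fc_const mu alpha = 0%E \/ fc_const mu beta = 0%E ->
    exists C : R, [/\ 0 <= C, (C%:E <= sqrte (fc_const mu alpha * fc_const mu beta))%E &
      forall f g : R[i] -> R[i], fock f -> fock g ->
        normc (fc_form mu alpha beta f g) <= C * fock_norm f * fock_norm g].
  move=> z; exists 0; split=> //; first exact: sqrte_ge0.
  move=> f g ff fg; rewrite !mul0r -lee_fin.
  apply: (le_trans (normc_form_le M0 bM hk ff fg m1 m1 _ _ _)) => //.
    by move=> p; rewrite mulr1.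
  by case: z => z; rewrite (zero _ _ z)// sqrte0 ?mul0e ?mule0.
have [fb|] := ltP (fc_const mu beta) +oo%E; last first.
  by rewrite leye_eq => /eqP /(fin0 _ _ pfin) ?; apply: degenerate; left.
have [fa|] := ltP (fc_const mu alpha) +oo%E; last first.
  rewrite leye_eq => /eqP; rewrite muleC in pfin.
  by move=> /(fin0 _ _ pfin) z; apply: degenerate; right.
have [a [a0 aE ba]] := fc_const_attained fa; have [b [b0 bE bb]] := fc_const_attained fb.
exists (Num.sqrt (a * b)); split; [exact: sqrtr_ge0|by rewrite aE bE sqrtE|].
move=> f g ff fg; apply: (form_bound M0 bM hk ff fg a0 b0 m1 m1) => //.
- by move=> p; rewrite mulr1.
- exact: bound.
- exact: bound.
Qed.
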